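(* Let $(\Omega,\mathcal{A},\mu)$ be a probability space, $T:\Omega\to\Omega$ an invertible, ergodic, measure preserving transformation, and $(\mathcal{F}_i)_{i\in\mathbb{Z}}$ a filtration of sub-$\sigma$-algebras of $\mathcal{A}$ with $\mathcal{F}_{i+1}=T^{-1}\mathcal{F}_i$ for all $i\in\mathbb{Z}$. Suppose $f\in L_0^2(\mu)$ is $\mathcal{F}_0$-measurable, $E(f|\mathcal{F}_{-\infty})=0$, and $$\sum_{i\le 0}\Vert P_if\Vert_2<\infty .$$ Then there is a (non-random) normal distribution $G$ such that, for $\mu$-a.e. $\omega$, the (regular) conditional distribution given $\mathcal{F}_0$ of $$\frac{S_n(f)-E(S_n(f)|\mathcal{F}_0)}{\sqrt{n}},$$ evaluated at $\omega$, converges weakly to $G$ as $n\to\infty$.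
   Context: ''Invertible'' means that $T$ is a bijection with measurable inverse. Write $U^ig=g\circ T^i$ for $i\in\mathbb{Z}$, and $S_n(f)=Uf+\cdots+U^nf=\sum_{i=1}^n f\circ T^i$. $L_0^2(\mu)=\{g\in L^2(\mu):\int g\,d\mu=0\}$. $\mathcal{F}_{-\infty}=\bigcap_{i\in\mathbb{Z}}\mathcal{F}_i$. For $g\in L^1(\mu)$, $P_ig=E(g|\mathcal{F}_i)-E(g|\mathcal{F}_{i-1})$. $\Vert\cdot\Vert_2$ is the norm of $L^2(\mu)$. A filtration is increasing: $\mathcal{F}_i\subseteq\mathcal{F}_{i+1}$. The normal distribution with mean $0$ and variance $0$ is the point mass at $0$ and is counted as a normal distribution. *)

(* Defs.v *)
From HB Require Import structures.
From mathcomp Require Import all_boot all_order all_algebra.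
From mathcomp Require Import all_classical all_reals all_analysis.
From mathcomp Require Import measurable_realfun.

Set Implicit Arguments.
Unset Strict Implicit.
Unset Printing Implicit Defensive.

Import Order.TTheory GRing.Theory Num.Theory.
Import numFieldNormedType.Exports.

Local Open Scope classical_set_scope.
Local Open Scope ring_scope.

Section dynamics.
Context d (Omega : measurableType d) (R : realType).
Implicit Types (P : probability Omega R) (T : Omega -> Omega).

Definition invertible T := exists S : Omega -> Omega,
  [/\ cancel T S, cancel S T & measurable_fun setT S].

Definition measure_preserving P T := measurable_fun setT T /\
  forall A, measurable A -> P (T @^-1` A) = P A.

Definition ergodic P T := forall A, measurable A -> T @^-1` A = A ->
  P A = 0%E \/ P A = 1%E.

Definition birkhoff_sum T (f : Omega -> R) (n : nat) : Omega -> R :=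
  fun w => \sum_(1 <= i < n.+1) f (iter i T w).

End dynamics.

(* [g_sigma_algebraType G] is [Omega] equipped with the sigma-algebra
   generated by [G], which is [G] itself when [G] is a sigma-algebra. *)
Definition measurable_wrt (T : pointedType) (G : set (set T)) (R : realType)
    (h : T -> R) :=
  measurable_fun setT (h : g_sigma_algebraType G -> R).

Section conditioning.
Context d (Omega : measurableType d) (R : realType).
Variables (P : probability Omega R) (G : set (set Omega)).

Definition is_cond_exp (g h : Omega -> R) :=
  [/\ measurable_wrt G h,
      P.-integrable setT (EFin \o h) &
      forall A, G.-sigma.-measurable A ->
        (\int[P]_(w in A) (h w)%:E = \int[P]_(w in A) (g w)%:E)%E].

(* A fixed version of E(g | G); the default value is not used when [g] is
   integrable, see [cond_expP]. *)
Definition cond_exp (g : Omega -> R) : Omega -> R :=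
  xget (cst 0) [set h | is_cond_exp g h].

Lemma cond_expP (g : Omega -> R) : G `<=` measurable ->
  P.-integrable setT (EFin \o g) -> is_cond_exp g (cond_exp g).
Proof.
move=> GA intg; rewrite /cond_exp.
suff [h hP] : exists h, is_cond_exp g h by case: xgetP => [y _ //|/(_ h)].
have mG A : G.-sigma.-measurable A -> d.-measurable A.
  by apply: smallest_sub => //; exact: sigma_algebra_measurable.
pose i : Omega -> g_sigma_algebraType G := id.
have mi : measurable_fun setT i by move=> _ A mA; rewrite setTI; exact: mG.
pose nuA : {charge set Omega -> \bar R} := induced_charge intg.
pose X : {mfun Omega >-> g_sigma_algebraType G} :=
  HB.pack i (isMeasurableFun.Build _ _ _ _ i mi).
pose Q : probability _ R := distribution P X.
pose nu : {charge set (g_sigma_algebraType G) -> \bar R} :=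
  measure_function_pushforward__canonical__charge_Charge nuA mi.
have nuQ : nu `<< Q.
  apply/null_content_dominatesP => A mA QA0.
  apply: null_set_integral => //; first exact: mG.
  by case/integrableP: (integrableS measurableT (mG _ mA) (@subsetT _ _) intg).
pose h := Radon_Nikodym nu Q.
have hfin w : h w \is a fin_num by exact: Radon_Nikodym_fin_num.
have hE : EFin \o (fine \o h) = h by apply/funext => w /=; rewrite fineK.
have /integrableP[mh hoo] : Q.-integrable setT h.
  exact: Radon_Nikodym_integrable.
have Ph : P.-integrable setT h.
  apply/integrableP; split.
    by move=> _ B mB; apply: mG; exact: mh.
  move: hoo; rewrite /Q /distribution ge0_integral_pushforward//.
  exact: measurableT_comp mh.
exists (fine \o h); split => //.
- exact: measurableT_comp mh.
- by rewrite hE.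
- move=> A GA'.
  transitivity (\int[P]_(w in A) h w)%E.
    by apply: eq_integral => w _ /=; rewrite fineK.
  have -> : (\int[P]_(w in A) (g w)%:E)%E = nu A by [].
  rewrite (Radon_Nikodym_integral nuQ GA').
  rewrite /Q /distribution (integral_pushforward (phi := X))//.
  by apply: integrableS Ph => //; exact: mG.
Qed.

(* Regular conditional distribution of X given G; since X is real-valued, it
   exists and is unique up to a null set of points [w]. *)
Definition is_cond_distribution (X : Omega -> R)
    (k : R.-pker (g_sigma_algebraType G) ~> (measurableTypeR R)) :=
  forall A B, G.-sigma.-measurable A -> measurable B ->
    (\int[P]_(w in A) k w B = P (A `&` X @^-1` B))%E.

End conditioning.

Definition proj_diff d (Omega : measurableType d) (R : realType)
    (P : probability Omega R) (F : int -> set (set Omega)) (i : int)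
    (g : Omega -> R) : Omega -> R :=
  cond_exp P (F i) g \- cond_exp P (F (i - 1)) g.

(* Laws on the line are measures on [measurableTypeR R], the carrier of the
   library's [normal_prob]. As [normal_prob m 0] is the uniform distribution on
   [0, 1], the degenerate normal distribution is added by hand. *)
Definition normal_law (R : realType) (m s : R) :
    probability (measurableTypeR R) R :=
  if s == 0 then (@dirac _ (measurableTypeR R) m R : probability _ R)
  else normal_prob m s.

Definition weak_cvg (R : realType)
    (mu : nat -> {measure set (measurableTypeR R) -> \bar R})
    (nu : {measure set (measurableTypeR R) -> \bar R}) :=
  forall phi : R -> R, continuous phi -> bounded_fun phi ->
    \int[mu n]_x phi x @[n --> \oo] --> \int[nu]_x phi x.

(* Main.v *)
Require Import Defs.
From HB Require Import structures.
From mathcomp Require Import finmap.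
From mathcomp Require Import all_boot all_order all_algebra.
From mathcomp Require Import all_classical all_reals all_analysis.
From mathcomp Require Import measurable_realfun.
From mathcomp Require Import zify ring lra.

Set Implicit Arguments.
Unset Strict Implicit.
Unset Printing Implicit Defensive.

Import Order.TTheory GRing.Theory Num.Theory.
Import numFieldNormedType.Exports.

Local Open Scope classical_set_scope.
Local Open Scope ring_scope.


(** Write [E0] for conditional expectation given [F 0], [Q g = E0 (g o T)] and
    [Y_j = (P_{-j} f) o T^j]. Each [Y_j] is [F 0]-measurable with conditional mean zero given
    [F (-1)], and by hypothesis the L2 norms of the [Y_j] are summable. So [D = sum_j Y_j] is a
    square integrable martingale difference. Telescoping the conditional expectations of [f] gives
    [S_n - E0 S_n = M_n - R_n], where [M_n = sum_{1 <= i <= n} D o T^i],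
    [R_n = sum_{k < n} rho_{n-k} o T^{k+1}] and [rho_m = sum_{j >= m} Y_j]. The limit is the centred
    normal law of variance [E D^2].

    The pointwise tool is [quenched_ergodic]: for [F 0]-measurable integrable [g], the averages of
    [E0 (g o T^k)] converge almost everywhere to the mean of [g]. Bounded [g] follow from Birkhoff's
    theorem by conditional bounded convergence; truncation errors are controlled by Hopf's maximal
    inequality for the positive operator [Q].

    Remainder: a weighted Cauchy-Schwarz inequality ([weighted_series]) gives [rho_m^2 <= wt_m H]
    with one integrable [H] and numbers [wt_m] tending to zero. Orthogonality of the increments and
    [quenched_ergodic] for [H] then yield [E0 (R_n^2) / n -> 0] almost everywhere.

    Martingale part ([quenched_martingale_clt]): with [c = t^2 E D^2 / 2], the process [exp (- c (1
    - k/n)) cos (t M_k / sqrt n + th)] leads from [exp (- c) cos th] at [k = 0] to the cosine of the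
    full sum at [k = n]. Taylor expansion of each step leaves a martingale difference, a Lindeberg
    error, and a multiple of [D^2 - E D^2]. By [coboundary] the latter is [g - Q g + r] with [r]
    small in L1; the coboundary is removed by conditioning and Abel summation. All remaining errors
    are ergodic averages.

    Passage to laws: integrals against the conditional distribution agree almost everywhere with
    conditional expectations. Countably many cosines and a bound on second moments suffice for weak
    convergence ([levy_criterion], through Bernstein polynomials in a sine). [normal_law_cos]
    identifies the limit. *)

Section integrable_real.

(** * Expectations of real-valued integrable functions *)

Context d (T : measurableType d) (R : realType) (mu : {finite_measure set T -> \bar R}).
Implicit Types (f g : T -> R).

Local Notation intg f := (mu.-integrable setT (EFin \o f)).
Local Notation Ex f := (Rintegral mu setT f).

Lemma intg_meas f : intg f -> measurable_fun setT f.
Proof. by move/measurable_int/measurable_EFinP. Qed.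

Lemma intgD f g : intg f -> intg g -> intg (fun w => f w + g w).
Proof. by move=> hf hg; have := integrableD measurableT hf hg. Qed.

Lemma intgB f g : intg f -> intg g -> intg (fun w => f w - g w).
Proof. by move=> hf hg; have := integrableB measurableT hf hg. Qed.

Lemma intgZ (c : R) f : intg f -> intg (fun w => c * f w).
Proof. by move=> hf; have := integrableZl measurableT c hf. Qed.

Lemma intgN f : intg f -> intg (fun w => - f w).
Proof. by move=> hf; have := integrableN hf. Qed.

Lemma intg_abs f : intg f -> intg (fun w => `|f w|).
Proof. by move=> hf; have := integrable_abse hf. Qed.

Lemma intg_cst (c : R) : intg (fun=> c).
Proof.
apply: measurable_bounded_integrable => //; first by rewrite -ge0_fin_numE// fin_num_measure.
exact: bounded_cst.
Qed.

Lemma intg_sum (I : Type) (s : seq I) (P : pred I) (h : I -> T -> R) :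
  (forall i, intg (h i)) -> intg (fun w => \sum_(i <- s | P i) h i w).
Proof.
move=> hi; elim: s => [|i s ih].
  by under eq_fun do rewrite big_nil; exact: intg_cst.
under eq_fun do rewrite big_cons.
by case: (P i) => //; exact: intgD.
Qed.

Lemma intg_le f g : measurable_fun setT f -> intg g ->
  (forall w, `|f w| <= g w) -> intg f.
Proof.
move=> mf ig fg; apply: le_integrable ig => //; first exact/measurable_EFinP.
by move=> w _ /=; rewrite lee_fin (le_trans (fg w))// ler_norm.
Qed.

Lemma intg_bdM f g (c : R) : measurable_fun setT f -> (forall w, `|f w| <= c) ->
  intg g -> intg (fun w => f w * g w).
Proof.
move=> mf fc ig; apply: (@intg_le _ (fun w => c * `|g w|)).
- by apply: measurable_funM => //; exact: intg_meas.
- exact/intgZ/intg_abs.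
- by move=> w; rewrite normrM ler_wpM2r.
Qed.

Lemma intgM f g : measurable_fun setT f -> measurable_fun setT g ->
  intg (fun w => f w ^+ 2) -> intg (fun w => g w ^+ 2) ->
  intg (fun w => f w * g w).
Proof.
move=> mf mg hf hg; apply: (@intg_le _ (fun w => f w ^+ 2 + g w ^+ 2)).
- exact: measurable_funM.
- exact: intgD.
- move=> w; have := sqr_ge0 (f w + g w); have := sqr_ge0 (f w - g w).
  rewrite ler_norml /= => h1 h2.
  by apply/andP; split; have := sqr_ge0 (f w); have := sqr_ge0 (g w); lra.
Qed.

Lemma intg_sqrD f g : measurable_fun setT f -> measurable_fun setT g ->
  intg (fun w => f w ^+ 2) -> intg (fun w => g w ^+ 2) ->
  intg (fun w => (f w + g w) ^+ 2).
Proof.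
move=> mf mg hf hg; apply: (@intg_le _ (fun w => 2 * f w ^+ 2 + 2 * g w ^+ 2)).
- by apply: measurable_funX; exact: measurable_funD.
- by apply: intgD; exact: intgZ.
- by move=> w; rewrite ger0_norm ?sqr_ge0//=; have := sqr_ge0 (f w - g w); lra.
Qed.

Lemma intg_sqr f : measurable_fun setT f -> intg (fun w => f w ^+ 2) -> intg f.
Proof.
move=> mf hf; apply: (@intg_le _ (fun w => 1 + f w ^+ 2)) => //.
  by apply: intgD => //; exact: intg_cst.
move=> w; have := sqr_ge0 (1 + f w); have := sqr_ge0 (1 - f w).
rewrite ler_norml /= => h1 h2.
by apply/andP; split; have := sqr_ge0 (f w); lra.
Qed.

Lemma intg_indicM (A : set T) f : measurable A -> intg f ->
  intg (fun w => \1_A w * f w).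
Proof.
move=> mA; apply: (@intg_bdM _ _ 1) => //.
by move=> w; rewrite indicE ger0_norm// lern1; case: (_ \in _).
Qed.

Lemma Rintegral_indicM (A : set T) f : measurable A ->
  Rintegral mu A f = Ex (fun w => \1_A w * f w).
Proof.
move=> mA; rewrite Rintegral_mkcond; apply: eq_Rintegral => w _.
by rewrite /patch indicE; case: ifP => _; rewrite ?mul1r ?mul0r.
Qed.

Lemma ExD f g : intg f -> intg g -> Ex (fun w => f w + g w) = Ex f + Ex g.
Proof. by move=> hf hg; exact: RintegralD. Qed.

Lemma ExB f g : intg f -> intg g -> Ex (fun w => f w - g w) = Ex f - Ex g.
Proof. by move=> hf hg; exact: RintegralB. Qed.

Lemma ExZ (c : R) f : intg f -> Ex (fun w => c * f w) = c * Ex f.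
Proof. by move=> hf; exact: RintegralZl. Qed.

Lemma ExN f : intg f -> Ex (fun w => - f w) = - Ex f.
Proof.
by move=> hf; under eq_Rintegral do rewrite -mulN1r; rewrite ExZ// mulN1r.
Qed.

Lemma Ex_sum (I : Type) (s : seq I) (P : pred I) (h : I -> T -> R) :
  (forall i, intg (h i)) ->
  Ex (fun w => \sum_(i <- s | P i) h i w) = \sum_(i <- s | P i) Ex (h i).
Proof.
move=> hi; elim: s => [|i s ih].
  under eq_Rintegral do rewrite big_nil.
  by rewrite big_nil Rintegral_cst// mul0r.
under eq_Rintegral do rewrite big_cons.
rewrite big_cons; case: (P i) => //.
by rewrite ExD ?ih//; exact: intg_sum.
Qed.

Lemma Ex_ae_eq f g : measurable_fun setT f -> measurable_fun setT g ->
  {ae mu, forall w, f w = g w} -> Ex f = Ex g.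
Proof.
move=> mf mg fg; congr fine; apply: ae_eq_integral => //; try exact/measurable_EFinP.
by move: fg; apply: filterS => w -> _.
Qed.

Lemma Ex_ge0 f : intg f -> {ae mu, forall w, 0 <= f w} -> 0 <= Ex f.
Proof.
move=> hf f0; have mf := intg_meas hf.
rewrite (@Ex_ae_eq _ (fun w => `|f w|)) ?Rintegral_ge0//.
  exact: measurableT_comp.
by move: f0; apply: filterS => w f0; rewrite ger0_norm.
Qed.

Lemma Ex_le f g : intg f -> intg g -> {ae mu, forall w, f w <= g w} -> Ex f <= Ex g.
Proof.
move=> hf hg fg; rewrite -subr_ge0 -ExB//; apply: Ex_ge0; first exact: intgB.
by move: fg; apply: filterS => w; rewrite subr_ge0.
Qed.

Lemma intg_ae f g : measurable_fun setT g -> intg f -> {ae mu, forall w, f w = g w} -> intg g.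
Proof.
move=> mg /integrableP[mf foo] fg; apply/integrableP; split; first exact/measurable_EFinP.
rewrite (@ae_eq_integral _ _ _ _ _ (fun w => `|(f w)%:E|)%E)//.
- by apply: measurableT_comp => //; exact/measurable_EFinP.
- by apply: measurableT_comp => //; exact/measurable_EFinP.
- by move: fg; apply: filterS => w -> _.
Qed.

Lemma Ex_abs_le f : intg f -> `|Ex f| <= Ex (fun w => `|f w|).
Proof. by move=> hf; exact: le_normr_Rintegral. Qed.

Lemma Ex_ge0_eq0 f : intg f -> {ae mu, forall w, 0 <= f w} -> Ex f <= 0 ->
  {ae mu, forall w, f w = 0}.
Proof.
move=> hf f0 Ef.
have /(ae_eq_integral_abs mu measurableT (measurable_int _ hf)) : (\int[mu]_w `|(f w)%:E| = 0)%E.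
  rewrite -[LHS]fineK; last by apply: integrable_fin_num => //; exact: integrable_abse.
  congr (_%:E); apply/eqP; rewrite eq_le; apply/andP; split; last first.
    by apply: Rintegral_ge0 => w _.
  rewrite (le_trans _ Ef)//; change (Ex (fun w => `|f w|) <= Ex f).
  apply: Ex_le => //; first exact: intg_abs.
  by move: f0; apply: filterS => w /ger0_norm ->.
by apply: filterS => w /(_ I) [].
Qed.

Lemma Ex_dct (f_ : nat -> T -> R) f g :
  (forall n, measurable_fun setT (f_ n)) -> measurable_fun setT f -> intg g ->
  {ae mu, forall w, f_ n w @[n --> \oo] --> f w} ->
  (forall n, {ae mu, forall w, `|f_ n w| <= g w}) ->
  intg f /\ Ex (f_ n) @[n --> \oo] --> Ex f.
Proof.
move=> mf_ mf ig fl fg.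
have [|||//||if_ _ cv] := @dominated_convergence _ _ _ mu setT measurableT
    (fun n => EFin \o f_ n) (EFin \o f) (EFin \o g).
- by move=> n; exact/measurable_EFinP.
- exact/measurable_EFinP.
- move: fl; apply: filterS => w fl _.
  by apply: cvg_EFin; [exact: nearW|exact: fl].
- move/ae_foralln : fg; apply: filterS => w fg n _ /=.
  by rewrite lee_fin.
split => //; apply: fine_cvg.
by rewrite fineK//; exact: integrable_fin_num.
Qed.

Lemma Ex_markov f (e : R) : 0 < e -> intg f -> {ae mu, forall w, 0 <= f w} ->
  (mu [set w | (e < f w)%R] <= (Ex f / e)%:E)%E.
Proof.
move=> e0 hf f0; have mA : measurable [set w | e < f w].
  rewrite -[X in measurable X]setTI.
  have := intg_meas hf measurableT (measurable_itv `]e, +oo[).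
  by congr measurable; apply/seteqP; split => w /=; rewrite ?in_itv/= ?andbT.
rewrite -(@fineK _ (mu _)); last exact: fin_num_measure.
rewrite lee_fin ler_pdivlMr// mulrC -[X in e * X]mul1r -Rintegral_cst//.
rewrite (Rintegral_indicM _ mA) -ExZ; last by apply: intg_indicM => //; exact: intg_cst.
apply: Ex_le => //; first by apply/intgZ/intg_indicM => //; exact: intg_cst.
move: f0; apply: filterS => w f0; rewrite indicE.
case: (boolP (w \in _)) => [|_]; last by rewrite !mul0r mulr0.
by rewrite inE/= => /ltW; rewrite !mul1r mulr1.
Qed.

End integrable_real.

(** * Calculus of conditional expectations through their defining property *)

Section cond_exp_theory.
Import HBNNSimple.
Context d (T : measurableType d) (R : realType) (P : probability T R).
Variables (G : set (set T)).
Hypothesis GA : G `<=` measurable.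
Implicit Types (f g h b : T -> R).

Local Notation intg f := (P.-integrable setT (EFin \o f)).
Local Notation Ex f := (Rintegral P setT f).

Lemma sub_measurable A : G.-sigma.-measurable A -> d.-measurable A.
Proof. by apply: smallest_sub => //; exact: sigma_algebra_measurable. Qed.

Lemma wrt_measurable h : measurable_wrt G h -> measurable_fun setT h.
Proof. by move=> mh _ B mB; apply: sub_measurable; exact: mh. Qed.

Lemma wrt_comp (phi : R -> R) h : measurable_fun setT phi -> measurable_wrt G h ->
  measurable_wrt G (fun w => phi (h w)).
Proof. by move=> mphi mh; exact: (@measurableT_comp _ _ _ _ _ _ phi _ (h : g_sigma_algebraType G -> R)). Qed.

Lemma wrt_indic A : G.-sigma.-measurable A -> measurable_wrt G (\1_A : T -> R).
Proof. by move=> mA; apply: measurable_indic. Qed.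

Lemma cond_exp_indic g h A : is_cond_exp P G g h -> G.-sigma.-measurable A ->
  Ex (fun w => \1_A w * h w) = Ex (fun w => \1_A w * g w).
Proof.
move=> [mh ih hA] mA; rewrite -!Rintegral_indicM; try exact: sub_measurable.
by congr fine; exact: hA.
Qed.

Lemma is_cond_exp_indic g h : intg g -> measurable_wrt G h -> intg h ->
  (forall A, G.-sigma.-measurable A ->
    Ex (fun w => \1_A w * h w) = Ex (fun w => \1_A w * g w)) ->
  is_cond_exp P G g h.
Proof.
move=> ig mh ih hA; split => // A mA.
have mA' := sub_measurable mA.
have := congr1 EFin (hA _ mA); rewrite -!Rintegral_indicM//.
rewrite !fineK//; apply: integrable_fin_num => //.
  by apply: integrableS ig.
by apply: integrableS ih.
Qed.

(** The set where [h' < h] is [G]-measurable, and on it a nonnegative function would have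
    nonpositive integral. A hypothesis on integrals over sets of [G] serves uniqueness, monotonicity
    and the relation [E0_dom] alike. *)
Lemma cond_exp_le f f' h h' : intg f -> intg f' ->
  is_cond_exp P G f h -> is_cond_exp P G f' h' ->
  (forall A, G.-sigma.-measurable A ->
    Ex (fun w => \1_A w * f w) <= Ex (fun w => \1_A w * f' w)) ->
  {ae P, forall w, h w <= h' w}.
Proof.
move=> if_ if' hc hc' le; have [[mh ih _] [mh' ih' _]] := (hc, hc').
pose A := [set w | h' w < h w].
have mA : G.-sigma.-measurable A.
  have := measurable_fun_ltr mh' mh; move=> /(_ measurableT [set true]).
  by rewrite setTI; apply.
have mA' := sub_measurable mA.
have ihh : intg (fun w => \1_A w * (h w - h' w)).
  by apply: intg_indicM => //; exact: intgB.
have A0 w : 0 <= \1_A w * (h w - h' w).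
  rewrite indicE; case: (boolP (w \in A)) => [|_]; last by rewrite mul0r.
  by rewrite inE /A/= mul1r subr_ge0 => /ltW.
have : {ae P, forall w, \1_A w * (h w - h' w) = 0}.
  apply: Ex_ge0_eq0 => //; first exact: aeW.
  under eq_Rintegral do rewrite mulrBr.
  rewrite ExB; try exact: intg_indicM.
  by rewrite (cond_exp_indic hc)// (cond_exp_indic hc')// subr_le0 le.
apply: filterS => w; rewrite indicE; have [//|lt] := leP (h w) (h' w).
by rewrite mem_set//= mul1r => /eqP; rewrite subr_eq0 => /eqP lt'; rewrite lt' ltxx in lt.
Qed.

Lemma cond_exp_unique f f' h h' : intg f -> intg f' ->
  is_cond_exp P G f h -> is_cond_exp P G f' h' ->
  (forall A, G.-sigma.-measurable A ->
    Ex (fun w => \1_A w * f w) = Ex (fun w => \1_A w * f' w)) ->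
  {ae P, forall w, h w = h' w}.
Proof.
move=> if_ if' hc hc' e.
have := @cond_exp_le f f' h h' if_ if' hc hc'.
move=> /(_ (fun A mA => eq_ind _ (fun x => _ <= x) (lexx _) _ (e A mA))).
have := @cond_exp_le f' f h' h if' if_ hc' hc.
move=> /(_ (fun A mA => eq_ind _ (fun x => x <= _) (lexx _) _ (e A mA))).
by apply: filterS2 => w h1 h2; apply/eqP; rewrite eq_le h1 h2.
Qed.

Lemma cond_exp_mono f f' h h' : intg f -> intg f' ->
  is_cond_exp P G f h -> is_cond_exp P G f' h' ->
  {ae P, forall w, f w <= f' w} -> {ae P, forall w, h w <= h' w}.
Proof.
move=> if_ if' hc hc' le; apply: (cond_exp_le if_ if' hc hc') => A mA.
have mA' := sub_measurable mA.
apply: Ex_le; try exact: intg_indicM.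
by move: le; apply: filterS => w le; rewrite ler_wpM2l.
Qed.

Let pull_simple g h (b : {nnsfun (g_sigma_algebraType G) >-> R}) :
  intg g -> is_cond_exp P G g h ->
  Ex (fun w => b w * h w) = Ex (fun w => b w * g w).
Proof.
move=> ig hc; have [mh ih _] := hc.
have E (k : T -> R) : intg k -> Ex (fun w => b w * k w) =
    \sum_(y <- fset_set (range b)) y * Ex (fun w => \1_(b @^-1` [set y]) w * k w).
  move=> ik.
  have mb y : d.-measurable (b @^-1` [set y]).
    apply: sub_measurable; rewrite -[X in measurable X]setTI.
    exact: (@measurable_funPT _ _ _ _ b).
  have ib y : intg (fun w => \1_(b @^-1` [set y]) w * k w) by exact: intg_indicM.
  rewrite (_ : (fun w => b w * k w) = fun w =>
      \sum_(y <- fset_set (range b)) y * (\1_(b @^-1` [set y]) w * k w)).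
    rewrite Ex_sum; last by move=> y; exact: intgZ.
    by apply: eq_bigr => y _; rewrite ExZ.
  apply/funext => w; rewrite {1}(fimfunE b w) fsbig_finite//= mulr_suml.
  by apply: eq_bigr => y _; rewrite mulrA.
rewrite (E h)// (E g)//; apply: eq_bigr => y _; congr (_ * _).
apply: (cond_exp_indic hc); rewrite -[X in _.-measurable X]setTI.
exact: (@measurable_funPT _ _ _ _ b).
Qed.

Let pull_ge0 g h b : intg g -> is_cond_exp P G g h -> measurable_wrt G b ->
  (forall w, 0 <= b w) ->
  intg (fun w => b w * g w) -> intg (fun w => b w * h w) ->
  Ex (fun w => b w * h w) = Ex (fun w => b w * g w).
Proof.
move=> ig hc mb b0 ibg ibh; have [mh ih _] := hc.
(* The approximation is built on the carrier with the sigma-algebra of [G], so that each simple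
   function [bn n] is itself [G]-measurable. *)
pose S := g_sigma_algebraType G.
have meb : measurable_fun [set: S] (EFin \o (b : S -> R)) by exact/measurable_EFinP.
pose bn := @nnsfun_approx _ S R setT measurableT (EFin \o b) meb.
have eb0 (w : S) : setT w -> (0 <= (EFin \o b) w)%E by rewrite /= lee_fin.
have bn_le n w : bn n w <= b w.
  by rewrite /bn nnsfun_approxE -lee_fin; exact: (@le_approx _ S R setT (EFin \o b) n w eb0 I).
have bn_cvg w : bn n w @[n --> \oo] --> b w.
  have := @cvg_nnsfun_approx _ S R setT measurableT _ meb eb0 w I.
  by move/fine_cvg.
have mbn n : measurable_fun setT (bn n : T -> R).
  by apply: wrt_measurable; exact: measurable_funPT.
have lim k : intg k -> intg (fun w => b w * k w) ->
    Ex (fun w => bn n w * k w) @[n --> \oo] --> Ex (fun w => b w * k w).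
  move=> ik ibk.
  apply: (proj2 (@Ex_dct _ _ _ P (fun n w => bn n w * k w) (fun w => b w * k w)
     (fun w => `|b w * k w|) _ _ _ _ _)).
  - by move=> n; apply: measurable_funM => //; exact: (intg_meas ik).
  - exact: (intg_meas ibk).
  - exact: intg_abs.
  - by apply: aeW => w; apply: cvgMr_tmp; exact: bn_cvg.
  - move=> n; apply: aeW => w; rewrite !normrM ler_wpM2r//.
    by rewrite !ger0_norm//; exact: bn_le.
have hl := lim _ ih ibh; have gl := lim _ ig ibg.
have e : (fun n => Ex (fun w => bn n w * h w)) = (fun n => Ex (fun w => bn n w * g w)).
  by apply/funext => n; exact: pull_simple.
rewrite e in hl; exact: (cvg_unique (@Rhausdorff R) hl gl).
Qed.

(** Simple [b] by linearity, nonnegative [b] by dominated convergence along simple functions below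
    [b], and signed [b] by splitting into positive and negative parts. *)
Lemma cond_exp_pull g h b : intg g -> is_cond_exp P G g h -> measurable_wrt G b ->
  intg (fun w => b w * g w) -> intg (fun w => b w * h w) ->
  Ex (fun w => b w * h w) = Ex (fun w => b w * g w).
Proof.
move=> ig hc mb ibg ibh; have [mh ih _] := hc.
have wb := wrt_measurable mb.
pose bp w := Num.max (b w) 0; pose bm w := Num.max (- b w) 0.
have mbp : measurable_wrt G bp by apply: measurable_maxr => //; exact: measurable_cst.
have mbm : measurable_wrt G bm.
  by apply: measurable_maxr; [exact: measurableT_comp mb|exact: measurable_cst].
have bE w : b w = bp w - bm w.
  by rewrite /bp /bm; case: ltrP => ?; case: ltrP => ?; lra.
have bp0 w : 0 <= bp w by rewrite le_max lexx orbT.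
have bm0 w : 0 <= bm w by rewrite le_max lexx orbT.
have bpb w : `|bp w| <= `|b w| by rewrite ger0_norm// ge_max ler_norm/=.
have bmb w : `|bm w| <= `|b w| by rewrite ger0_norm// ge_max -normrN ler_norm/=.
have I c k : measurable_wrt G c -> (forall w, `|c w| <= `|b w|) -> intg k ->
    intg (fun w => b w * k w) -> intg (fun w => c w * k w).
  move=> mc cb ik ibk; apply: intg_le (intg_abs ibk) _.
    by apply: measurable_funM; [exact: wrt_measurable|exact: (intg_meas ik)].
  by move=> w; rewrite !normrM ler_wpM2r.
have E k : intg k -> intg (fun w => b w * k w) -> Ex (fun w => b w * k w) =
    Ex (fun w => bp w * k w) - Ex (fun w => bm w * k w).
  move=> ik ibk; rewrite -ExB; try exact: I.
  by apply: eq_Rintegral => w _; rewrite -mulrBl -bE.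
by rewrite !E//; congr (_ - _); apply: pull_ge0 => //; exact: I.
Qed.

Lemma is_cond_expM g h b : intg g -> is_cond_exp P G g h -> measurable_wrt G b ->
  intg (fun w => b w * g w) -> intg (fun w => b w * h w) ->
  is_cond_exp P G (fun w => b w * g w) (fun w => b w * h w).
Proof.
move=> ig hc mb ibg ibh; have [mh ih _] := hc.
apply: is_cond_exp_indic => //; first exact: measurable_funM.
move=> A mA; have mA' := sub_measurable mA.
under eq_Rintegral do rewrite mulrA.
under [RHS]eq_Rintegral do rewrite mulrA.
apply: (@cond_exp_pull g h (fun w => \1_A w * b w) ig hc).
- by apply: measurable_funM => //; exact: measurable_indic.
- by under eq_fun do rewrite -mulrA; exact: (@intg_indicM _ _ _ P _ _ mA' ibg).
- by under eq_fun do rewrite -mulrA; exact: (@intg_indicM _ _ _ P _ _ mA' ibh).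
Qed.

Lemma is_cond_exp_id g : measurable_wrt G g -> intg g -> is_cond_exp P G g g.
Proof. by []. Qed.

Lemma is_cond_expD g h g' h' : intg g -> intg g' -> is_cond_exp P G g h ->
  is_cond_exp P G g' h' ->
  is_cond_exp P G (fun w => g w + g' w) (fun w => h w + h' w).
Proof.
move=> ig ig' hc hc'; have [[mh ih _] [mh' ih' _]] := (hc, hc').
apply: is_cond_exp_indic; try exact: intgD; first exact: measurable_funD.
move=> A mA; have mA' := sub_measurable mA.
under eq_Rintegral do rewrite mulrDr.
under [RHS]eq_Rintegral do rewrite mulrDr.
by rewrite !ExD ?(cond_exp_indic hc)// ?(cond_exp_indic hc')//; exact: intg_indicM.
Qed.

Lemma is_cond_expZ g h (c : R) : intg g -> is_cond_exp P G g h ->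
  is_cond_exp P G (fun w => c * g w) (fun w => c * h w).
Proof.
move=> ig hc; have [mh ih _] := hc.
apply: (is_cond_expM ig hc); first exact: measurable_cst.
- exact: intgZ.
- exact: intgZ.
Qed.

Lemma is_cond_expB g h g' h' : intg g -> intg g' -> is_cond_exp P G g h ->
  is_cond_exp P G g' h' ->
  is_cond_exp P G (fun w => g w - g' w) (fun w => h w - h' w).
Proof.
move=> ig ig' hc /(is_cond_expZ (-1) ig') hc'.
have := is_cond_expD ig (intgZ (-1) ig') hc hc'.
by under eq_fun do rewrite mulN1r; under [X in is_cond_exp _ _ _ X]eq_fun do rewrite mulN1r.
Qed.

Lemma is_cond_exp_sum (I : Type) (s : seq I) (g h : I -> T -> R) :
  (forall i, intg (g i)) -> (forall i, is_cond_exp P G (g i) (h i)) ->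
  is_cond_exp P G (fun w => \sum_(i <- s) g i w) (fun w => \sum_(i <- s) h i w).
Proof.
move=> ig hc; elim: s => [|i s ih].
  under eq_fun do rewrite big_nil; under [X in is_cond_exp _ _ _ X]eq_fun do rewrite big_nil.
  by apply: is_cond_exp_id; [exact: measurable_cst|exact: intg_cst].
under eq_fun do rewrite big_cons; under [X in is_cond_exp _ _ _ X]eq_fun do rewrite big_cons.
by apply: is_cond_expD => //; exact: intg_sum.
Qed.

Lemma is_cond_exp_ae g g' h : intg g -> intg g' -> {ae P, forall w, g w = g' w} ->
  is_cond_exp P G g h -> is_cond_exp P G g' h.
Proof.
move=> ig ig' e hc; have [mh ih _] := hc.
apply: is_cond_exp_indic => // A mA; have mA' := sub_measurable mA.
rewrite (cond_exp_indic hc)//; apply: Ex_ae_eq.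
- by apply: measurable_funM => //; exact: intg_meas ig.
- by apply: measurable_funM => //; exact: intg_meas ig'.
- by move: e; apply: filterS => w ->.
Qed.

Lemma Ex_cond_exp g h : is_cond_exp P G g h -> Ex h = Ex g.
Proof.
move=> hc; have := cond_exp_indic hc (@measurableT _ (g_sigma_algebraType G)).
by under eq_Rintegral do rewrite indicT mul1r; under [RHS]eq_Rintegral do rewrite indicT mul1r.
Qed.

End cond_exp_theory.

Lemma cond_exp_tower d (T : measurableType d) (R : realType) (P : probability T R)
    (G G' : set (set T)) (g h' h : T -> R) :
  G' `<=` measurable -> G `<=` G' -> P.-integrable setT (EFin \o g) ->
  is_cond_exp P G' g h' -> is_cond_exp P G h' h -> is_cond_exp P G g h.
Proof.
move=> mG' GG' ig hc' hc; have [[_ ih' _] [mh ih _]] := (hc', hc).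
have mG : G `<=` measurable by exact: subset_trans mG'.
apply: is_cond_exp_indic => // A mA.
rewrite (cond_exp_indic mG hc)// (cond_exp_indic mG' hc')//.
by move: mA; apply: sub_sigma_algebra2.
Qed.

(** * A criterion for almost everywhere convergence to zero *)

Section almost_everywhere_convergence.
Context d (T : measurableType d) (R : realType) (P : probability T R).

Lemma natr_ge (x : R) : exists N : nat, forall n, (N <= n)%N -> x <= n%:R.
Proof.
by have [N _ HN] := nbhs_infty_ger x; exists N => n; exact: HN.
Qed.

(** For each precision, bad sets of measure [1/(i+1)] intersect in a null set. This form suits
    maximal and Markov inequalities, which only bound the measure of a bad set. *)
Lemma ae_cvg0 (a : nat -> T -> R) :
  (forall e eta : R, 0 < e -> 0 < eta -> exists B : set T,
    [/\ measurable B, (P B <= eta%:E)%E &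
     {ae P, forall w, ~ B w -> exists N : nat, forall n, (N <= n)%N -> `|a n w| <= e}]) ->
  {ae P, forall w, a n w @[n --> \oo] --> 0}.
Proof.
move=> H.
suff : {ae P, forall w, forall j : nat, exists N : nat, forall n, (N <= n)%N ->
    `|a n w| <= j.+1%:R^-1}.
  apply: filterS => w Hw; apply/cvgrPdist_le => e e0.
  have [j je] : exists j : nat, j.+1%:R^-1 <= e.
    have [N HN] := natr_ge e^-1; exists N.
    by rewrite -[e]invrK lef_pV2 ?posrE ?invr_gt0//; apply: HN.
  have [N HN] := Hw j; exists N => // n /= Nn.
  by rewrite sub0r normrN (le_trans (HN _ Nn)).
apply: ae_foralln => j.
have j0 : 0 < j.+1%:R^-1 :> R by rewrite invr_gt0.
have /choice[B HB] : forall i : nat, exists B : set T,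
    [/\ measurable B, (P B <= (i.+1%:R^-1 : R)%:E)%E &
     {ae P, forall w, ~ B w -> exists N : nat, forall n, (N <= n)%N -> `|a n w| <= j.+1%:R^-1}].
  by move=> i; apply: H => //; rewrite invr_gt0.
have mB : measurable (\bigcap_i B i) by apply: bigcapT_measurable => i; have [] := HB i.
have B0 : P (\bigcap_i B i) = 0%E.
  apply/eqP; rewrite eq_le measure_ge0 andbT; apply/lee_addgt0Pr => e e0.
  rewrite add0e; have [N HN] := natr_ge e^-1.
  apply: (@le_trans _ _ (P (B N))).
    by apply: le_measure; rewrite ?inE//; [have [] := HB N|exact: bigcap_inf].
  have [_ /le_trans + _] := HB N; apply; rewrite lee_fin -[e]invrK.
  by rewrite lef_pV2 ?posrE ?invr_gt0//; apply: HN.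
have : {ae P, forall w, ~ (\bigcap_i B i) w}.
  by exists (\bigcap_i B i); split => // w /= /contrapT.
have : {ae P, forall w, forall i, ~ B i w -> exists N : nat, forall n, (N <= n)%N ->
    `|a n w| <= j.+1%:R^-1}.
  by apply: ae_foralln => i; have [] := HB i.
apply: filterS2 => w h1 h2.
by have [i /h1] : exists i, ~ B i w by apply/existsNP => h; apply: h2 => i _.
Qed.

End almost_everywhere_convergence.

(** * Hopf's maximal inequality for a positive integral-preserving operator *)

Section maximal.
Context d (T : measurableType d) (R : realType) (P : probability T R).
Implicit Types (f g h : T -> R).
Local Notation intg f := (P.-integrable setT (EFin \o f)).
Local Notation Ex f := (Rintegral P setT f).

Variable V : (T -> R) -> (T -> R).
Hypothesis V_int : forall g, intg g -> intg (V g).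
Hypothesis V_Ex : forall g, intg g -> Ex (V g) = Ex g.
Hypothesis V_le : forall f g, intg f -> intg g ->
  {ae P, forall w, f w <= g w} -> {ae P, forall w, V f w <= V g w}.
Hypothesis V_ge0 : forall g, intg g -> (forall w, 0 <= g w) ->
  {ae P, forall w, 0 <= V g w}.
Variable h : T -> R.
Hypothesis ih : intg h.

(** Horner form of [h + V h + ... + V^(n-1) h]. The section is applied to composition with [T] and
    to the Markov operator [Q]; the latter acts through chosen versions, hence the order properties
    of [V] are only almost everywhere. *)
Fixpoint orbit_sum n : T -> R :=
  if n is n'.+1 then fun w => h w + V (orbit_sum n') w else fun=> 0.

(** Applying [V] to the previous maximum, instead of taking the maximum of the sums, gives a
    majorant of all [orbit_sum] up to [n] by monotonicity of [V] alone. *)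
Fixpoint orbit_max n : T -> R :=
  if n is n'.+1 then fun w => Num.max (orbit_max n' w) (h w + V (orbit_max n') w)
  else fun=> 0.

Lemma orbit_sum_int n : intg (orbit_sum n).
Proof. by elim: n => [|n IH] /=; [exact: intg_cst|apply: intgD => //; exact: V_int]. Qed.

Lemma orbit_max_int n : intg (orbit_max n).
Proof.
elim: n => [|n IH] /=; first exact: intg_cst.
apply: (@intg_le _ _ _ _ _ (fun w => `|orbit_max n w| + `|h w + V (orbit_max n) w|)).
- apply: measurable_maxr; first exact: intg_meas IH.
  by apply: measurable_funD; [exact: intg_meas ih|exact: intg_meas (V_int IH)].
- by apply: intgD; apply: intg_abs => //; apply: intgD => //; exact: V_int.
- by move=> w; rewrite /Num.max; case: ifP => _; rewrite ?lerDl ?lerDr.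
Qed.

Lemma orbit_max_nd n w : orbit_max n w <= orbit_max n.+1 w.
Proof. by rewrite /= le_max lexx. Qed.

Lemma orbit_max_ge0 n w : 0 <= orbit_max n w.
Proof. by elim: n => //= n; move/le_trans; apply; rewrite le_max lexx. Qed.

Lemma orbit_sum_le_max n : {ae P, forall w, orbit_sum n w <= orbit_max n w}.
Proof.
elim: n => [|n IH]; first exact: aeW.
have := V_le (orbit_sum_int n) (orbit_max_int n) IH.
by apply: filterS => w h1 /=; rewrite le_max lerD2l h1 orbT.
Qed.

(** A positive value was produced at some step [m < n] as [h + V (orbit_max m)], and [V] is monotone
    along the nondecreasing sequence [orbit_max]. *)
Let orbit_max_le n : {ae P, forall w, 0 < orbit_max n w ->
  orbit_max n w <= h w + V (orbit_max n) w}.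
Proof.
elim: n => [|n IH]; first by apply: aeW => w /=; rewrite ltxx.
have : {ae P, forall w, V (orbit_max n) w <= V (orbit_max n.+1) w}.
  by apply: V_le; [exact: orbit_max_int|exact: orbit_max_int|apply: aeW => w; exact: orbit_max_nd].
apply: filterS2 IH => w IH hV.
rewrite [orbit_max n.+1 w]/= /Num.max; case: ifP => _ h0.
- by rewrite lerD2l.
- by rewrite (le_trans (IH h0))// lerD2l.
Qed.

Let pos n := [set w | 0 < orbit_max n w].

Let mpos n : measurable (pos n).
Proof.
have := intg_meas (orbit_max_int n).
move=> /(_ measurableT _ (measurable_itv `]0, +oo[)); rewrite setTI.
by congr measurable; apply/seteqP; split => w /=; rewrite ?in_itv/= ?andbT.
Qed.

(** Garsia's argument: [orbit_max n - V (orbit_max n)] has integral zero. It is at most [h] on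
    [pos n] by [orbit_max_le], and at most zero elsewhere, where [orbit_max n] is not positive and
    its image under [V] is nonnegative. *)
Lemma maximal_ergodic_fin n : 0 <= Ex (fun w => \1_(pos n) w * h w).
Proof.
apply: (@le_trans _ _ (Ex (orbit_max n) - Ex (V (orbit_max n)))).
  by rewrite V_Ex ?subrr//; exact: orbit_max_int.
rewrite -ExB; try exact: orbit_max_int; try exact/V_int/orbit_max_int.
have iM := orbit_max_int n; have iV := V_int iM.
apply: Ex_le; [exact: intgB|exact: intg_indicM|].
have : {ae P, forall w, 0 <= V (orbit_max n) w}.
  by apply: V_ge0 => // w; exact: orbit_max_ge0.
apply: filterS2 (orbit_max_le n) => w h1 h2.
rewrite indicE; case: (boolP (w \in _)) => [|wn].
  by rewrite inE/= mul1r => /h1; rewrite lerBlDr.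
rewrite mul0r subr_le0; move: wn; rewrite notin_setE/= => /negP; rewrite -leNgt => h3.
exact: le_trans h2.
Qed.

Definition maximal_set := \bigcup_n pos n.

Lemma measurable_maximal_set : measurable maximal_set.
Proof. exact: bigcupT_measurable. Qed.

Lemma maximal_ergodic : 0 <= Ex (fun w => \1_maximal_set w * h w).
Proof.
have mh := intg_meas ih.
have [|||||_] := @Ex_dct _ _ _ P (fun n w => \1_(pos n) w * h w)
  (fun w => \1_maximal_set w * h w) (fun w => `|h w|).
- by move=> n; apply: measurable_funM => //; exact: measurable_indic.
- by apply: measurable_funM => //; apply: measurable_indic; exact: measurable_maximal_set.
- exact: intg_abs.
- apply: aeW => w; apply: cvgMr_tmp.
  case: (pselect (maximal_set w)) => [[N _ hN]|hw].
    have w1 : maximal_set w by exists N.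
    apply: cvg_near_cst; exists N => // n /= Nn; rewrite !indicE.
    suff w2 : pos n w by rewrite !mem_set.
    rewrite /pos/= (lt_le_trans hN)//.
    by move/nondecreasing_seqP: (orbit_max_nd^~ w); exact.
  apply: cvg_near_cst; exists 0%N => // n _; rewrite !indicE.
  by rewrite !memNset// => hn; apply: hw; exists n.
- move=> n; apply: aeW => w; rewrite normrM ler_piMl//.
  by rewrite indicE ger0_norm// lern1; case: (_ \in _).
- move=> hl; rewrite -(cvg_lim (@Rhausdorff R) hl); apply: limr_ge; first exact: cvgP hl.
  by apply: nearW => n; exact: maximal_ergodic_fin.
Qed.

Lemma orbit_sum_le0 : {ae P, forall w, ~ maximal_set w -> forall n, orbit_sum n w <= 0}.
Proof.
have := ae_foralln orbit_sum_le_max; apply: filterS => w hw nB n.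
rewrite (le_trans (hw n))// leNgt; apply/negP => h0.
by apply: nB; exists n.
Qed.

End maximal.


(** * Measure preserving maps and Birkhoff's ergodic theorem *)

Section measure_preserving_theory.
Context d (Om : measurableType d) (R : realType) (P : probability Om R).
Variable T : Om -> Om.
Hypothesis T_mp : measure_preserving P T.
Implicit Types (f g h : Om -> R).
Local Notation intg f := (P.-integrable setT (EFin \o f)).
Local Notation Ex f := (Rintegral P setT f).

Let mT : measurable_fun setT T := proj1 T_mp.

Lemma measurable_comp_mp g : measurable_fun setT g -> measurable_fun setT (fun w => g (T w)).
Proof. by move=> mg; exact: measurableT_comp. Qed.

Lemma Ex_cst (c : R) : Ex (fun=> c) = c.
Proof. by rewrite Rintegral_cst//= probability_setT mulr1. Qed.

Let pushE (g : Om -> \bar R) :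
  (\int[pushforward P T]_w g w = \int[P]_w g w)%E.
Proof. by apply: eq_measure_integral => A mA _; exact: (proj2 T_mp). Qed.

Lemma intg_mp g : intg g -> intg (fun w => g (T w)).
Proof.
move=> /integrableP[mg goo]; apply/integrableP; split.
  by apply: measurableT_comp mg _.
move: goo; rewrite -pushE ge0_integral_pushforward//.
by apply: measurableT_comp.
Qed.

Lemma Ex_mp g : intg g -> Ex (fun w => g (T w)) = Ex g.
Proof.
move=> ig; rewrite /Rintegral; congr fine.
rewrite -[RHS]pushE integral_pushforward//; first exact: measurable_int ig.
exact: intg_mp.
Qed.

Lemma ae_mp (p : Om -> Prop) : {ae P, forall w, p w} -> {ae P, forall w, p (T w)}.
Proof.
move=> [A [mA A0 pA]]; exists (T @^-1` A); split.
- by rewrite -[X in measurable X]setTI; exact: mT.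
- by rewrite (proj2 T_mp).
- by move=> w /= pw; apply: pA.
Qed.

Definition birkhoff n f w : R := \sum_(0 <= k < n) f (iter k T w).

Lemma birkhoffS n f w : birkhoff n.+1 f w = f w + birkhoff n f (T w).
Proof.
rewrite /birkhoff big_nat_recl//=; congr (_ + _); apply: eq_bigr => k _.
by rewrite -iterSr.
Qed.

Lemma orbit_sum_birkhoff f n w : orbit_sum (fun g w => g (T w)) f n w = birkhoff n f w.
Proof. by elim: n w => [|n IH] w /=; [rewrite /birkhoff big_nil|rewrite birkhoffS IH]. Qed.

Lemma measurable_iter k : measurable_fun setT (iter k T).
Proof.
elim: k => [|k IH]; first exact: measurable_id.
by have -> : iter k.+1 T = T \o iter k T by []; exact: measurableT_comp.
Qed.

Lemma iter_mp k : measure_preserving P (iter k T).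
Proof.
split; first exact: measurable_iter.
move=> A mA; elim: k => [//|k IH]; rewrite -[RHS]IH.
rewrite -[in RHS](proj2 T_mp); first by congr (P _); apply/seteqP; split => w /=; rewrite -iterSr.
by rewrite -[X in measurable X]setTI; exact: measurable_iter.
Qed.

Hypothesis T_ergodic : ergodic P T.

Section birkhoff_limsup.
Variables (f : Om -> R) (lam : R).
Hypothesis if_ : intg f.

Let S j n := [set w | n%:R * (lam + j.+1%:R^-1) < birkhoff n f w].
Let B := \bigcup_j \bigcap_N \bigcup_k S j (N + k)%N.

Let mS j n : measurable (S j n).
Proof.
have : measurable_fun setT (birkhoff n f).
  apply: measurable_sum => k; apply: measurableT_comp; last exact: measurable_iter.
  exact: intg_meas if_.
move=> /(_ measurableT _ (measurable_itv `]n%:R * (lam + j.+1%:R^-1), +oo[)); rewrite setTI.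
by congr measurable; apply/seteqP; split => w /=; rewrite ?in_itv/= ?andbT.
Qed.

Let mB : measurable B.
Proof.
apply: bigcupT_measurable => j; apply: bigcapT_measurable => N.
by apply: bigcupT_measurable => k.
Qed.

Let BP w : B w <-> exists e, 0 < e /\
  forall N : nat, exists2 n, (N <= n)%N & n%:R * (lam + e) < birkhoff n f w.
Proof.
split=> [[j _ Bj]|[e [e0 He]]].
  exists j.+1%:R^-1; split => // N; have [k _ Sk] := Bj N I.
  by exists (N + k)%N => //; rewrite leq_addr.
have [N HN] := natr_ge e^-1; exists N => // M _.
have [n Mn Sn] := He M; exists (n - M)%N => //; rewrite subnKC// /S/=.
rewrite (le_lt_trans _ Sn)// ler_wpM2l// lerD2l.
by rewrite -[e]invrK lef_pV2 ?posrE ?invr_gt0//; apply: HN.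
Qed.

(** The sums along [w] and along [T w] differ by the term [f w] and a shift of the index, which
    lowering the margin from [e] to [e / 2] absorbs for large [n]. The definition [ergodic] requires
    this exact equality of sets. *)
Let B_inv : T @^-1` B = B.
Proof.
apply/seteqP; split => w; rewrite /preimage/= !BP => -[e [e0 He]];
  exists (e / 2); (split; first by rewrite divr_gt0) => N.
- have [N' HN'] := natr_ge (2 / e * (lam + e / 2 - f w)).
  have [n nN Sn] := He (maxn N N'); move: nN; rewrite geq_max => /andP[nN nN'].
  exists n.+1; first exact: leqW.
  rewrite birkhoffS -natr1; have := HN' _ nN'.
  rewrite mulrAC ler_pdivrMr// => h; move: Sn h; move: (birkhoff _ _ _) => x; nra.
- have [N' HN'] := natr_ge (2 / e * (f w - lam - e)).
  have [[//|n] nN Sn] := He (maxn N N').+1; move: nN; rewrite ltnS geq_max => /andP[nN nN'].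
  exists n => //; move: Sn.
  rewrite birkhoffS -natr1; have := HN' _ nN'.
  rewrite mulrAC ler_pdivrMr// => h Sn; move: Sn h; move: (birkhoff _ _ _) => x; nra.
Qed.

(** By ergodicity the bad set [B] has measure zero or one. In the second case the maximal set of
    [f - lam] has full measure, and [maximal_ergodic] would give [Ex f >= lam]. *)
Lemma birkhoff_limsup : Ex f < lam -> {ae P, forall w, forall e, 0 < e ->
  exists N : nat, forall n, (N <= n)%N -> birkhoff n f w <= n%:R * (lam + e)}.
Proof.
move=> flam.
suff B0 : P B = 0%E.
  exists B; split => // w /= /existsNP[e /not_implyP[e0 /forallNP He]]; apply/BP.
  exists e; split => // N; have := He N => /existsNP[n /not_implyP[Nn /negP]].
  by rewrite -ltNge => h; exists n.
have [//|B1] := T_ergodic mB B_inv; exfalso.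
pose h w := f w - lam.
have ih : intg h by apply: intgB => //; exact: intg_cst.
pose V (g : Om -> R) := fun w => g (T w).
have [Vi Ve] : (forall g, intg g -> intg (V g)) /\ (forall g, intg g -> Ex (V g) = Ex g).
  by split; [exact: intg_mp|exact: Ex_mp].
have Vle g g' : intg g -> intg g' -> {ae P, forall w, g w <= g' w} ->
  {ae P, forall w, V g w <= V g' w} by move=> _ _; exact: ae_mp.
have V0 g : intg g -> (forall w, 0 <= g w) -> {ae P, forall w, 0 <= V g w}.
  by move=> _ g0; apply: aeW => w; exact: g0.
have := maximal_ergodic Vi Ve Vle V0 ih.
have Bae : {ae P, forall w, B w}.
  exists (~` B); split; [exact: measurableC| |by []].
  by rewrite probability_setC// B1 subee.
suff -> : Ex (fun w => \1_(maximal_set V h) w * h w) = Ex h.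
  by rewrite /h ExB ?Ex_cst ?subr_ge0 1?leNgt ?flam//; exact: intg_cst.
apply: Ex_ae_eq.
- apply: measurable_funM; last exact: intg_meas ih.
  by apply: measurable_indic; exact: (measurable_maximal_set Vi ih).
- exact: intg_meas ih.
- apply: filterS2 Bae (orbit_sum_le0 Vi Vle ih) => w /BP[e [e0 He]] hm.
  rewrite indicE mem_set ?mul1r//; apply: contrapT => /hm h0.
  have [n n1 hn] := He 1%N; have := h0 n.
  rewrite orbit_sum_birkhoff /h /birkhoff big_split/= sumr_const_nat subn0.
  rewrite -/(birkhoff n f w) -mulr_natr mulNr subr_le0 leNgt => /negP; apply.
  by rewrite (le_lt_trans _ hn)// mulrC ler_wpM2l// lerDl ltW.
Qed.

End birkhoff_limsup.

(** The one-sided bound is applied to [f] and to [- f], with [lam] at distance [1/(j+1)] above the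
    mean. *)
Lemma birkhoff_ergodic f : intg f ->
  {ae P, forall w, birkhoff n f w / n%:R @[n --> \oo] --> Ex f}.
Proof.
move=> if_.
have H g : intg g -> {ae P, forall w, forall j : nat, forall e, 0 < e ->
    exists N : nat, forall n, (N <= n)%N -> birkhoff n g w <= n%:R * (Ex g + j.+1%:R^-1 + e)}.
  move=> ig; apply: ae_foralln => j; apply: birkhoff_limsup => //.
  by rewrite ltrDl invr_gt0.
apply: filterS2 (H _ if_) (H _ (intgN if_)) => w h1 h2.
apply/cvgrPdist_le => e e0.
have e20 : 0 < e / 2 by rewrite divr_gt0.
have [j HNj] := natr_ge (e / 2)^-1.
have je : j.+1%:R^-1 <= e / 2.
  by rewrite -[X in _ <= X]invrK lef_pV2 ?posrE ?invr_gt0//; apply: HNj.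
have [N1 HN1] := h1 j _ e20; have [N2 HN2] := h2 j _ e20.
exists (maxn (maxn N1 N2) 1) => // n /=; rewrite !geq_max => /andP[/andP[n1 n2] n0].
have {}HN1 := HN1 _ n1; have {}HN2 := HN2 _ n2.
have n0' : 0 < n%:R :> R by rewrite ltr0n.
have bN : birkhoff n (fun w => - f w) w = - birkhoff n f w by rewrite /birkhoff sumrN.
rewrite bN (ExN if_) in HN2.
have y1 : birkhoff n f w / n%:R <= Ex f + j.+1%:R^-1 + e / 2 by rewrite ler_pdivrMr// mulrC.
have y2 : - (birkhoff n f w / n%:R) <= - Ex f + j.+1%:R^-1 + e / 2.
  by rewrite -mulNr ler_pdivrMr// mulrC.
rewrite ler_norml; move: y1 y2; set y := _ / _; set jj := j.+1%:R^-1 in je *.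
by move=> y1 y2; apply/andP; split; lra.
Qed.

End measure_preserving_theory.

(** * Bounded convergence for conditional expectations *)

Section conditional_dominated_convergence.
Context d (T : measurableType d) (R : realType) (P : probability T R).
Variables (G : set (set T)).
Hypothesis GA : G `<=` measurable.
Local Notation intg f := (P.-integrable setT (EFin \o f)).
Local Notation Ex f := (Rintegral P setT f).

Lemma Ex_indic A : measurable A -> (Ex (\1_A : T -> R))%:E = P A.
Proof.
move=> mA; rewrite -[RHS]fineK; last exact: fin_num_measure.
by rewrite /Rintegral integral_indic// setIT.
Qed.

Lemma intg_indic A : measurable A -> intg (\1_A : T -> R).
Proof.
move=> mA; have := intg_indicM mA (intg_cst P 1).
by under eq_fun do rewrite mulr1.
Qed.

(** Off [A N] all terms from [N] on are at most [e / 2], so [|h n| <= e / 2 + C E] where [E] is the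
    conditional probability of [A N]. As [P (A N)] tends to zero, Markov's inequality makes [E]
    small off a small set. *)
Lemma cond_exp_bounded_cvg0 (g h : nat -> T -> R) (C : R) :
  (forall n, intg (g n)) -> (forall n, is_cond_exp P G (g n) (h n)) ->
  (forall n w, `|g n w| <= C) ->
  {ae P, forall w, g n w @[n --> \oo] --> 0} ->
  {ae P, forall w, h n w @[n --> \oo] --> 0}.
Proof.
move=> ig hc gC gcv; apply: ae_cvg0 => e eta e0 eta0.
have C0 : 0 <= C by rewrite (le_trans _ (gC 0%N point)).
pose A N := \bigcup_k [set w | e / 2 < `|g (N + k)%N w|].
have mA N : measurable (A N).
  apply: bigcupT_measurable => k.
  have := intg_meas (intg_abs (ig (N + k)%N)).
  move=> /(_ measurableT _ (measurable_itv `]e / 2, +oo[)); rewrite setTI.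
  by congr measurable; apply/seteqP; split => w /=; rewrite ?in_itv/= ?andbT.
have mcA : measurable (\bigcap_N A N) by exact: bigcapT_measurable.
have A0 : P (\bigcap_N A N) = 0%E.
  have [B [mB B0 hB]] := gcv.
  apply: (@subset_measure0 _ _ _ _ _ B) => // w Aw; apply: hB => /= cv.
  have : 0 < e / 2 by rewrite divr_gt0.
  move/cvgrPdist_lt: cv => /[apply] -[N _ HN].
  have [k _ /=] := Aw N I; have /= := HN (N + k)%N (leq_addr _ _).
  by rewrite sub0r normrN => h1 h2; have := lt_trans h1 h2; rewrite ltxx.
have Acv : (P \o A) x @[x --> \oo] --> P (\bigcap_N A N).
  apply: nonincreasing_cvg_mu => //; first by rewrite -ge0_fin_numE// fin_num_measure.
  move=> n m nm; apply/subsetPset => w [k _ /= hk].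
  exists (m - n + k)%N => //=; rewrite addnA subnKC//.
(* Chosen so that [C * dl <= e / 2]; the added one covers [C = 0]. *)
pose dl := e / (2 * (C + 1)).
have dl0 : 0 < dl by rewrite divr_gt0// mulr_gt0// ltr_wpDl.
have [N AN] : exists N, (P (A N) <= (dl * eta)%:E)%E.
  move: Acv; rewrite A0 => /fine_cvgP[_ /cvgrPdist_le /(_ (dl * eta))].
  rewrite mulr_gt0// => /(_ isT)[N _ /(_ N (leqnn _))].
  rewrite /= sub0r normrN ger0_norm ?fine_ge0// => h1; exists N.
  by rewrite -[P (A N)]fineK ?lee_fin//; exact: fin_num_measure.
have iA := intg_indic (mA N).
pose E := cond_exp P G (\1_(A N) : T -> R).
have Ec : is_cond_exp P G (\1_(A N) : T -> R) E by exact: cond_expP.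
have [mE iE _] := Ec.
have E0 : {ae P, forall w, 0 <= E w}.
  have := @cond_exp_mono _ _ _ P G GA (fun=> 0) (\1_(A N)) (fun=> 0) E.
  apply => //; first exact: intg_cst.
  - by apply: is_cond_exp_id; [exact: measurable_cst|exact: intg_cst].
  - exact: aeW.
exists [set w | (dl < E w)%R]; split.
- have := intg_meas iE.
  move=> /(_ measurableT _ (measurable_itv `]dl, +oo[)); rewrite setTI.
  by congr measurable; apply/seteqP; split => w /=; rewrite ?in_itv/= ?andbT.
- apply: (le_trans (Ex_markov dl0 iE E0)).
  rewrite (Ex_cond_exp GA Ec) lee_fin ler_pdivrMr// mulrC -lee_fin.
  by rewrite Ex_indic.
have bnd n : (N <= n)%N -> {ae P, forall w, `|h n w| <= e / 2 + C * E w}.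
  move=> Nn.
  have ib : intg (fun w => e / 2 + C * \1_(A N) w) by apply: intgD; [exact: intg_cst|exact: intgZ].
  have cb : is_cond_exp P G (fun w => e / 2 + C * \1_(A N) w) (fun w => e / 2 + C * E w).
    apply: is_cond_expD => //; [exact: intg_cst|exact: intgZ| |exact: is_cond_expZ].
    by apply: is_cond_exp_id; [exact: measurable_cst|exact: intg_cst].
  have gb w : `|g n w| <= e / 2 + C * \1_(A N) w.
    rewrite indicE; case: (boolP (w \in _)) => [_|].
      by rewrite mulr1 (le_trans (gC _ _))// lerDr divr_ge0// ltW.
    rewrite mulr0 addr0 notin_setE/= => wA; rewrite leNgt; apply/negP => hw.
    by apply: wA; exists (n - N)%N => //=; rewrite subnKC.
  have h1 : {ae P, forall w, h n w <= e / 2 + C * E w}.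
    apply: (cond_exp_mono GA (ig n) ib (hc n) cb); apply: aeW => w.
    exact: le_trans (ler_norm _) (gb w).
  have h2 : {ae P, forall w, -1 * h n w <= e / 2 + C * E w}.
    apply: (cond_exp_mono GA (intgZ (-1) (ig n)) ib (is_cond_expZ GA (-1) (ig n) (hc n)) cb).
    by apply: aeW => w; rewrite mulN1r (le_trans _ (gb w))// -normrN ler_norm.
  by apply: filterS2 h1 h2 => w h1 h2; rewrite ler_norml; apply/andP; split; lra.
have : {ae P, forall w, forall n, `|h (N + n)%N w| <= e / 2 + C * E w}.
  by apply: ae_foralln => n; apply: bnd; exact: leq_addr.
apply: filterS2 E0 => w E0 hb /negP; rewrite -leNgt => Ew; exists N => n Nn.
have := hb (n - N)%N; rewrite subnKC// => /le_trans; apply.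
have : C * E w <= e / 2.
  apply: (@le_trans _ _ ((C + 1) * dl)); first by rewrite ler_pM// lerDl.
  rewrite /dl invfM; suff -> : (C + 1) * (e * (2^-1 * (C + 1)^-1)) = e / 2 by [].
  by field; rewrite gt_eqF// ltr_wpDl.
lra.
Qed.

End conditional_dominated_convergence.

(** * Stationary filtrations, the Markov operator and the quenched ergodic theorem *)

Record ergodic_filtration d (Om : measurableType d) (R : realType)
    (P : probability Om R) (T : Om -> Om) (F : int -> set (set Om)) : Prop := {
  ef_mp : measure_preserving P T;
  ef_ergodic : ergodic P T;
  ef_sub : forall i, sigma_algebra setT (F i) /\ F i `<=` measurable;
  ef_incr : forall i, F i `<=` F (i + 1);
  ef_shift : forall i, F (i + 1) = preimage_set_system setT T (F i) }.

Section filtration.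
Context d (Om : measurableType d) (R : realType) (P : probability Om R).
Variables (T : Om -> Om) (F : int -> set (set Om)).
Hypothesis ef : ergodic_filtration P T F.
Implicit Types (f g h : Om -> R).
Local Notation intg f := (P.-integrable setT (EFin \o f)).
Local Notation Ex f := (Rintegral P setT f).
Local Notation E0 := (cond_exp P (F 0)).

Lemma F_meas i : F i `<=` d.-measurable. Proof. exact: (ef_sub ef i).2. Qed.
Hint Resolve F_meas : core.

Let T_mp := ef_mp ef.

Lemma F_mono i j : i <= j -> F i `<=` F j.
Proof.
move=> ij; have [k ->] : exists k : nat, j = i + k%:Z.
  by exists `|j - i|%N; rewrite gez0_abs ?subr_ge0// [RHS]addrC subrK.
elim: k => [|k IH]; first by rewrite addr0.
by apply: subset_trans IH _; rewrite intS addrCA addrC; exact: ef_incr ef _.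
Qed.

Lemma sub_wrt (G G' : set (set Om)) h :
  G `<=` G' -> measurable_wrt G h -> measurable_wrt G' h.
Proof. by move=> GG' mh _ B mB; apply: (sub_sigma_algebra2 GG'); exact: mh. Qed.

Lemma wrt_mono i j h : i <= j -> measurable_wrt (F i) h -> measurable_wrt (F j) h.
Proof. by move/F_mono; exact: sub_wrt. Qed.

Lemma sigma_F i A : (F i).-sigma.-measurable A = F i A.
Proof. by rewrite /measurable/= sigma_algebra_id//; exact: (ef_sub ef i).1. Qed.

Lemma F_shiftP i A : F (i + 1) A <-> exists2 B, F i B & A = T @^-1` B.
Proof.
rewrite (ef_shift ef); split; first by move=> [B FB <-]; exists B; rewrite ?setTI.
by move=> [B FB ->]; exists B; rewrite ?setTI.
Qed.

Lemma wrt_shift i h : measurable_wrt (F i) h ->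
  measurable_wrt (F (i + 1)) (fun w => h (T w)).
Proof.
move=> mh _ B mB; rewrite setTI sigma_F; apply/F_shiftP.
exists (h @^-1` B) => //; rewrite -sigma_F -[X in _.-measurable X]setTI.
exact: mh.
Qed.

Lemma is_cond_exp_shift i g h : intg g -> is_cond_exp P (F i) g h ->
  is_cond_exp P (F (i + 1)) (fun w => g (T w)) (fun w => h (T w)).
Proof.
move=> ig hc; have [mh ih _] := hc.
apply: is_cond_exp_indic => //; try exact: intg_mp; first exact: wrt_shift.
move=> A; rewrite sigma_F => /F_shiftP[B FB ->].
have mB : measurable B by exact: F_meas FB.
have := @Ex_mp _ _ _ P T T_mp (fun w => \1_B w * h w) (intg_indicM mB ih).
have := @Ex_mp _ _ _ P T T_mp (fun w => \1_B w * g w) (intg_indicM mB ig).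
by move=> /= -> ->; apply: (cond_exp_indic (@F_meas i) hc); rewrite sigma_F.
Qed.

Lemma intg_iter k g : intg g -> intg (fun w => g (iter k T w)).
Proof. exact/intg_mp/iter_mp. Qed.

Lemma Ex_iter k g : intg g -> Ex (fun w => g (iter k T w)) = Ex g.
Proof. exact/Ex_mp/iter_mp. Qed.

Lemma ae_iter k (p : Om -> Prop) : {ae P, forall w, p w} -> {ae P, forall w, p (iter k T w)}.
Proof. exact/ae_mp/iter_mp. Qed.

Lemma wrt_iter i k h : measurable_wrt (F i) h ->
  measurable_wrt (F (i + k%:Z)) (fun w => h (iter k T w)).
Proof.
move=> mh; elim: k => [|k IH]; first by rewrite addr0.
have := wrt_shift IH; rewrite -addrA intS [1 + _]addrC.
by under eq_fun do rewrite -iterSr.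
Qed.

Lemma is_cond_exp_iter i k g h : intg g -> is_cond_exp P (F i) g h ->
  is_cond_exp P (F (i + k%:Z)) (fun w => g (iter k T w)) (fun w => h (iter k T w)).
Proof.
move=> ig hc; elim: k => [|k IH]; first by rewrite addr0.
have := is_cond_exp_shift (intg_iter k ig) IH; rewrite -addrA intS [1 + _]addrC.
by under eq_fun do rewrite -iterSr; under [X in is_cond_exp _ _ _ X]eq_fun do rewrite -iterSr.
Qed.

Lemma E0P g : intg g -> is_cond_exp P (F 0) g (E0 g).
Proof. exact: cond_expP. Qed.

Lemma E0_int g : intg g -> intg (E0 g).
Proof. by move/E0P => -[]. Qed.

Lemma E0_wrt g : intg g -> measurable_wrt (F 0) (E0 g).
Proof. by move/E0P => -[]. Qed.

Lemma E0_le f g : intg f -> intg g -> {ae P, forall w, f w <= g w} ->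
  {ae P, forall w, E0 f w <= E0 g w}.
Proof. by move=> if_ ig; apply: (cond_exp_mono (@F_meas 0) if_ ig); exact: E0P. Qed.

Lemma E0_unique f h : intg f -> is_cond_exp P (F 0) f h -> {ae P, forall w, E0 f w = h w}.
Proof. by move=> if_ hc; apply: (cond_exp_unique (@F_meas 0) if_ if_ (E0P if_) hc). Qed.

Lemma E0_ge0 g : intg g -> {ae P, forall w, 0 <= g w} -> {ae P, forall w, 0 <= E0 g w}.
Proof.
move=> ig g0; apply: (@cond_exp_mono _ _ _ P _ (@F_meas 0) (fun=> 0) g) g0 => //.
- exact: intg_cst.
- by apply: is_cond_exp_id; [exact: measurable_cst|exact: intg_cst].
- exact: E0P.
Qed.

(** The dynamics seen from [F 0]: on [F 0]-measurable [g], the [k]-th iterate is a version of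
    [E0 (g o T^k)]. *)
Definition markov_op g := E0 (fun w => g (T w)).

Lemma markov_op_int g : intg g -> intg (markov_op g).
Proof. by move=> ig; exact/E0_int/intg_mp. Qed.

Lemma markov_op_Ex g : intg g -> Ex (markov_op g) = Ex g.
Proof.
by move=> ig; rewrite (Ex_cond_exp (@F_meas 0) (E0P (intg_mp T_mp ig))) Ex_mp.
Qed.

Lemma markov_op_le f g : intg f -> intg g -> {ae P, forall w, f w <= g w} ->
  {ae P, forall w, markov_op f w <= markov_op g w}.
Proof.
by move=> if_ ig le; apply: E0_le; try exact: intg_mp; exact: (ae_mp T_mp le).
Qed.

Lemma markov_op_ge0 g : intg g -> (forall w, 0 <= g w) ->
  {ae P, forall w, 0 <= markov_op g w}.
Proof. by move=> ig g0; apply: E0_ge0; [exact: intg_mp|exact: aeW]. Qed.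

(** Composing [E0 (g o T^k)] with [T] gives the conditional expectation of [g o T^(k+1)] given
    [F 1]; the tower property from [F 1] down to [F 0] concludes. *)
Lemma is_cond_exp_markov_iter k g : intg g ->
  is_cond_exp P (F 0) (fun w => g (iter k.+1 T w))
    (markov_op (E0 (fun w => g (iter k T w)))).
Proof.
move=> ig; have ik := intg_iter k ig.
have iE := E0_int ik.
have := is_cond_exp_shift ik (E0P ik).
under eq_fun do rewrite -iterSr; move=> hc.
apply: (cond_exp_tower (@F_meas (0 + 1)) (@ef_incr _ _ _ _ _ _ ef 0) (intg_iter k.+1 ig) hc).
by apply: E0P; exact: intg_mp.
Qed.

Lemma markov_iter k g : intg g -> {ae P, forall w,
  E0 (fun w => g (iter k.+1 T w)) w = markov_op (E0 (fun w => g (iter k T w))) w}.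
Proof. by move=> ig; apply: E0_unique (is_cond_exp_markov_iter k ig); exact: (intg_iter k.+1 ig). Qed.

Definition quenched_sum n g w : R := \sum_(0 <= k < n) E0 (fun w => g (iter k T w)) w.

Lemma quenched_sum_int n g : intg g -> intg (quenched_sum n g).
Proof. by move=> ig; apply: intg_sum => k; exact/E0_int/intg_iter. Qed.

Lemma is_cond_exp_quenched_sum n g : intg g ->
  is_cond_exp P (F 0) (birkhoff T n g) (quenched_sum n g).
Proof.
by move=> ig; apply: is_cond_exp_sum => // k; [exact: intg_iter|exact/E0P/intg_iter].
Qed.

Lemma orbit_sum_markov g lam n : measurable_wrt (F 0) g -> intg g -> {ae P, forall w,
  orbit_sum markov_op (fun w => g w - lam) n w = quenched_sum n g w - n%:R * lam}.
Proof.
move=> mg ig; have igl : intg (fun w => g w - lam) by apply: intgB => //; exact: intg_cst.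
elim: n => [|n IH].
  by apply: aeW => w; rewrite /quenched_sum big_nil mul0r subr0.
set S := orbit_sum _ _ n in IH *.
have iS : intg S by apply: orbit_sum_int => //; exact: markov_op_int.
have iq : intg (fun w => quenched_sum n g w - n%:R * lam).
  by apply: intgB; [exact: quenched_sum_int|exact: intg_cst].
have h1 : {ae P, forall w, markov_op S w =
    \sum_(0 <= k < n) markov_op (E0 (fun w => g (iter k T w))) w - n%:R * lam}.
  apply: E0_unique; first exact: intg_mp.
  have cc : is_cond_exp P (F 0) (fun=> n%:R * lam) (fun=> n%:R * lam).
    by apply: is_cond_exp_id; [exact: measurable_cst|exact: intg_cst].
  apply: (@is_cond_exp_ae _ _ _ P _ (@F_meas 0) (fun w => quenched_sum n g (T w) - n%:R * lam)).
  - exact: (intg_mp T_mp iq).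
  - exact: intg_mp.
  - by apply: filterS (ae_mp T_mp IH) => w ->.
  - apply: is_cond_expB => //; [exact: (intg_mp T_mp (quenched_sum_int n ig))|exact: intg_cst|].
    apply: is_cond_exp_sum => // k; first exact/intg_mp/E0_int/intg_iter.
    exact/E0P/intg_mp/E0_int/intg_iter.
have h2 : {ae P, forall w, forall k, E0 (fun w => g (iter k.+1 T w)) w =
    markov_op (E0 (fun w => g (iter k T w))) w}.
  by apply: ae_foralln => k; exact: markov_iter.
(* The term [k = 0] of [quenched_sum] is [E0 g], whereas [orbit_sum] starts with [g] itself;
   measurability of [g] identifies them. *)
have h3 : {ae P, forall w, E0 g w = g w} by apply: E0_unique.
apply: filterS3 h1 h2 h3 => w h1 h2 h3.
rewrite /= -/S h1 /quenched_sum big_nat_recl//=; rewrite h3.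
rewrite -natr1 mulrDl mul1r.
under [X in _ = _ + X - _]eq_bigr do rewrite h2.
ring.
Qed.

Let clip (j : nat) g w := Num.max (- j%:R) (Num.min (g w) j%:R).

Let clip_bd j g w : `|clip j g w| <= j%:R.
Proof.
rewrite /clip ler_norml le_max lexx/= ge_max ge_min lexx orbT andbT.
by rewrite (le_trans (y:=0))// oppr_le0.
Qed.

Let clip_wrt j g : measurable_wrt (F 0) g -> measurable_wrt (F 0) (clip j g).
Proof.
move=> mg; apply: measurable_maxr; first exact: measurable_cst.
by apply: measurable_minr => //; exact: measurable_cst.
Qed.

Let clip_le j g w : `|g w - clip j g w| <= `|g w|.
Proof.
have j0 : 0 <= j%:R :> R by [].
rewrite /clip; case: (lerP (g w) j%:R) => h1; case: (lerP (- j%:R) _) => h2.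
- by rewrite subrr normr0.
- by rewrite !ler0_norm; lra.
- by rewrite !ger0_norm; lra.
- by rewrite !ger0_norm; lra.
Qed.

Let clip_eq j g w : `|g w| <= j%:R -> clip j g w = g w.
Proof.
rewrite ler_norml => /andP[h1 h2]; rewrite /clip min_l// max_r//.
Qed.

(** After truncation, Birkhoff averages of the bounded part converge and stay bounded, so their
    conditional expectations converge too. Averages of the truncation error [r] are at most [dl],
    for all [n] at once, off the maximal set of [r - dl] for the operator [Q]. *)
Theorem quenched_ergodic g : measurable_wrt (F 0) g -> intg g ->
  {ae P, forall w, quenched_sum n g w / n%:R @[n --> \oo] --> Ex g}.
Proof.
move=> mg ig.
suff : {ae P, forall w, (quenched_sum n g w / n%:R - Ex g) @[n --> \oo] --> 0}.
  by apply: filterS => w; rewrite subr_cvg0.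
have m0 : measurable_fun setT g by exact: (wrt_measurable (@F_meas 0) mg).
apply: ae_cvg0 => e eta e0 eta0.
pose dl := e / 4; have dl0 : 0 < dl by rewrite divr_gt0.
have ic j : intg (clip j g).
  apply: intg_le (intg_cst P j%:R) (clip_bd j g).
  exact: (wrt_measurable (@F_meas 0) (clip_wrt _ mg)).
(* The first bound controls the change of the mean; the second, divided by [dl], will bound the
   measure of the maximal set by [eta]. *)
have [j [jdl jeta]] : exists j, Ex (fun w => `|g w - clip j g w|) <= dl /\
    Ex (fun w => `|g w - clip j g w|) <= dl * eta.
  have [|||||_] := @Ex_dct _ _ _ P (fun j w => `|g w - clip j g w|) (fun=> 0) (fun w => `|g w|).
  - by move=> j; exact: intg_meas (intg_abs (intgB ig (ic j))).
  - exact: measurable_cst.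
  - exact: intg_abs.
  - apply: aeW => w; apply: cvg_near_cst; have [N HN] := natr_ge `|g w|.
    by exists N => // j /= Nj; rewrite clip_eq ?subrr ?normr0// HN.
  - by move=> j; apply: aeW => w; rewrite normr_id; exact: clip_le.
  rewrite Ex_cst => /cvgrPdist_le /(_ (Num.min dl (dl * eta))).
  rewrite lt_min dl0 mulr_gt0// => /(_ isT)[N _ /(_ N (leqnn _))] /=.
  rewrite sub0r normrN ger0_norm; last by apply: Rintegral_ge0.
  by rewrite le_min => /andP[h1 h2]; exists N.
pose c := clip j g; pose r w := `|g w - c w|.
have icc : intg c := ic j.
have mc : measurable_wrt (F 0) c by exact: clip_wrt.
have mr : measurable_wrt (F 0) r.
  by apply: measurableT_comp; [exact: normr_measurable|exact: measurable_funB].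
have ir : intg r by exact: (intg_abs (intgB ig (ic j))).
have irdl : intg (fun w => r w - dl) by apply: intgB => //; exact: intg_cst.
have Vi := markov_op_int; have Vle := markov_op_le.
pose B := maximal_set markov_op (fun w => r w - dl).
have mB : measurable B by exact: (measurable_maximal_set Vi irdl).
exists B; split => //.
(* The maximal inequality reads [dl * P B <= Ex (1_B r)], which is at most [dl * eta]. *)
- have := maximal_ergodic Vi markov_op_Ex Vle markov_op_ge0 irdl.
  under eq_Rintegral do rewrite mulrBr [_ * dl]mulrC.
  rewrite ExB; [|exact: intg_indicM|exact/intgZ/intg_indic].
  rewrite ExZ; last exact: intg_indic.
  rewrite -Ex_indic// lee_fin subr_ge0 -/B => h1.
  rewrite -(ler_pM2l dl0) (le_trans h1)// (le_trans _ jeta)//.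
  apply: Ex_le => //; first exact: intg_indicM.
  by apply: aeW => w; rewrite ler_piMl ?normr_ge0// indicE lern1; case: (_ \in _).
have h1 : {ae P, forall w, (quenched_sum n c w / n%:R - Ex c) @[n --> \oo] --> 0}.
  pose gn n w := n.+1%:R^-1 * birkhoff T n.+1 c w - Ex c.
  pose hn n w := n.+1%:R^-1 * quenched_sum n.+1 c w - Ex c.
  have ib n : intg (birkhoff T n c) by apply: intg_sum => k; exact: (intg_iter k (ic j)).
  have : {ae P, forall w, hn n w @[n --> \oo] --> 0}.
    apply: (@cond_exp_bounded_cvg0 _ _ _ P _ (@F_meas 0) gn hn (j%:R + `|Ex c|)).
    + by move=> n; apply: intgB; [exact: (intgZ _ (ib _))|exact: intg_cst].
    + move=> n; apply: is_cond_expB => //; [exact: (intgZ _ (ib _))|exact: intg_cst| |].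
        by apply: is_cond_expZ => //; exact: is_cond_exp_quenched_sum.
      by apply: is_cond_exp_id; [exact: measurable_cst|exact: intg_cst].
    + move=> n w; rewrite (le_trans (ler_normB _ _))// lerD2r normrM ger0_norm//.
      rewrite mulrC ler_pdivrMr// (le_trans (ler_norm_sum _ _ _))//.
      apply: (@le_trans _ _ (\sum_(0 <= k < n.+1) j%:R)); first by apply: ler_sum => k _; exact: clip_bd.
      by rewrite sumr_const_nat subn0 -[X in X <= _]mulr_natr.
    + apply: filterS (birkhoff_ergodic (ef_mp ef) (ef_ergodic ef) (ic j)) => w.
      rewrite -subr_cvg0 -(cvg_shiftS (fun n => _ - _)) /gn.
      by under eq_fun do rewrite mulrC.
  apply: filterS => w hw; rewrite -(cvg_shiftS (fun n => _ - _)).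
  suff -> : (fun n => quenched_sum n.+1 c w / n.+1%:R - Ex c) = hn^~ w by [].
  by apply/funext => n; rewrite /hn mulrC.
have h2 : {ae P, forall w, ~ B w -> forall n, quenched_sum n r w <= n%:R * dl}.
  have : {ae P, forall w, forall n, orbit_sum markov_op (fun w => r w - dl) n w =
      quenched_sum n r w - n%:R * dl}.
    by apply: ae_foralln => n; exact: orbit_sum_markov.
  apply: filterS2 (orbit_sum_le0 Vi Vle irdl) => w hw hq nB n.
  by have := hw nB n; rewrite hq subr_le0.
have h3 : {ae P, forall w, forall k, `|E0 (fun w => g (iter k T w)) w - E0 (fun w => c (iter k T w)) w|
    <= E0 (fun w => r (iter k T w)) w}.
  apply: ae_foralln => k.
  have igk := intg_iter k ig; have ick := intg_iter k (ic j); have irk := intg_iter k ir.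
  have l1 : {ae P, forall w, E0 (fun w => g (iter k T w)) w - E0 (fun w => c (iter k T w)) w
      <= E0 (fun w => r (iter k T w)) w}.
    apply: (cond_exp_mono (@F_meas 0) (intgB igk ick) irk _ (E0P irk)).
      by apply: is_cond_expB => //; exact: E0P.
    by apply: aeW => w; exact: ler_norm.
  have l2 : {ae P, forall w, E0 (fun w => c (iter k T w)) w - E0 (fun w => g (iter k T w)) w
      <= E0 (fun w => r (iter k T w)) w}.
    apply: (cond_exp_mono (@F_meas 0) (intgB ick igk) irk _ (E0P irk)).
      by apply: is_cond_expB => //; exact: E0P.
    by apply: aeW => w; rewrite /r distrC; exact: ler_norm.
  by apply: filterS2 l1 l2 => w l1 l2; rewrite ler_norml; apply/andP; split; lra.
have h4 : `|Ex c - Ex g| <= dl.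
  rewrite distrC -ExB//.
  by rewrite (le_trans (Ex_abs_le _))//; exact: intgB.
apply: filterS3 h1 h2 h3 => w /cvgrPdist_le /(_ _ dl0)[N _ HN] h2 h3 /h2 {}h2.
exists N.+1 => -[//|n] Nn; have /= := HN n.+1 (ltnW Nn).
rewrite sub0r normrN => h5.
have n0 : 0 < n.+1%:R :> R by [].
have h6 : `|quenched_sum n.+1 g w / n.+1%:R - quenched_sum n.+1 c w / n.+1%:R| <= dl.
  rewrite -mulrBl normrM [X in _ * X]ger0_norm// ler_pdivrMr// mulrC.
  rewrite (le_trans _ (h2 n.+1))// /quenched_sum -sumrB.
  by rewrite (le_trans (ler_norm_sum _ _ _))//; apply: ler_sum => k _.
have aux (x y u v z : R) : 0 < z -> `|u - v| <= z -> `|y - u| <= z -> `|x - y| <= z ->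
    `|x - v| <= 4 * z.
  rewrite !ler_norml => z0 /andP[? ?] /andP[? ?] /andP[? ?].
  by apply/andP; split; lra.
by rewrite (_ : e = 4 * dl) ?(aux _ _ _ _ _ dl0 h4 h5 h6)// /dl; field.
Qed.

End filtration.

(** * Taylor bounds for sine, cosine and the exponential *)

Section trigonometric_bounds.
Context {R : realType}.
Implicit Types x y a : R.

(** Mean value theorem. The estimates below form a chain in which the derivative of each difference
    is nonnegative by an earlier one. *)
Lemma nonneg_derive (f f' : R -> R) : (forall x, is_derive x 1 f (f' x)) ->
  f 0 = 0 -> (forall x, 0 <= x -> 0 <= f' x) -> forall x, 0 <= x -> 0 <= f x.
Proof.
move=> df f0 f'0 x; rewrite le_eqVlt => /predU1P[<-|x0]; first by rewrite f0.
have [|c /andP[c0 cx]] := @MVT R f f' 0 x x0.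
- by apply: derivable_within_continuous => y _; apply: ex_derive.
- by rewrite f0 !subr0 => ->; rewrite mulr_ge0// ?f'0// ltW.
Qed.

(** Restates a derivative assembled by the rules below for the function actually wanted, leaving two
    pointwise identities for [field]. *)
Let der (f : R -> R) (f' g g' : R -> R) : (forall x, is_derive x 1 f (f' x)) -> f =1 g -> f' =1 g' ->
  forall x, is_derive x 1 g (g' x).
Proof. by move=> df /funext <- /funext <-. Qed.

Let derX n : forall x : R, is_derive x 1 (fun y : R => y ^+ n.+1 : R) (n.+1%:R * x ^+ n).
Proof.
move=> x; have := @is_deriveX R R (fun y : R => y : R) n.+1 x 1 1 (is_derive_id x 1).
rewrite /= /GRing.scale/= mulr1; congr is_derive.
by apply/funext => y; elim: n => [//|n IH]; rewrite exprS [RHS]exprS -IH.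
Qed.

Let derD (f g f' g' : R -> R) : (forall x, is_derive x 1 f (f' x)) ->
  (forall x, is_derive x 1 g (g' x)) -> forall x, is_derive x 1 (fun y => f y + g y) (f' x + g' x).
Proof. by move=> df dg x; exact: is_deriveD. Qed.

Let derZ c (f f' : R -> R) : (forall x, is_derive x 1 f (f' x)) ->
  forall x, is_derive x 1 (fun y => c * f y) (c * f' x).
Proof. by move=> df x; exact: (is_deriveZ c). Qed.

Let derC (c : R) : forall x : R, is_derive x 1 (fun=> c) ((fun=> 0) x).
Proof. by move=> x; exact: is_derive_cst. Qed.

Let dsin : forall x : R, is_derive x 1 sin (cos x) := @is_derive_sin R.
Let dcos : forall x : R, is_derive x 1 cos (- sin x) := @is_derive_cos R.

Lemma sin_le x : 0 <= x -> sin x <= x.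
Proof.
move=> x0; rewrite -subr_ge0.
have dF := der (g := fun y => y - sin y) (g' := fun y => 1 - cos y) (derD (derX 0) (derZ (-1) dsin)).
apply: (nonneg_derive (dF _ _) _ _ x0).
- by move=> y /=; field.
- by move=> y /=; field.
- by rewrite sin0; field.
- by move=> y y0; rewrite subr_ge0 cos_le1.
Qed.

Lemma cos_ge x : 0 <= x -> 1 - cos x <= x ^+ 2 / 2.
Proof.
move=> x0; rewrite -subr_ge0.
have dF := der (g := fun y => y ^+ 2 / 2 - (1 - cos y)) (g' := fun y => y - sin y) (derD (derD (derZ 2^-1 (derX 1)) (derC (-1))) dcos).
apply: (nonneg_derive (dF _ _) _ _ x0).
- by move=> y /=; field.
- by move=> y /=; field.
- by rewrite cos0; field.
- by move=> y y0; rewrite subr_ge0 sin_le.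
Qed.

Lemma cos_ge1 x : 0 <= x -> 1 - cos x <= 2 * x.
Proof.
move=> x0; rewrite -subr_ge0.
have dF := der (g := fun y => 2 * y - (1 - cos y)) (g' := fun y => 2 - sin y) (derD (derD (derZ 2 (derX 0)) (derC (-1))) dcos).
apply: (nonneg_derive (dF _ _) _ _ x0).
- by move=> y /=; field.
- by move=> y /=; field.
- by rewrite cos0; field.
- by move=> y y0; have := sin_le1 y; lra.
Qed.

Lemma sin_ge2 x : 0 <= x -> x - sin x <= x ^+ 2.
Proof.
move=> x0; rewrite -subr_ge0.
have dF := der (g := fun y => y ^+ 2 - (y - sin y)) (g' := fun y => 2 * y - (1 - cos y)) (derD (derD (derX 1) (derZ (-1) (derX 0))) dsin).
apply: (nonneg_derive (dF _ _) _ _ x0).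
- by move=> y /=; field.
- by move=> y /=; field.
- by rewrite sin0; field.
- by move=> y y0; rewrite subr_ge0 cos_ge1.
Qed.

Lemma sin_ge3 x : 0 <= x -> x - sin x <= x ^+ 3.
Proof.
move=> x0; rewrite -subr_ge0.
have dF := der (g := fun y => y ^+ 3 - (y - sin y)) (g' := fun y => 3 * y ^+ 2 - (1 - cos y)) (derD (derD (derX 2) (derZ (-1) (derX 0))) dsin).
apply: (nonneg_derive (dF _ _) _ _ x0).
- by move=> y /=; field.
- by move=> y /=; field.
- by rewrite sin0; field.
- by move=> y y0; have := cos_ge y0; have := sqr_ge0 y; lra.
Qed.

Lemma cos_taylor3 x : 0 <= x -> cos x - 1 + x ^+ 2 / 2 <= x ^+ 3.
Proof.
move=> x0; rewrite -subr_ge0.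
have dF := der (g := fun y => y ^+ 3 - (cos y - 1 + y ^+ 2 / 2)) (g' := fun y => 3 * y ^+ 2 - (y - sin y)) (derD (derD (derD (derX 2) (derZ (- 2^-1) (derX 1))) (derC 1)) (derZ (-1) dcos)).
apply: (nonneg_derive (dF _ _) _ _ x0).
- by move=> y /=; field.
- by move=> y /=; field.
- by rewrite cos0; field.
- by move=> y y0; have := sin_ge2 y0; have := sqr_ge0 y; lra.
Qed.

(** The minimum combines the quadratic bound for large [x] with the cubic one for small [x]. This is
    the form for Lindeberg's method with second moments only. *)
Lemma cos_taylor a x :
  `|cos (a + x) - (cos a - x * sin a - x ^+ 2 / 2 * cos a)| <= 2 * (x ^+ 2 * Num.min 1 `|x|).
Proof.
have P (y : R) : 0 <= y -> 0 <= cos y - 1 + y ^+ 2 / 2 <= y ^+ 2 * Num.min 1 y /\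
    0 <= y - sin y <= y ^+ 2 * Num.min 1 y.
  move=> y0; have := cos_ge y0; have := sin_le y0; have := cos_le1 y.
  have := sin_ge2 y0; have := sin_ge3 y0; have := cos_taylor3 y0; have := sqr_ge0 y.
  case: (lerP 1 y) => hy; rewrite ?min_l ?min_r// ?(ltW hy)// => *.
    by split; apply/andP; split; lra.
  by rewrite -exprSr; split; apply/andP; split; lra.
have [] := P _ (normr_ge0 x).
set m := _ * Num.min 1 _; rewrite -normrX (@ger0_norm _ (x ^+ 2)) ?sqr_ge0// => hc hs.
have {hc}hc : 0 <= cos x - 1 + x ^+ 2 / 2 <= m.
  by move: hc; case: (ger0P x) => // _; rewrite cosN.
have {hs}hs : `|sin x - x| <= m.
  move: hs; rewrite /m; case: (ger0P x) => _; rewrite ?sinN => /andP[h1 h2];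
    by rewrite ler_norml; apply/andP; split; rewrite -?normrX ?ger0_norm ?sqr_ge0//; lra.
have -> : cos (a + x) - (cos a - x * sin a - x ^+ 2 / 2 * cos a) =
    cos a * (cos x - 1 + x ^+ 2 / 2) - sin a * (sin x - x) by rewrite cosD; ring.
rewrite (le_trans (ler_normB _ _))// !normrM (_ : 2 * _ = m + m); last by rewrite /m -normrX (@ger0_norm _ (x ^+ 2)) ?sqr_ge0//; lra.
have cb : `|cos a| <= 1 by rewrite ler_norml cos_geN1 cos_le1.
have sb : `|sin a| <= 1 by rewrite ler_norml sin_geN1 sin_le1.
move: hc => /andP[hc1 hc2]; rewrite lerD//.
  by rewrite (le_trans (ler_piMl _ cb))// ger0_norm.
by rewrite (le_trans (ler_piMl _ sb)).
Qed.

Lemma cos_lipschitz x y : `|cos x - cos y| <= `|x - y|.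
Proof.
wlog xy : x y / x < y.
  move=> H; have [|//|->] := ltgtP x y; [exact: H| |by rewrite subrr normr0].
  by rewrite distrC [X in _ <= X]distrC; exact: H.
have [|c _] := @MVT R cos (fun x => - sin x) x y xy (fun x _ => dcos x).
  by apply: derivable_within_continuous => z _; apply: ex_derive.
rewrite distrC => ->; rewrite normrM [X in _ <= X]distrC ler_piMl//.
by rewrite normrN ler_norml sin_geN1 sin_le1.
Qed.

Lemma expRN_taylor x : 0 <= x -> 0 <= expR (- x) - (1 - x) <= x ^+ 2.
Proof.
move=> x0; apply/andP; split; first by rewrite subr_ge0; exact: expR_ge1Dx.
have := expR_ge1Dx x => h; rewrite lerBlDr expRN.
have x1 : 0 < 1 + x by lra.
rewrite (le_trans (y := (1 + x)^-1)) ?lef_pV2 ?posrE ?expR_gt0//.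
rewrite -[X in X <= _]mul1r ler_pdivrMr//.
have : 0 <= x ^+ 3 by rewrite exprn_ge0.
by lra.
Qed.

Lemma expRN_lipschitz x y : 0 <= x -> x <= y -> 0 <= expR (- x) - expR (- y) <= y - x.
Proof.
move=> x0 xy; rewrite subr_ge0 ler_expR lerN2 xy/=.
have -> : - y = - x + - (y - x) by ring.
have := expR_ge1Dx (- (y - x)); rewrite expRD => h.
have e1 : expR (- x) <= 1 by rewrite -expR0 ler_expR; lra.
have e0 := expR_gt0 (- x).
set e := expR (- x) in e1 e0 *; set g := expR (- (y - x)) in h *.
have : 0 <= (1 - e) * (y - x) by rewrite mulr_ge0; lra.
have : e * (1 - (y - x)) <= e * g by rewrite ler_wpM2l// ltW.
by lra.
Qed.

End trigonometric_bounds.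

(** * Approximate coboundaries, and comparison under conditioning on [F 0] *)

Section quenched_domination.
Context d (Om : measurableType d) (R : realType) (P : probability Om R).
Variables (T : Om -> Om) (F : int -> set (set Om)).
Hypothesis ef : ergodic_filtration P T F.
Implicit Types (f g h : Om -> R).
Local Notation intg f := (P.-integrable setT (EFin \o f)).
Local Notation Ex f := (Rintegral P setT f).
Local Notation E0 := (cond_exp P (F 0)).
Local Notation Q := (markov_op P T F).
Local Notation qs := (quenched_sum P T F).

Let F0 := @F_meas _ _ _ _ _ _ ef 0.

(** Since [h - Q^j h = (I - Q) (qs j h)], averaging over [j <= m] gives [h - A m = G - Q G] with
    [A m] the Cesaro mean of the iterates. The remainder [A m - Ex h] tends to zero almost
    everywhere by [quenched_ergodic], and in L1 because [A m] is nonnegative with constant mean. *)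
Lemma coboundary h (eta : R) : 0 < eta -> measurable_wrt (F 0) h -> intg h ->
  (forall w, 0 <= h w) ->
  exists g r, [/\ measurable_wrt (F 0) g, intg g, measurable_wrt (F 0) r, intg r &
    {ae P, forall w, h w - Ex h = g w - Q g w + r w} /\ Ex (fun w => `|r w|) <= eta].
Proof.
move=> eta0 mh ih h0.
pose A m w := m.+1%:R^-1 * qs m.+1 h w.
have iq m : intg (qs m h) by exact: quenched_sum_int.
have iA m : intg (A m) by exact: intgZ.
have Eq m : Ex (qs m h) = m%:R * Ex h.
  rewrite Ex_sum; last by move=> k; exact: (E0_int ef (intg_iter ef k ih)).
  rewrite -(subn0 m) -[X in X%:R * _]subn0 mulr_natl -sumr_const_nat; apply: eq_bigr => k _.
  by rewrite (Ex_cond_exp F0 (E0P ef (intg_iter ef k ih))) (Ex_iter ef).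
have EA m : Ex (A m) = Ex h.
  by rewrite ExZ// Eq mulrA mulVf ?mul1r.
have qs_wrt m : measurable_wrt (F 0) (qs m h).
  by have [] := is_cond_exp_quenched_sum ef m ih.
have A0 m : {ae P, forall w, 0 <= A m w}.
  have : {ae P, forall w, forall k, 0 <= E0 (fun w => h (iter k T w)) w}.
    by apply: ae_foralln => k; apply: (E0_ge0 ef); [exact: (intg_iter ef k ih)|by apply: aeW => w].
  by apply: filterS => w hw; rewrite mulr_ge0 ?invr_ge0//; apply: sumr_ge0 => k _.
have Eh0 : 0 <= Ex h by apply: Ex_ge0 => //; exact: aeW.
(* Scheffe: the negative parts are dominated by the constant [Ex h]. *)
pose N m w : R := Num.max 0 (Ex h - A m w).
have mN m : measurable_fun setT (N m).
  apply: measurable_maxr; first exact: measurable_cst.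
  by apply: measurable_funB; [exact: measurable_cst|exact: intg_meas (iA m)].
have Nle m : {ae P, forall w, `|N m w| <= Ex h}.
  apply: filterS (A0 m) => w h1; rewrite ger0_norm ?le_max ?lexx//.
  by rewrite ge_max Eh0/=; lra.
have [|||||_ Ncv] := @Ex_dct _ _ _ P N (fun=> 0) (fun=> Ex h).
- exact: mN.
- exact: measurable_cst.
- exact: intg_cst.
- apply: filterS (quenched_ergodic ef mh ih) => w.
  rewrite -(cvg_shiftS (fun n => qs n h w / n%:R)) => /cvgrPdist_le hcv.
  apply/cvgrPdist_le => e e0; apply: filterS (hcv _ e0) => n /=.
  move=> h1; rewrite sub0r normrN ger0_norm; last by rewrite le_max lexx.
  by rewrite ge_max (ltW e0)/= /A [_^-1 * _]mulrC (le_trans (ler_norm _)).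
- exact: Nle.
rewrite Ex_cst in Ncv.
have iN m : intg (N m).
  apply: (intg_ae (f := fun w => Num.min (Ex h) (N m w))) => //.
    apply: intg_le (intg_cst P (Ex h)) _.
      by apply: measurable_minr => //; exact: measurable_cst.
    move=> w; rewrite ger0_norm ?ge_min ?lexx//.
    by rewrite le_min Eh0 le_max lexx.
  by apply: filterS (Nle m) => w h1; rewrite min_r// (le_trans (ler_norm _)).
have [m Nm] : exists m, Ex (N m) <= eta / 2.
  have e2 : 0 < eta / 2 by rewrite divr_gt0.
  move/cvgrPdist_le : Ncv => /(_ _ e2)[m _ /(_ m (leqnn m))] /=.
  by rewrite sub0r normrN => /(le_trans (ler_norm _)); exists m.
pose G w := m.+1%:R^-1 * \sum_(0 <= j < m.+1) qs j h w.
pose r w := A m w - Ex h.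
have iG : intg G by apply: intgZ; exact: intg_sum.
exists G, r; split => //.
- by apply: measurable_funM; [exact: measurable_cst|exact: measurable_sum].
- apply: measurable_funB; last exact: measurable_cst.
  by apply: measurable_funM; [exact: measurable_cst|exact: qs_wrt].
- by apply: intgB => //; exact: intg_cst.
split; last first.
  (* [N m] is the negative part of [r], and [r] has mean zero. *)
  have -> : Ex (fun w => `|r w|) = Ex (fun w => r w + 2 * N m w).
    apply: eq_Rintegral => w _; rewrite /r /N.
    case: (lerP 0 (Ex h - A m w)) => h1; last by rewrite mulr0 addr0 ger0_norm; lra.
    by rewrite ler0_norm; lra.
  rewrite ExD; [|by apply: intgB => //; exact: intg_cst|exact: intgZ].
  by rewrite ExB ?EA ?Ex_cst ?subrr ?add0r ?ExZ//; [lra|exact: intg_cst].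
have iS : intg (fun w => \sum_(0 <= j < m.+1) qs j h w) by exact: intg_sum.
have iE k : intg (E0 (fun w => h (iter k T w))) by exact: (E0_int ef (intg_iter ef k ih)).
have QG : {ae P, forall w, Q G w = m.+1%:R^-1 * \sum_(0 <= j < m.+1) \sum_(0 <= k < j)
    Q (E0 (fun w => h (iter k T w))) w}.
  apply: (E0_unique ef); first exact: (intg_mp (ef_mp ef) iG).
  apply: is_cond_expZ => //; first exact: (intg_mp (ef_mp ef) iS).
  apply: is_cond_exp_sum => // j; first exact: (intg_mp (ef_mp ef) (iq j)).
  apply: is_cond_exp_sum => // k; first exact: (intg_mp (ef_mp ef) (iE k)).
  by apply: (E0P ef); exact: (intg_mp (ef_mp ef) (iE k)).
have Qk : {ae P, forall w, forall k, E0 (fun w => h (iter k.+1 T w)) w =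
    Q (E0 (fun w => h (iter k T w))) w}.
  by apply: ae_foralln => k; exact: markov_iter.
have h3 : {ae P, forall w, E0 h w = h w} by apply: (E0_unique ef).
apply: filterS3 QG Qk h3 => w -> Qk h3.
have Gj j : qs j h w - \sum_(0 <= k < j) Q (E0 (fun w => h (iter k T w))) w =
    h w - E0 (fun w => h (iter j T w)) w.
  rewrite /quenched_sum -sumrB -h3.
  under eq_bigr do rewrite -Qk.
  elim: j => [|j IH]; first by rewrite big_nil /= subrr.
  by rewrite big_nat_recr//= IH; ring.
rewrite /G -mulrBr -sumrB; under eq_bigr do rewrite Gj.
rewrite sumrB sumr_const_nat subn0 /r /A -/(qs m.+1 h w) -[h w *+ _]mulr_natl mulrBr mulrA mulVf// mul1r.
by ring.
Qed.

(** Integrated form of [E0 f <= E0 g]. Sums and chains of such comparisons then involve no choice of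
    versions and no null sets. *)
Definition E0_dom f g := [/\ intg f, intg g & forall A, F 0 A ->
  Ex (fun w => \1_A w * f w) <= Ex (fun w => \1_A w * g w)].

Let mF0 A : F 0 A -> measurable A. Proof. exact: F0. Qed.

Lemma E0_dom_le f g : E0_dom f g -> {ae P, forall w, E0 f w <= E0 g w}.
Proof.
move=> [if_ ig H]; apply: (cond_exp_le F0 if_ ig (E0P ef if_) (E0P ef ig)) => A.
by rewrite (sigma_F ef); exact: H.
Qed.

Lemma E0_dom_ae f g : intg f -> intg g -> {ae P, forall w, f w <= g w} -> E0_dom f g.
Proof.
move=> if_ ig fg; split => // A /mF0 mA; apply: Ex_le; try exact: intg_indicM.
by apply: filterS fg => w fg; rewrite ler_wpM2l.
Qed.

Lemma E0_dom_refl f : intg f -> E0_dom f f.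
Proof. by []. Qed.

Lemma E0_dom_trans f g h : E0_dom f g -> E0_dom g h -> E0_dom f h.
Proof.
move=> [if_ _ H] [_ ih H']; split => // A FA; exact: le_trans (H A FA) (H' A FA).
Qed.

Lemma E0_domD f g f' g' : E0_dom f g -> E0_dom f' g' ->
  E0_dom (fun w => f w + f' w) (fun w => g w + g' w).
Proof.
move=> [if_ ig H] [if' ig' H']; split; try exact: intgD.
move=> A FA; have mA := mF0 FA.
under eq_Rintegral do rewrite mulrDr; under [X in _ <= X]eq_Rintegral do rewrite mulrDr.
by rewrite !ExD ?lerD ?H ?H'//; exact: intg_indicM.
Qed.

Lemma E0_domZ (c : R) f g : 0 <= c -> E0_dom f g ->
  E0_dom (fun w => c * f w) (fun w => c * g w).
Proof.
move=> c0 [if_ ig H]; split; try exact: intgZ.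
move=> A FA; have mA := mF0 FA.
under eq_Rintegral do rewrite mulrCA; under [X in _ <= X]eq_Rintegral do rewrite mulrCA.
by rewrite !ExZ ?ler_wpM2l ?H//; exact: intg_indicM.
Qed.

Lemma E0_dom_sum n (f g : nat -> Om -> R) : (forall k, (k < n)%N -> E0_dom (f k) (g k)) ->
  E0_dom (fun w => \sum_(0 <= k < n) f k w) (fun w => \sum_(0 <= k < n) g k w).
Proof.
elim: n => [|n IH] H.
  under eq_fun do rewrite big_nil; under [X in E0_dom _ X]eq_fun do rewrite big_nil.
  by apply: E0_dom_ae; [exact: intg_cst|exact: intg_cst|exact: aeW].
under eq_fun do rewrite big_nat_recr//=; under [X in E0_dom _ X]eq_fun do rewrite big_nat_recr//=.
by apply: E0_domD; [apply: IH => k kn; apply: H; exact: ltnW|exact: H].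
Qed.

(** A set [A] of [F 0] lies in [F k], so [1_A b] can be pulled out of the conditional expectation
    given [F k]. *)
Lemma E0_pull (k : nat) b f h : intg f -> is_cond_exp P (F k%:Z) f h ->
  measurable_wrt (F k%:Z) b -> intg (fun w => b w * f w) -> intg (fun w => b w * h w) ->
  forall A, F 0 A -> Ex (fun w => \1_A w * (b w * f w)) = Ex (fun w => \1_A w * (b w * h w)).
Proof.
move=> if_ hc mb ibf ibh A FA; have mA := mF0 FA.
have FkA : F k%:Z A by apply: (F_mono ef) FA.
under eq_Rintegral do rewrite mulrA; under [RHS]eq_Rintegral do rewrite mulrA.
apply/esym; apply: (cond_exp_pull (@F_meas _ _ _ _ _ _ ef _) if_ hc).
- apply: measurable_funM => //; apply: measurable_indic.
  by rewrite (sigma_F ef).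
- by under eq_fun do rewrite -mulrA; exact: (intg_indicM mA ibf).
- by under eq_fun do rewrite -mulrA; exact: (intg_indicM mA ibh).
Qed.

Lemma E0_dom_pull (k : nat) b f h : intg f -> is_cond_exp P (F k%:Z) f h ->
  measurable_wrt (F k%:Z) b -> intg (fun w => b w * f w) -> intg (fun w => b w * h w) ->
  E0_dom (fun w => b w * f w) (fun w => b w * h w) /\
  E0_dom (fun w => b w * h w) (fun w => b w * f w).
Proof.
by move=> if_ hc mb ibf ibh; split; split => // A FA; rewrite (E0_pull if_ hc mb ibf ibh FA).
Qed.

End quenched_domination.

(** * Cesaro means and summation by parts *)

Section real_sequences.
Context {R : realType}.
Implicit Types (v : nat -> R) (l : R).

Lemma cesaro_shift v l : (\sum_(0 <= k < n) v k) / n%:R @[n --> \oo] --> l ->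
  (\sum_(0 <= k < n.+1) v k.+1) / n.+1%:R @[n --> \oo] --> l.
Proof.
move=> hv.
have h1 : (\sum_(0 <= k < n.+2) v k) / n.+2%:R @[n --> \oo] --> l.
  by move: hv; rewrite -(cvg_shiftS (fun n => _ / _ : R)) -(cvg_shiftS (fun n => _ / _ : R)).
have i0 : n.+1%:R^-1 @[n --> \oo] --> (0 : R) by exact: cvg_harmonic.
have h2 : ((\sum_(0 <= k < n.+2) v k) / n.+2%:R) * (1 + n.+1%:R^-1) - v 0%N * n.+1%:R^-1
    @[n --> \oo] --> l.
  rewrite [X in _ --> X](_ : l = l * (1 + 0) - v 0%N * 0); last by rewrite addr0 mulr1 mulr0 subr0.
  apply: cvgB; apply: cvgM => //; first by apply: cvgD => //; exact: cvg_cst.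
  exact: cvg_cst.
move: h2; apply: cvg_trans; apply: near_eq_cvg; apply: nearW => n.
rewrite [\sum_(0 <= k < n.+2) _]big_nat_recl// -(natr1 n.+1).
have n1 : n.+1%:R != 0 :> R by [].
have n2 : n.+1%:R + 1 != 0 :> R by rewrite natr1.
by move: (\sum_(0 <= k < n.+1) _) (n.+1%:R) n1 n2 => S x n1 n2; field; rewrite n1 n2.
Qed.

(** [v n] is the difference of two consecutive partial sums, whose normalised values have the same
    limit. *)
Lemma cesaro_last v l : (\sum_(0 <= k < n) v k) / n%:R @[n --> \oo] --> l ->
  v n / n.+1%:R @[n --> \oo] --> 0.
Proof.
move=> hv.
have h1 : (\sum_(0 <= k < n.+1) v k) / n.+1%:R @[n --> \oo] --> l.
  by move: hv; rewrite -(cvg_shiftS (fun n => _ / _ : R)).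
have i0 : n.+1%:R^-1 @[n --> \oo] --> (0 : R) by exact: cvg_harmonic.
have h2 : (\sum_(0 <= k < n.+1) v k) / n.+1%:R -
  ((\sum_(0 <= k < n) v k) / n%:R) * (1 - n.+1%:R^-1) @[n --> \oo] --> 0.
  rewrite [X in _ --> X](_ : 0 = l - l * (1 - 0)); last by rewrite subr0 mulr1 subrr.
  apply: cvgB => //; apply: cvgM => //; apply: cvgB => //; exact: cvg_cst.
move: h2; apply: cvg_trans; apply: near_eq_cvg; exists 1%N => // -[//|n] _ /=.
rewrite [\sum_(0 <= k < n.+2) _]big_nat_recr//= -(natr1 n.+1).
have n1 : n.+1%:R != 0 :> R by [].
have n2 : n.+1%:R + 1 != 0 :> R by rewrite natr1.
by move: (\sum_(0 <= k < n.+1) _) (n.+1%:R) n1 n2 => S x n1 n2; field; rewrite n1 n2.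
Qed.

Lemma abel_summation (b G : nat -> R) n :
  \sum_(0 <= k < n.+1) b k * (G k.+1 - G k.+2) =
  b 0%N * G 1%N - b n * G n.+2 + \sum_(0 <= k < n) (b k.+1 - b k) * G k.+2.
Proof.
elim: n => [|n IH]; first by rewrite big_nat1 big_nil; ring.
by rewrite big_nat_recr//= IH [in RHS]big_nat_recr//=; ring.
Qed.

(** Moves the differences from [G] to [b]: only the end values of [G] and the increments of [b]
    survive. *)
Lemma abel_bound (b G : nat -> R) n : (forall k, (k <= n)%N -> `|b k| <= 1) ->
  \sum_(0 <= k < n.+1) - b k * (G k.+1 - G k.+2) <=
  `|G 1%N| + `|G n.+2| + \sum_(0 <= k < n) `|b k.+1 - b k| * `|G k.+2|.
Proof.
move=> b1; have := abel_summation (fun k => - b k) G n => /= ->.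
have bn k x : (k <= n)%N -> - b k * x <= `|x|.
  move=> kn; rewrite (le_trans (ler_norm _))// normrM normrN ler_piMl//; exact: b1.
apply: lerD; first apply: lerD; first exact: bn.
  rewrite -mulrN -[X in _ <= X]normrN.
  by rewrite -[X in _ <= X]normrN opprK mulrN -mulNr opprK (le_trans (ler_norm _))// normrM ler_piMl// b1.
by apply: ler_sum => k _; rewrite -normrM (le_trans (ler_norm _))// -opprB opprK addrC -opprB mulNr normrN.
Qed.

End real_sequences.

(** * Lindeberg's method for the martingale, conditionally on [F 0] *)

Section martingale_clt.
Context d (Om : measurableType d) (R : realType) (P : probability Om R).
Variables (T : Om -> Om) (F : int -> set (set Om)).
Hypothesis ef : ergodic_filtration P T F.
Implicit Types (f g h : Om -> R).
Local Notation intg f := (P.-integrable setT (EFin \o f)).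
Local Notation Ex f := (Rintegral P setT f).
Local Notation E0 := (cond_exp P (F 0)).
Local Notation Q := (markov_op P T F).
Local Notation qs := (quenched_sum P T F).
Local Notation "f °^ k" := (fun w => f (iter k T w)) (at level 2, format "f °^ k").

Let measurable_cos' : measurable_fun setT (@cos R).
Proof. by apply: continuous_measurable_fun => x; exact: continuous_cos. Qed.

Let measurable_sin' : measurable_fun setT (@sin R).
Proof. by apply: continuous_measurable_fun => x; exact: continuous_sin. Qed.

Variable D : Om -> R.
Hypothesis mD : measurable_wrt (F 0) D.
Hypothesis iD2 : intg (fun w => D w ^+ 2).
Hypothesis Dc : is_cond_exp P (F (-1)) D (fun=> 0).

Let s2 := Ex (fun w => D w ^+ 2).
Let F_ i := @F_meas _ _ _ _ _ _ ef i.
Let mp k := iter_mp (ef_mp ef) k.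

Let mD0 : measurable_fun setT D. Proof. exact: (wrt_measurable (@F_ 0) mD). Qed.
Let iD : intg D. Proof. exact: intg_sqr. Qed.

Lemma is_cond_exp_next g k : intg g -> is_cond_exp P (F k%:Z) g°^k.+1 (Q g)°^k.
Proof.
move=> ig; have ig1 := intg_mp (ef_mp ef) ig.
have := is_cond_exp_iter ef k ig1 (E0P ef ig1).
by rewrite add0r; under eq_fun do rewrite -iterS.
Qed.

Lemma wrt_iterF g k j : (k <= j)%N -> measurable_wrt (F 0) g -> measurable_wrt (F j%:Z) g°^k.
Proof.
move=> kj mg; apply: (wrt_mono ef (i := k%:Z)); first by rewrite lez_nat.
by have := @wrt_iter _ _ _ _ _ _ ef 0 k g mg; rewrite add0r.
Qed.

Lemma martingale_diff k : is_cond_exp P (F k%:Z) D°^k.+1 (fun=> 0).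
Proof.
have := is_cond_exp_iter ef k.+1 iD Dc.
by rewrite intS addrA addNr add0r.
Qed.

Definition martingale k w : R := \sum_(1 <= i < k.+1) D (iter i T w).

Lemma martingaleS k w : martingale k.+1 w = martingale k w + D (iter k.+1 T w).
Proof. by rewrite /martingale big_nat_recr. Qed.

Lemma martingale0 w : martingale 0 w = 0.
Proof. by rewrite /martingale big_nil. Qed.

Lemma martingale_wrt k : measurable_wrt (F k%:Z) (martingale k).
Proof.
elim: k => [|k IH].
  by rewrite (_ : martingale 0 = fun=> 0); [exact: measurable_cst|apply/funext => w; rewrite martingale0].
rewrite (_ : martingale k.+1 = fun w => martingale k w + D (iter k.+1 T w)); last first.
  by apply/funext => w; rewrite martingaleS.
apply: measurable_funD; last exact: wrt_iterF.
by apply: (wrt_mono ef) IH; rewrite lez_nat.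
Qed.

Section one_step.
Variables (t th : R) (n : nat) (N : nat).
Hypothesis N0 : (0 < N)%N.
Hypothesis nN : (N <= n.+1)%N.

Let rn : R := Num.sqrt n.+1%:R.
Let c := s2 * t ^+ 2 / 2.
Let kap : R := t ^+ 2 / (2 * n.+1%:R).

Let rn0 : 0 < rn. Proof. by rewrite sqrtr_gt0. Qed.
Let rn2 : rn ^+ 2 = n.+1%:R. Proof. by rewrite sqr_sqrtr. Qed.
Let s20 : 0 <= s2. Proof. by apply: Rintegral_ge0 => w _; exact: sqr_ge0. Qed.
Let c0 : 0 <= c. Proof. by rewrite divr_ge0// mulr_ge0// sqr_ge0. Qed.
Let kap0 : 0 <= kap. Proof. by rewrite divr_ge0// sqr_ge0. Qed.
Let n0 : 0 < n.+1%:R :> R. Proof. by []. Qed.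

Definition clt_arg k w : R := t * martingale k w / rn + th.
Let a := clt_arg.
(** Stands for the variance still to come after step [k], replaced by its mean. It equals
    [exp (- c)] at [k = 0] and one at [k = n+1], so that [u k cos (a k)] interpolates between the
    two sides of the limit theorem. *)
Definition clt_damp (k : nat) : R := expR (- (c * (1 - k%:R / n.+1%:R))).
Let u := clt_damp.
Let b k w : R := u k.+1 * cos (a k w).
(** The truncation level is a fixed [N <= n+1] instead of [n+1]. The function thus does not vary
    with [n], the ergodic theorem applies to it, and [N] can be taken large beforehand. *)
Definition lindeberg_fun w : R := D w ^+ 2 * Num.min 1 (`|t| * `|D w| / Num.sqrt N%:R).
(** Bound for one increment of [b]: [c / N] from the damping, the other summand from the new
    martingale increment. The cap [2] keeps it bounded, so that it may multiply an integrable
    function. *)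
Definition oscillation_fun w : R := Num.min 2 (c / N%:R + `|t| * `|D w| / Num.sqrt N%:R).

Let u01 k : (k <= n.+1)%N -> 0 < u k <= 1.
Proof.
move=> kn; rewrite expR_gt0/= -[X in _ <= X]expR0 ler_expR oppr_le0 mulr_ge0//.
by rewrite subr_ge0 ler_pdivrMr// mul1r ler_nat.
Qed.

Let b1 k w : (k <= n)%N -> `|b k w| <= 1.
Proof.
move=> kn; have /andP[u0 u1] := u01 (kn : (k.+1 <= n.+1)%N).
rewrite /b normrM (gtr0_norm u0) mulr_ile1 ?(ltW u0)//.
by rewrite ler_norml cos_geN1 cos_le1.
Qed.

Let sqN0 : 0 < Num.sqrt N%:R :> R. Proof. by rewrite sqrtr_gt0 ltr0n. Qed.
Let sqNn : Num.sqrt N%:R <= rn. Proof. by rewrite ler_sqrt// ler_nat. Qed.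

Let b_step k w : (k < n)%N -> `|b k.+1 w - b k w| <= oscillation_fun (iter k.+1 T w).
Proof.
move=> kn; rewrite /oscillation_fun le_min; apply/andP; split.
  rewrite (le_trans (ler_normB _ _))//.
  by have := b1 w kn; have := b1 w (ltnW kn); lra.
have aS : a k.+1 w - a k w = t * D (iter k.+1 T w) / rn.
  by rewrite /a /clt_arg martingaleS; field; rewrite gt_eqF.
have -> : b k.+1 w - b k w = (u k.+2 - u k.+1) * cos (a k.+1 w) +
   u k.+1 * (cos (a k.+1 w) - cos (a k w)) by rewrite /b; ring.
rewrite (le_trans (ler_normD _ _))// lerD//.
  rewrite normrM (le_trans (ler_piMr _ _))//.
    by rewrite ler_norml cos_geN1 cos_le1.
  have := @expRN_lipschitz R (c * (1 - k.+2%:R / n.+1%:R)) (c * (1 - k.+1%:R / n.+1%:R)).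
  rewrite -/(u k.+2) -/(u k.+1) => /(_ _ _)/andP[||h1 h2].
  - by rewrite mulr_ge0// subr_ge0 ler_pdivrMr// mul1r ler_nat.
  - by rewrite ler_wpM2l// lerD2l lerN2 ler_wpM2r// ?invr_ge0// ler_nat.
  rewrite ger0_norm// (le_trans h2)// -mulrBr ler_wpM2l//.
  rewrite (_ : _ - _ = n.+1%:R^-1); last first.
    by rewrite -[k.+2%:R]natr1; field; rewrite gt_eqF.
  by rewrite lef_pV2 ?posrE ?ltr0n// ler_nat.
have /andP[u0 u1] := u01 (ltnW kn : (k.+1 <= n.+1)%N).
rewrite normrM (gtr0_norm u0) (le_trans (ler_piMl _ u1))//.
rewrite (le_trans (cos_lipschitz _ _))// aS !normrM normfV [X in _ / X]gtr0_norm//.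
by rewrite ler_wpM2l ?mulr_ge0// lef_pV2.
Qed.

Let Z k w : R := u k * cos (a k w).

Let X k w : R := - (t / rn * u k.+1 * sin (a k w)) * D (iter k.+1 T w).

(** Taylor expansion around [a k]. The first-order term is the martingale difference [X k]. The
    first-order effect of the damping, [c / (n+1)], equals [kap * s2] and centres the quadratic term
    to [D^2 - s2]. *)
Let one_step k w : (k <= n)%N -> Z k.+1 w - Z k w <=
  X k w - kap * b k w * (D (iter k.+1 T w) ^+ 2 - s2) +
  (2 * t ^+ 2 / n.+1%:R * lindeberg_fun (iter k.+1 T w) + (c / n.+1%:R) ^+ 2).
Proof.
move=> kn; set x := D _; set dl := t * x / rn.
have aS : a k.+1 w = a k w + dl.
  by rewrite /a /clt_arg martingaleS -/x /dl; field; rewrite gt_eqF.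
have uS : u k = u k.+1 * expR (- (c / n.+1%:R)).
  rewrite /u /clt_damp -expRD; congr expR.
  by rewrite -[k.+1%:R]natr1; field; rewrite gt_eqF.
have cn0 : 0 <= c / n.+1%:R by rewrite divr_ge0.
have /andP[e20 e21] := expRN_taylor cn0.
have e1 := cos_taylor (a k w) dl; rewrite -aS in e1.
have /andP[u0 u1] := u01 (kn : (k.+1 <= n.+1)%N).
have dl2 : dl ^+ 2 = t ^+ 2 * x ^+ 2 / n.+1%:R.
  by rewrite /dl !exprMn exprVn rn2.
have e3 : dl ^+ 2 * Num.min 1 `|dl| <= t ^+ 2 / n.+1%:R * lindeberg_fun (iter k.+1 T w).
  rewrite dl2 /lindeberg_fun -/x.
  have -> : t ^+ 2 * x ^+ 2 / n.+1%:R * Num.min 1 `|dl| =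
    t ^+ 2 / n.+1%:R * (x ^+ 2 * Num.min 1 `|dl|) by ring.
  rewrite ler_wpM2l ?divr_ge0 ?sqr_ge0// ler_wpM2l ?sqr_ge0//.
  rewrite le_min ge_min lexx/= ge_min; apply/orP; right.
  by rewrite /dl !normrM normfV (gtr0_norm rn0) ler_wpM2l ?mulr_ge0// lef_pV2.
pose e2 := expR (- (c / n.+1%:R)) - (1 - c / n.+1%:R).
pose e4 := cos (a k.+1 w) - (cos (a k w) - dl * sin (a k w) - dl ^+ 2 / 2 * cos (a k w)).
have -> : Z k.+1 w - Z k w = X k w - kap * b k w * (x ^+ 2 - s2) +
    u k.+1 * (e4 - e2 * cos (a k w)).
  have -> : Z k.+1 w - Z k w = u k.+1 * (cos (a k.+1 w) - expR (- (c / n.+1%:R)) * cos (a k w)).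
    by rewrite /Z uS; ring.
  have -> : cos (a k.+1 w) = e4 + (cos (a k w) - dl * sin (a k w) - dl ^+ 2 / 2 * cos (a k w)).
    by rewrite /e4; ring.
  have -> : expR (- (c / n.+1%:R)) = e2 + (1 - c / n.+1%:R) by rewrite /e2; ring.
  rewrite dl2 /X -/x /b /kap /dl /c; field; rewrite ?gt_eqF//.
rewrite lerD2l.
have cb : `|cos (a k w)| <= 1 by rewrite ler_norml cos_geN1 cos_le1.
rewrite (le_trans (ler_norm _))// normrM (gtr0_norm u0) (le_trans (ler_piMl _ u1))//.
rewrite (le_trans (ler_normB _ _))// lerD//.
  by rewrite (le_trans e1)// -mulrA -mulrA ler_pM2l// mulrA.
by rewrite normrM (le_trans (ler_piMr _ cb))// ger0_norm.
Qed.



Lemma lindeberg_fun_ge0 w : 0 <= lindeberg_fun w.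
Proof. by rewrite mulr_ge0 ?sqr_ge0// le_min ler01/= divr_ge0// mulr_ge0. Qed.

Lemma oscillation_fun_ge0 w : 0 <= oscillation_fun w.
Proof. by rewrite le_min ler0n/= addr_ge0// divr_ge0// mulr_ge0. Qed.

Lemma lindeberg_fun_wrt : measurable_wrt (F 0) lindeberg_fun.
Proof.
apply: measurable_funM; first exact: measurable_funX.
apply: measurable_minr; first exact: measurable_cst.
apply: measurable_funM; last exact: measurable_cst.
by apply: measurable_funM; [exact: measurable_cst|exact: measurableT_comp].
Qed.

Lemma oscillation_fun_wrt : measurable_wrt (F 0) oscillation_fun.
Proof.
apply: measurable_minr; first exact: measurable_cst.
apply: measurable_funD; first exact: measurable_cst.
apply: measurable_funM; last exact: measurable_cst.
by apply: measurable_funM; [exact: measurable_cst|exact: measurableT_comp].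
Qed.

Lemma lindeberg_fun_int : intg lindeberg_fun.
Proof.
apply: intg_le iD2 _; first exact: (wrt_measurable (@F_ 0) lindeberg_fun_wrt).
by move=> w; rewrite ger0_norm ?lindeberg_fun_ge0// /lindeberg_fun ler_piMr ?sqr_ge0// ge_min lexx.
Qed.

Lemma oscillation_fun_le w : `|oscillation_fun w| <= 2.
Proof. by rewrite ger0_norm ?oscillation_fun_ge0// /oscillation_fun ge_min lexx. Qed.

Variables g r : Om -> R.
Hypothesis mg : measurable_wrt (F 0) g.
Hypothesis ig : intg g.
Hypothesis ir : intg r.
Hypothesis gr : {ae P, forall w, D w ^+ 2 - s2 = g w - Q g w + r w}.

Let absg w : R := `|g w|.
Let iag : intg absg. Proof. exact: intg_abs. Qed.

(** Dominates the conditional expectation given [F k] of [oscillation_fun o T^k] times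
    [|g| o T^(k+1)], after a shift by [T^k]. The outer absolute value guards against a version of
    [Q |g|] that is negative on a null set. *)
Definition boundary_fun w : R := oscillation_fun w * `|Q absg w|.

Lemma boundary_fun_int : intg boundary_fun.
Proof.
apply: (intg_bdM _ oscillation_fun_le).
  exact: (wrt_measurable (@F_ 0) oscillation_fun_wrt).
exact/intg_abs/(markov_op_int ef).
Qed.

(** The sequences stand for [|g|], [boundary_fun], [|r|] and [lindeberg_fun] along the orbit. The
    expression is affine in them, so conditional expectation passes inside. *)
Definition clt_error (G H S L : nat -> R) : R :=
  kap * (G 1%N + G n.+2 + \sum_(0 <= k < n) H k.+1 + \sum_(0 <= k < n.+1) S k.+1) +
  2 * t ^+ 2 / n.+1%:R * (\sum_(0 <= k < n.+1) L k.+1) + n.+1%:R * (c / n.+1%:R) ^+ 2.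

Let mit k f : measurable_fun setT f -> measurable_fun setT f°^k.
Proof. exact: (measurable_comp_mp (mp k)). Qed.

Let it k f : intg f -> intg f°^k.
Proof. exact: (intg_iter ef). Qed.

Let a_wrt k : measurable_wrt (F k%:Z) (a k).
Proof.
apply: measurable_funD; last exact: measurable_cst.
apply: measurable_funM; last exact: measurable_cst.
by apply: measurable_funM; [exact: measurable_cst|exact: martingale_wrt].
Qed.

Let b_wrt k : measurable_wrt (F k%:Z) (b k).
Proof.
apply: measurable_funM; first exact: measurable_cst.
exact: (wrt_comp measurable_cos' (@a_wrt k)).
Qed.

Let wm k h : measurable_wrt (F k%:Z) h -> measurable_fun setT h.
Proof. exact: (wrt_measurable (@F_ _)). Qed.

Let iZ k : intg (Z k).
Proof.
apply: intgZ; apply: intg_le (intg_cst P 1) _.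
  exact: (wm (wrt_comp measurable_cos' (@a_wrt k))).
by move=> w; rewrite ler_norml cos_geN1 cos_le1.
Qed.

Let sin_wrt k : measurable_wrt (F k%:Z) (fun w => - (t / rn * u k.+1 * sin (a k w))).
Proof.
apply: measurableT_comp => //; apply: measurable_funM; first exact: measurable_cst.
exact: (wrt_comp measurable_sin' (@a_wrt k)).
Qed.

Let iX k : intg (X k).
Proof.
apply: (intg_bdM (wm (@sin_wrt k)) (c := `|t / rn * u k.+1|)) (it k.+1 iD).
move=> w; rewrite normrN normrM ler_piMr//.
by rewrite ler_norml sin_geN1 sin_le1.
Qed.

Let X_dom k : E0_dom P F (X k) (fun=> 0).
Proof.
have := E0_dom_pull ef (it k.+1 iD) (martingale_diff k) (@sin_wrt k) (iX k) _.
under [X in E0_dom _ _ _ X]eq_fun do rewrite mulr0.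
by case=> //; under eq_fun do rewrite mulr0; exact: intg_cst.
Qed.

Let ibM k f : intg f -> intg (fun w => - b k w * f w).
Proof.
move=> if_; apply: (intg_bdM (c := u k.+1)) => //.
  by apply: measurableT_comp => //; exact: (wm (@b_wrt k)).
move=> w; rewrite normrN /b normrM ger0_norm ?expR_ge0// ler_piMr ?expR_ge0//.
by rewrite ler_norml cos_geN1 cos_le1.
Qed.

(** [Q g o T^(k+1)] is the conditional expectation of [g o T^(k+2)] given [F (k+1)], where [b k] is
    measurable. The replacement turns the coboundary into differences along the orbit, ready for
    Abel summation. *)
Let coboundary_dom k :
  E0_dom P F (fun w => - b k w * (g (iter k.+1 T w) - Q g (iter k.+1 T w)))
    (fun w => - b k w * (g (iter k.+1 T w) - g (iter k.+2 T w))).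
Proof.
have mb : measurable_wrt (F k.+1%:Z) (fun w => - b k w).
  apply: measurableT_comp => //; apply: (wrt_mono ef) (@b_wrt k).
  by rewrite lez_nat.
have i1 := intgB (it k.+1 ig) (it k.+2 ig).
have i2 := intgB (it k.+1 ig) (it k.+1 (markov_op_int ef ig)).
have hc : is_cond_exp P (F k.+1%:Z) (fun w => g (iter k.+1 T w) - g (iter k.+2 T w))
    (fun w => g (iter k.+1 T w) - Q g (iter k.+1 T w)).
  apply: (is_cond_expB (@F_ _)); [exact: it|exact: it| |exact: is_cond_exp_next].
  by apply: is_cond_exp_id; [exact: wrt_iterF|exact: it].
exact: (proj2 (E0_dom_pull ef i1 hc mb (ibM k i1) (ibM k i2))).
Qed.

Let osc_dom k : E0_dom P F (fun w => oscillation_fun (iter k T w) * absg (iter k.+1 T w))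
  (boundary_fun°^k).
Proof.
have m1 : measurable_wrt (F k%:Z) oscillation_fun°^k.
  exact: wrt_iterF oscillation_fun_wrt.
have iQ := markov_op_int ef iag.
have i2 f : intg f -> intg (fun w => oscillation_fun (iter k T w) * f w).
  by apply: (intg_bdM (wm m1)) => w; exact: oscillation_fun_le.
have i1 : intg (fun w => oscillation_fun (iter k T w) * Q absg (iter k T w)) by exact/i2/it.
have /E0_dom_trans := proj1 (E0_dom_pull ef (it k.+1 iag) (is_cond_exp_next k iag) m1 (i2 _ (it k.+1 iag)) i1).
apply; apply: (E0_dom_ae ef) => //; first exact: (it k boundary_fun_int).
by apply: aeW => w; rewrite /boundary_fun ler_wpM2l ?oscillation_fun_ge0// ler_norm.
Qed.

(** The steps are summed pointwise with [D^2 - s2 = g - Q g + r] inserted ([d1]). Conditioning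
    removes the [X k] and replaces [Q g] ([d2]). Abel summation is pointwise ([d3]), and a last
    conditioning brings in [boundary_fun] ([d4]). *)
Lemma clt_error_dom : E0_dom P F (fun w => Z n.+1 w - Z 0%N w)
  (fun w => clt_error (fun k => absg (iter k T w)) (fun k => boundary_fun (iter k T w))
     (fun k => `|r (iter k T w)|) (fun k => lindeberg_fun (iter k T w))).
Proof.
have iQ := markov_op_int ef ig.
pose Y k w := - b k w * (g (iter k.+1 T w) - Q g (iter k.+1 T w)).
pose Y' k w := - b k w * (g (iter k.+1 T w) - g (iter k.+2 T w)).
pose W k w := kap * `|r (iter k.+1 T w)| +
  (2 * t ^+ 2 / n.+1%:R * lindeberg_fun (iter k.+1 T w) + (c / n.+1%:R) ^+ 2).
have iY k : intg (Y k) by apply: ibM; apply: intgB; exact: it.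
have iY' k : intg (Y' k) by apply: ibM; apply: intgB; exact: it.
have iW k : intg (W k).
  apply: intgD; first exact/intgZ/intg_abs/it.
  by apply: intgD; [exact/intgZ/it/lindeberg_fun_int|exact: intg_cst].
have isW : intg (fun w => \sum_(0 <= k < n.+1) W k w) by exact: intg_sum.
have iosc k : intg (fun w => oscillation_fun (iter k.+1 T w) * absg (iter k.+2 T w)).
  by have [] := osc_dom k.+1.
pose S3 w := kap * (absg (iter 1 T w) + absg (iter n.+2 T w) +
  \sum_(0 <= k < n) oscillation_fun (iter k.+1 T w) * absg (iter k.+2 T w)).
pose S4 w := kap * (absg (iter 1 T w) + absg (iter n.+2 T w) +
  \sum_(0 <= k < n) boundary_fun (iter k.+1 T w)).
have iS3 : intg S3 by apply/intgZ/intgD; [apply: intgD; exact: (it _ iag)|exact: intg_sum].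
have d1 : E0_dom P F (fun w => Z n.+1 w - Z 0%N w) (fun w => \sum_(0 <= k < n.+1) X k w +
    (kap * \sum_(0 <= k < n.+1) Y k w + \sum_(0 <= k < n.+1) W k w)).
  apply: (E0_dom_ae ef).
  - exact: intgB.
  - apply: intgD; first exact: intg_sum.
    by apply: intgD => //; apply: intgZ; exact: intg_sum.
  have : {ae P, forall w, forall k, D (iter k.+1 T w) ^+ 2 - s2 =
      g (iter k.+1 T w) - Q g (iter k.+1 T w) + r (iter k.+1 T w)}.
    by apply: ae_foralln => k; exact: (ae_iter ef k.+1 gr).
  apply: filterS => w grw.
  rewrite -(telescope_sumr (Z^~ w) (leq0n n.+1)) mulr_sumr -big_split/= -big_split/=.
  rewrite [X in X <= _]big_nat [X in _ <= X]big_nat; apply: ler_sum => k /andP[_ kn].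
  rewrite (le_trans (one_step w kn))// grw -addrA lerD2l /Y /W !addrA !lerD2r.
  rewrite -lerBlDl; set rr := r _; set q := g _ - Q g _.
  rewrite (_ : _ - _ = kap * (- b k w * rr)); last by ring.
  rewrite ler_wpM2l// (le_trans (ler_norm _))// normrM normrN ler_piMl//.
  exact: b1.
have d2 : E0_dom P F (fun w => \sum_(0 <= k < n.+1) X k w +
    (kap * \sum_(0 <= k < n.+1) Y k w + \sum_(0 <= k < n.+1) W k w))
   (fun w => \sum_(0 <= k < n.+1) 0 + (kap * \sum_(0 <= k < n.+1) Y' k w + \sum_(0 <= k < n.+1) W k w)).
  apply: (E0_domD ef); first by apply: (@E0_dom_sum _ _ _ _ _ _ ef n.+1 X (fun _ _ => 0)) => k _; exact: X_dom.
  apply: (E0_domD ef); last exact: E0_dom_refl.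
  by apply: (E0_domZ ef) => //; apply: (E0_dom_sum ef) => k _; exact: coboundary_dom.
have d3 : E0_dom P F (fun w => \sum_(0 <= k < n.+1) 0 +
    (kap * \sum_(0 <= k < n.+1) Y' k w + \sum_(0 <= k < n.+1) W k w))
   (fun w => S3 w + \sum_(0 <= k < n.+1) W k w).
  apply: (E0_dom_ae ef).
  - apply: intgD; first by apply: intg_sum => k; exact: intg_cst.
    by apply: intgD => //; apply: intgZ; exact: intg_sum.
  - exact: intgD.
  apply: aeW => w; rewrite big1// add0r lerD2r ler_wpM2l//.
  rewrite (le_trans (abel_bound (fun k => g (iter k T w)) (fun k kn => b1 w kn)))// lerD2l.
  rewrite [X in X <= _]big_nat [X in _ <= X]big_nat; apply: ler_sum => k /andP[_ kn].
  by rewrite ler_wpM2r// b_step.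
have d4 : E0_dom P F (fun w => S3 w + \sum_(0 <= k < n.+1) W k w)
    (fun w => S4 w + \sum_(0 <= k < n.+1) W k w).
  apply: (E0_domD ef); last exact: E0_dom_refl.
  apply: (E0_domZ ef) => //; apply: (E0_domD ef); last first.
    by apply: (E0_dom_sum ef) => k _; exact: osc_dom.
  by apply: E0_dom_refl; apply: intgD; exact: (it _ iag).
have -> : (fun w => clt_error (fun k => absg (iter k T w)) (fun k => boundary_fun (iter k T w))
     (fun k => `|r (iter k T w)|) (fun k => lindeberg_fun (iter k T w))) =
   (fun w => S4 w + \sum_(0 <= k < n.+1) W k w).
  apply/funext => w; rewrite /clt_error /S4 /W !big_split/= sumr_const_nat subn0.
  by rewrite -!mulr_sumr -(mulr_natl ((c / n.+1%:R) ^+ 2) n.+1); ring.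
exact: E0_dom_trans (E0_dom_trans d1 d2) (E0_dom_trans d3 d4).
Qed.

End one_step.
End martingale_clt.

(** * Shifted Cesaro limits *)

Section clt_error_limit.
Context {R : realType}.
Implicit Types (v : nat -> R) (l : R).

Lemma eq_cvgn (u v : nat -> R) l : (forall n, u n = v n) -> u n @[n --> \oo] --> l ->
  v n @[n --> \oo] --> l.
Proof. by move=> /funext ->. Qed.

Lemma cvg_inv_sqrt : (Num.sqrt n.+1%:R)^-1 @[n --> \oo] --> (0 : R).
Proof.
suff : Num.sqrt (harmonic n) @[n --> \oo] --> Num.sqrt (0 : R).
  by rewrite sqrtr0; under eq_fun do rewrite /= sqrtrV//.
by apply: continuous_cvg; [exact: sqrt_continuous|exact: cvg_harmonic].
Qed.

Lemma cesaro_last_shift v l j : (\sum_(0 <= k < n) v k) / n%:R @[n --> \oo] --> l ->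
  v (n + j)%N / n.+1%:R @[n --> \oo] --> 0.
Proof.
move=> /cesaro_last hv.
have h1 : v (n + j)%N / (n + j).+1%:R @[n --> \oo] --> 0.
  by move: hv; rewrite -(cvg_shiftn j (fun n => _ / _ : R)).
have h2 : 1 + j%:R * n.+1%:R^-1 @[n --> \oo] --> 1 + j%:R * (0 : R).
  have i0 : n.+1%:R^-1 @[n --> \oo] --> (0 : R) by exact: cvg_harmonic.
  by apply: cvgD; [exact: cvg_cst|apply: cvgM => //; exact: cvg_cst].
have h3 : v (n + j)%N / (n + j).+1%:R * (1 + j%:R * n.+1%:R^-1) @[n --> \oo] --> 0.
  by rewrite -[X in _ --> X](mul0r (1 + j%:R * 0)); exact: cvgM.
move: h3; apply: cvg_trans; apply: near_eq_cvg; apply: nearW => n.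
have n1 : n.+1%:R != 0 :> R by [].
have n2 : n.+1%:R + j%:R != 0 :> R by rewrite -natrD.
rewrite /= -addSn natrD; move: (n.+1%:R) n1 n2 => x n1 n2.
by field; rewrite n1 n2.
Qed.

Lemma cesaro_shift' v l : (\sum_(0 <= k < n) v k) / n%:R @[n --> \oo] --> l ->
  (\sum_(0 <= k < n) v k.+1) / n.+1%:R @[n --> \oo] --> l.
Proof.
move=> hv; rewrite -[l]subr0.
apply: (eq_cvgn _ (cvgB (cesaro_shift hv) (cesaro_last_shift 1 hv))) => n /=.
by rewrite opprfctE /= big_nat_recr//= addn1 mulrDl addrK.
Qed.

End clt_error_limit.

(** * The quenched central limit theorem for stationary martingale differences *)

Section martingale_cvg.
Context d (Om : measurableType d) (R : realType) (P : probability Om R).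
Variables (T : Om -> Om) (F : int -> set (set Om)).
Hypothesis ef : ergodic_filtration P T F.
Implicit Types (f g h : Om -> R).
Local Notation intg f := (P.-integrable setT (EFin \o f)).
Local Notation Ex f := (Rintegral P setT f).
Local Notation E0 := (cond_exp P (F 0)).
Local Notation Q := (markov_op P T F).
Local Notation qs := (quenched_sum P T F).
Local Notation "f °^ k" := (fun w => f (iter k T w)) (at level 2, format "f °^ k").

Variable D : Om -> R.
Hypothesis mD : measurable_wrt (F 0) D.
Hypothesis iD2 : intg (fun w => D w ^+ 2).
Hypothesis Dc : is_cond_exp P (F (-1)) D (fun=> 0).

Let s2 := Ex (fun w => D w ^+ 2).
Let F_ i := @F_meas _ _ _ _ _ _ ef i.
Let mD0 : measurable_fun setT D. Proof. exact: (wrt_measurable (@F_ 0) mD). Qed.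

(** The end values of [G] vanish after division by [n+1]; for the last one this follows from Cesaro
    convergence of [G], whatever its limit. *)
Lemma clt_error_cvg t (G H S L : nat -> R) (lG lH lS lL : R) :
  (\sum_(0 <= k < n) G k) / n%:R @[n --> \oo] --> lG ->
  (\sum_(0 <= k < n) H k) / n%:R @[n --> \oo] --> lH ->
  (\sum_(0 <= k < n) S k) / n%:R @[n --> \oo] --> lS ->
  (\sum_(0 <= k < n) L k) / n%:R @[n --> \oo] --> lL ->
  clt_error P D t n G H S L @[n --> \oo] --> t ^+ 2 / 2 * (lH + lS) + 2 * t ^+ 2 * lL.
Proof.
move=> hG hH hS hL; pose c := s2 * t ^+ 2 / 2.
have i0 : n.+1%:R^-1 @[n --> \oo] --> (0 : R) by exact: cvg_harmonic.
have h1 := cvgM (cvg_cst (G 1%N)) i0.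
have h2 := cesaro_last_shift 2 hG.
have h3 := cesaro_shift' hH; have h4 := cesaro_shift hS; have h5 := cesaro_shift hL.
rewrite (_ : t ^+ 2 / 2 * (lH + lS) + _ =
  t ^+ 2 / 2 * (G 1%N * 0 + 0 + lH + lS) + 2 * t ^+ 2 * lL + c ^+ 2 * 0); last by ring.
have h6 : t ^+ 2 / 2 * (G 1%N * n.+1%:R^-1 + G (n + 2)%N / n.+1%:R +
     (\sum_(0 <= k < n) H k.+1) / n.+1%:R + (\sum_(0 <= k < n.+1) S k.+1) / n.+1%:R) +
    2 * t ^+ 2 * ((\sum_(0 <= k < n.+1) L k.+1) / n.+1%:R) + c ^+ 2 * n.+1%:R^-1
    @[n --> \oo] --> t ^+ 2 / 2 * (G 1%N * 0 + 0 + lH + lS) + 2 * t ^+ 2 * lL + c ^+ 2 * 0.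
  apply: cvgD; last by apply: cvgM => //; exact: cvg_cst.
  apply: cvgD; apply: cvgM => //; try exact: cvg_cst.
  by apply: cvgD => //; apply: cvgD => //; apply: cvgD => //; apply: cvgM => //; exact: cvg_cst.
apply: (eq_cvgn _ h6) => n.
rewrite /clt_error addn2 -/s2 -/c.
move: (\sum_(0 <= k < n) H _) (\sum_(0 <= k < n.+1) S _) (\sum_(0 <= k < n.+1) L _) => x y z.
by field.
Qed.

Lemma is_cond_exp_clt_error t n (g h s l : Om -> R) :
  intg g -> intg h -> intg s -> intg l ->
  let e k (f : Om -> R) := E0 f°^k in
  is_cond_exp P (F 0)
    (fun w => clt_error P D t n (fun k => g (iter k T w)) (fun k => h (iter k T w))
       (fun k => s (iter k T w)) (fun k => l (iter k T w)))
    (fun w => clt_error P D t n (fun k => e k g w) (fun k => e k h w)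
       (fun k => e k s w) (fun k => e k l w)).
Proof.
move=> ig ih is_ il e.
have it k f : intg f -> intg f°^k by exact: (intg_iter ef).
have ec k f : intg f -> is_cond_exp P (F 0) f°^k (e k f) by move=> if_; exact: (E0P ef (it k f if_)).
have cc (x : R) : is_cond_exp P (F 0) (fun=> x) (fun=> x).
  by apply: is_cond_exp_id; [exact: measurable_cst|exact: intg_cst].
have isum m f : intg f -> intg (fun w => \sum_(0 <= k < m) f (iter k.+1 T w)).
  by move=> if_; apply: intg_sum => k; exact: it.
have esum m f : intg f -> is_cond_exp P (F 0) (fun w => \sum_(0 <= k < m) f (iter k.+1 T w))
    (fun w => \sum_(0 <= k < m) e k.+1 f w).
  by move=> if_; apply: (is_cond_exp_sum (@F_ 0)) => k; [exact: (it k.+1)|exact: ec].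
have i1 : intg (fun w => g (iter 1 T w) + g (iter n.+2 T w)) by apply: intgD; exact: it.
have i2 := intgD i1 (isum n _ ih); have i3 := intgD i2 (isum n.+1 _ is_).
have ceD := @is_cond_expD _ _ _ P _ (@F_ 0); have ceZ := @is_cond_expZ _ _ _ P _ (@F_ 0).
apply: (ceD); [|exact: intg_cst| |exact: cc].
  by apply: intgD; apply: intgZ => //; exact: isum.
apply: (ceD); [exact: intgZ|by apply: intgZ; exact: isum| |].
  apply: (ceZ) => //; apply: (ceD) => //; [exact: isum| |exact: esum].
  apply: (ceD) => //; [exact: isum| |exact: esum].
  by apply: (ceD); [exact: (it 1%N)|exact: (it n.+2)|exact: ec|exact: ec].
by apply: (ceZ); [exact: isum|exact: esum].
Qed.

Let cosM t th n w := cos (t * martingale T D n w / Num.sqrt n%:R + th).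

Lemma cosM_int t th n : intg (cosM t th n).
Proof.
apply: intg_le (intg_cst P 1) _; last by move=> w; rewrite ler_norml cos_geN1 cos_le1.
apply: measurableT_comp; first by apply: continuous_measurable_fun => x; exact: continuous_cos.
apply: measurable_funD; last exact: measurable_cst.
apply: measurable_funM; last exact: measurable_cst.
apply: measurable_funM; first exact: measurable_cst.
exact: (wrt_measurable (@F_ n%:Z) (@martingale_wrt _ _ _ _ _ _ ef D mD n)).
Qed.

Let minr_ge0_lim (v : nat -> R) (y : R) : 0 <= y -> (forall n, 0 <= v n) -> v n @[n --> \oo] --> 0 ->
  Num.min y (v n) @[n --> \oo] --> 0.
Proof.
move=> y0 v0 hv; apply: (@squeeze_cvgr _ _ _ _ (fun=> 0) v) => //; last exact: cvg_cst.
by apply: nearW => n; rewrite le_min y0 v0 ge_min lexx orbT.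
Qed.

(** The order of choices matters: first [r] small in L1, then a level [j+1] making the means of the
    Lindeberg and boundary functions small, and only then [n] large, when ergodic averages are close
    to these means. *)
Lemma quenched_upper t th e : 0 < e -> {ae P, forall w, exists N : nat, forall n, (N <= n)%N ->
  E0 (cosM t th n.+1) w <= expR (- (s2 * t ^+ 2 / 2)) * cos th + e}.
Proof.
move=> e0; set c := s2 * t ^+ 2 / 2; pose K : R := t ^+ 2 / 2.
have K0 : 0 <= K by rewrite divr_ge0// sqr_ge0.
have K1 : 0 < K + 1 by rewrite ltr_wpDl.
(* [K] is [kap * (n+1)], the weight of the mean of [|r|] in the limiting error; dividing by [K + 1]
   stays meaningful at [t = 0]. *)
have [|g [r [mg ig mr ir [gr rle]]]] := @coboundary _ _ _ _ _ _ ef (fun w => D w ^+ 2)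
    (e / 4 / (K + 1)) _ (measurable_funX 2 mD) iD2 (fun w => sqr_ge0 _).
  by rewrite !divr_gt0.
have {}rle : K * Ex (fun w => `|r w|) <= e / 4.
  have r0 : 0 <= Ex (fun w => `|r w|) by apply: Rintegral_ge0.
  by move: rle; rewrite ler_pdivlMr// => h; lra.
pose lind j := lindeberg_fun D t j.+1.
pose bnd j := boundary_fun P T F D t j.+1 g.
have il j : intg (lind j) by exact: (lindeberg_fun_int ef mD iD2).
have ib j : intg (bnd j) by exact: (boundary_fun_int ef mD _ _ ig).
have iQg := intg_abs (markov_op_int ef (intg_abs ig)).
have lim_sqrt x : `|t| * `|x| / Num.sqrt j.+1%:R @[j --> \oo] --> 0.
  rewrite -[X in _ --> X](mulr0 (`|t| * `|x|)); apply: cvgM; first exact: cvg_cst.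
  exact: cvg_inv_sqrt.
have sq_ge0 x j : 0 <= `|t| * `|x| / Num.sqrt j.+1%:R by rewrite divr_ge0// mulr_ge0.
have lcv : Ex (lind j) @[j --> \oo] --> 0.
  have := @Ex_dct _ _ _ P lind (fun=> 0) (fun w => D w ^+ 2).
  rewrite Ex_cst => /(_ _ _ iD2 _ _)[||||//].
  - by move=> j; exact: intg_meas (il j).
  - exact: measurable_cst.
  - apply: aeW => w; rewrite -[X in _ --> X](mulr0 (D w ^+ 2)); apply: cvgM; first exact: cvg_cst.
    exact: minr_ge0_lim.
  - move=> j; apply: aeW => w; rewrite ger0_norm ?lindeberg_fun_ge0//.
    by rewrite /lind /lindeberg_fun ler_piMr ?sqr_ge0// ge_min lexx.
have bcv : Ex (bnd j) @[j --> \oo] --> 0.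
  have := @Ex_dct _ _ _ P bnd (fun=> 0) (fun w => 2 * `|Q (fun w => `|g w|) w|).
  rewrite Ex_cst => /(_ _ _ (intgZ 2 iQg) _ _)[||||//].
  - by move=> j; exact: intg_meas (ib j).
  - exact: measurable_cst.
  - apply: aeW => w; rewrite -[X in _ --> X](mul0r `|Q (fun w => `|g w|) w|).
    apply: cvgM; last exact: cvg_cst.
    apply: minr_ge0_lim => //.
      by move=> j; rewrite addr_ge0// divr_ge0// ?divr_ge0// mulr_ge0 ?sqr_ge0//; apply: Rintegral_ge0 => x _; exact: sqr_ge0.
    rewrite -[X in _ --> X](addr0 0); apply: cvgD => //.
    rewrite -[X in _ --> X](mulr0 (Ex (fun w => D w ^+ 2) * t ^+ 2 / 2)).
    have i0 : n.+1%:R^-1 @[n --> \oo] --> (0 : R) by exact: cvg_harmonic.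
    by apply: cvgM => //; exact: cvg_cst.
  - move=> j; apply: aeW => w; rewrite /bnd /boundary_fun normrM normr_id ler_wpM2r//.
    exact: oscillation_fun_le.
have [j hj] : exists j, K * Ex (bnd j) + 2 * t ^+ 2 * Ex (lind j) <= e / 4.
  have : K * Ex (bnd j) + 2 * t ^+ 2 * Ex (lind j) @[j --> \oo] --> K * 0 + 2 * t ^+ 2 * 0.
    by apply: cvgD; apply: cvgM => //; exact: cvg_cst.
  rewrite !mulr0 addr0 => /cvgrPdist_le /(_ (e / 4)); rewrite divr_gt0// => /(_ isT)[j _ /(_ j (leqnn j))].
  by rewrite /= sub0r normrN => /(le_trans (ler_norm _)); exists j.
have iabs := intg_abs ig; have irabs := intg_abs ir.
pose err n w := clt_error P D t n (fun k => E0 (fun w => `|g (iter k T w)|) w) (fun k => E0 (bnd j)°^k w)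
  (fun k => E0 (fun w => `|r (iter k T w)|) w) (fun k => E0 (lind j)°^k w).
have dom n : (j <= n)%N -> {ae P, forall w,
    E0 (cosM t th n.+1) w - expR (- c) * cos th <= err n w}.
  move=> jn.
  have hd := @clt_error_dom _ _ _ _ _ _ ef D mD iD2 Dc t th n j.+1 isT jn g r mg ig ir gr.
  have [if1 if2 _] := hd.
  have h1 := E0_dom_le ef hd.
  have h2 := E0_unique ef if2 (is_cond_exp_clt_error t n iabs (ib j) irabs (il j)).
  have cc : is_cond_exp P (F 0) (fun=> expR (- c) * cos th) (fun=> expR (- c) * cos th).
    by apply: is_cond_exp_id; [exact: measurable_cst|exact: intg_cst].
  have h3 := E0_unique ef if1 _.
  have {}h3 := h3 (fun w => E0 (cosM t th n.+1) w - expR (- c) * cos th) _.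
  have {h3} := h3 _; set A := (X in is_cond_exp _ _ X).
  have -> : A = (fun w => cosM t th n.+1 w - expR (- c) * cos th).
    (* The damping is one at step [n+1], while at step zero the martingale vanishes and the damping
       is [exp (- c)]. *)
    apply/funext => w; rewrite /A /clt_damp /clt_arg /= divff// subrr mulr0 oppr0 expR0 mul1r.
    by rewrite mul0r subr0 mulr1 martingale0 mulr0 mul0r add0r.
  move=> /(_ (is_cond_expB (@F_ 0) (cosM_int t th n.+1) (intg_cst P _) (E0P ef (cosM_int t th n.+1)) cc)) h3.
  by apply: filterS3 h1 h2 h3 => w k1 k2 k3; rewrite -k3 (le_trans k1)// k2.
have domj : {ae P, forall w, forall n, E0 (cosM t th (j + n).+1) w - expR (- c) * cos th <= err (j + n)%N w}.
  by apply: ae_foralln => n; apply: dom; exact: leq_addr.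
have mabs h : measurable_wrt (F 0) h -> measurable_wrt (F 0) (fun w => `|h w|).
  by apply: wrt_comp; exact: normr_measurable.
have mb : measurable_wrt (F 0) (bnd j).
  apply: measurable_funM; first exact: oscillation_fun_wrt.
  exact: (mabs _ (E0_wrt ef (intg_mp (ef_mp ef) iabs))).
have q1 := quenched_ergodic ef (mabs _ mg) iabs.
have q2 := quenched_ergodic ef mb (ib j).
have q3 := quenched_ergodic ef (mabs _ mr) irabs.
have q4 := quenched_ergodic ef (lindeberg_fun_wrt mD t j.+1) (il j).
apply: filterS2 (filterI domj q1) (filterI (filterI q2 q3) q4) => w [dj l1] [[l2 l3] l4].
have /cvgrPdist_le /(_ (e / 4)) := clt_error_cvg (t := t) l1 l2 l3 l4.
rewrite divr_gt0// => /(_ isT)[N _ HN]; exists (maxn N j) => n; rewrite geq_max => /andP[Nn jn].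
have := dj (n - j)%N; rewrite subnKC// => hd.
have := HN _ Nn; rewrite -/(err n w) distrC => /(le_trans (ler_norm _)) he.
rewrite -/K -/(lind j) in he.
by lra.
Qed.

(** The upper bound is enough: adding [pi] to the phase changes the sign of the cosine and yields
    the lower bound. *)
Theorem quenched_martingale_clt t th : {ae P, forall w,
  E0 (cosM t th n) w @[n --> \oo] --> expR (- (s2 * t ^+ 2 / 2)) * cos th}.
Proof.
have H th' : {ae P, forall w, forall j : nat, exists N : nat, forall n, (N <= n)%N ->
    E0 (cosM t th' n.+1) w <= expR (- (s2 * t ^+ 2 / 2)) * cos th' + j.+1%:R^-1}.
  by apply: ae_foralln => j; apply: quenched_upper; rewrite invr_gt0.
have opp : {ae P, forall w, forall n, E0 (cosM t (th + pi) n) w = - E0 (cosM t th n) w}.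
  apply: ae_foralln => n.
  have : {ae P, forall w, E0 (cosM t (th + pi) n) w = -1 * E0 (cosM t th n) w}.
    apply: (E0_unique ef); first exact: cosM_int.
    rewrite (_ : cosM t (th + pi) n = fun w => -1 * cosM t th n w).
      by apply: (is_cond_expZ (@F_ 0)); [exact: cosM_int|exact: (E0P ef (cosM_int _ _ _))].
    by apply/funext => w; rewrite /cosM addrA cosDpi mulN1r.
  by apply: filterS => w ->; rewrite mulN1r.
apply: filterS3 (H th) (H (th + pi)) opp => w h1 h2 hopp.
rewrite -(cvg_shiftS (fun n => E0 (cosM t th n) w)).
apply/cvgrPdist_le => e e0.
have [j HNj] := natr_ge e^-1.
have je : j.+1%:R^-1 <= e.
  by rewrite -[X in _ <= X]invrK lef_pV2 ?posrE ?invr_gt0//; apply: HNj.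
have [N1 HN1] := h1 j; have [N2 HN2] := h2 j.
exists (maxn N1 N2) => // n /=; rewrite geq_max => /andP[n1 n2].
have := HN1 _ n1; have := HN2 _ n2; rewrite hopp cosDpi mulrN => k1 k2.
rewrite /= ler_norml; move: k1 k2; set X := expR _ * cos th; set Y := E0 _ w; set jj := j.+1%:R^-1 in je *.
by move=> k1 k2; apply/andP; split; lra.
Qed.

End martingale_cvg.

(** * Martingale approximation: second moments and the series defining [D] *)

Lemma cauchy_schwarz_weighted (R : realType) (s : seq nat) (y c : nat -> R) :
  (forall j, 0 < c j) ->
  (\sum_(j <- s) y j) ^+ 2 <= (\sum_(j <- s) c j) * (\sum_(j <- s) y j ^+ 2 / c j).
Proof.
move=> c0; elim: s => [|j s IH]; first by rewrite !big_nil mul0r expr0n.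
rewrite !big_cons.
have C0 : 0 <= \sum_(i <- s) c i by apply: sumr_ge0 => i _; exact: ltW.
move: IH C0; set S := \sum_(i <- s) y i; set C := \sum_(i <- s) c i.
set B := \sum_(i <- s) _ => IH C0; have cj := c0 j.
move: C0; rewrite le_eqVlt => /predU1P[C0|C0].
  have S0 : S = 0.
    by apply/eqP; rewrite -sqrf_eq0 eq_le sqr_ge0 andbT (le_trans IH)// -C0 mul0r.
  rewrite S0 -C0 !addr0 mulrDr mulrCA divff ?gt_eqF// mulr1 lerDl mulr_ge0 ?(ltW cj)//.
  by apply: sumr_ge0 => i _; rewrite divr_ge0 ?sqr_ge0// ltW.
have h1 : 0 <= (C * y j - c j * S) ^+ 2 / (c j * C) by rewrite divr_ge0 ?sqr_ge0// mulr_ge0 ?(ltW cj) ?(ltW C0).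
have h2 : (C * y j - c j * S) ^+ 2 / (c j * C) = C * (y j ^+ 2 / c j) + c j * (S ^+ 2 / C) - 2 * y j * S.
  by field; rewrite !gt_eqF.
have h3 : c j * (S ^+ 2 / C) <= c j * B by rewrite ler_wpM2l ?(ltW cj)// ler_pdivrMr// mulrC.
have h4 : c j * (y j ^+ 2 / c j) = y j ^+ 2 by rewrite mulrCA divff ?gt_eqF// mulr1.
by rewrite mulrDl !mulrDr h4 sqrrD; lra.
Qed.

Section second_moment.
Context d (Om : measurableType d) (R : realType) (P : probability Om R).
Variables (T : Om -> Om) (F : int -> set (set Om)).
Hypothesis ef : ergodic_filtration P T F.
Local Notation intg f := (P.-integrable setT (EFin \o f)).
Local Notation Ex f := (Rintegral P setT f).
Let F_ i := @F_meas _ _ _ _ _ _ ef i.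

Variable rho : nat -> Om -> R.
Hypothesis mrho : forall k, measurable_wrt (F 0) (rho k).
Hypothesis irho : forall k, intg (fun w => rho k w ^+ 2).
Hypothesis crho : forall k, is_cond_exp P (F (-1)) (rho k) (fun=> 0).

Let S n w : R := \sum_(0 <= k < n) rho k (iter k.+1 T w).

Let m0 k : measurable_fun setT (rho k).
Proof. exact: (wrt_measurable (@F_ 0) (mrho k)). Qed.

Let i1 k : intg (rho k). Proof. exact: intg_sqr (m0 k) (irho k). Qed.

Lemma second_moment_wrt n : measurable_wrt (F n%:Z) (S n).
Proof.
elim: n => [|n IH].
  by rewrite (_ : S 0 = fun=> 0); [exact: measurable_cst|apply/funext => w; rewrite /S big_nil].
rewrite (_ : S n.+1 = fun w => S n w + rho n (iter n.+1 T w)); last first.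
  by apply/funext => w; rewrite /S big_nat_recr.
apply: measurable_funD; last exact: (wrt_iterF ef).
by apply: (wrt_mono ef) IH; rewrite lez_nat.
Qed.

(** The cross terms vanish because [rho n o T^(n+1)] has conditional mean zero given [F n]. The
    summand [rho k] may depend on [k], as it does in the remainder [R_n]. *)
Lemma second_moment_dom n : E0_dom P F (fun w => S n w ^+ 2)
  (fun w => \sum_(0 <= k < n) rho k (iter k.+1 T w) ^+ 2).
Proof.
elim: n => [|n IH].
  rewrite (_ : (fun w => S 0 w ^+ 2) = (fun w => \sum_(0 <= k < 0) rho k (iter k.+1 T w) ^+ 2)).
    by apply: E0_dom_refl; apply: intg_sum => k; exact: (intg_iter ef k.+1 (irho k)).
  by apply/funext => w; rewrite /S !big_nil expr0n.
pose x w := rho n (iter n.+1 T w).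
have mx : measurable_fun setT x.
  by apply: (measurable_comp_mp (iter_mp (ef_mp ef) n.+1)).
have ix2 : intg (fun w => x w ^+ 2) by exact: (intg_iter ef n.+1 (irho n)).
have mS := wrt_measurable (@F_ _) (@second_moment_wrt n).
have iS2 : intg (fun w => S n w ^+ 2) by case: IH.
have iSx := intgM mS mx iS2 ix2.
rewrite (_ : (fun w => S n.+1 w ^+ 2) = fun w => (S n w ^+ 2 + 2 * (S n w * x w)) + x w ^+ 2); last first.
  by apply/funext => w; rewrite /S big_nat_recr//= -/(S n w) /x sqrrD mulr_natl.
rewrite (_ : (fun w => \sum_(0 <= k < n.+1) _) = (fun w =>
    (\sum_(0 <= k < n) rho k (iter k.+1 T w) ^+ 2 + 2 * (S n w * 0)) + x w ^+ 2)); last first.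
  by apply/funext => w; rewrite big_nat_recr//= mulr0 mulr0 addr0.
apply: (E0_domD ef); last exact: E0_dom_refl.
apply: (E0_domD ef) => //; apply: (E0_domZ ef) => //.
have cx : is_cond_exp P (F n%:Z) x (fun=> 0).
  have := is_cond_exp_iter ef n.+1 (i1 n) (crho n).
  by rewrite intS addrA addNr add0r.
have iS0 : intg (fun w => S n w * 0) by under eq_fun do rewrite mulr0; exact: intg_cst.
exact: (proj1 (E0_dom_pull ef (intg_iter ef n.+1 (i1 n)) cx (@second_moment_wrt n) iSx iS0)).
Qed.

End second_moment.

Section weighted_series.
Context d (Om : measurableType d) (R : realType) (P : probability Om R).
Variables (T : Om -> Om) (F : int -> set (set Om)).
Hypothesis ef : ergodic_filtration P T F.
Local Notation intg f := (P.-integrable setT (EFin \o f)).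
Local Notation Ex f := (Rintegral P setT f).
Let F_ i := @F_meas _ _ _ _ _ _ ef i.

Variables (Y : nat -> Om -> R) (a : nat -> R) (A : R).
Hypothesis mY : forall j, measurable_wrt (F 0) (Y j).
Hypothesis iY2 : forall j, intg (fun w => Y j w ^+ 2).
Hypothesis cY : forall j, is_cond_exp P (F (-1)) (Y j) (fun=> 0).
Hypothesis a0 : forall j, 0 <= a j.
Hypothesis Ya : forall j, Ex (fun w => Y j w ^+ 2) <= a j ^+ 2.
Hypothesis aA : forall n, \sum_(0 <= j < n) a j <= A.

(** Weights as large as the bounds on the L2 norms, still summable, and positive even where
    [a j = 0], so that [q j] may divide by them. *)
Let c j : R := a j + 2^-1 ^+ j.+1.
Let c0 j : 0 < c j. Proof. by rewrite ltr_wpDl// exprn_gt0// invr_gt0. Qed.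
Let sC n : R := \sum_(0 <= j < n) c j.

Let sC_le n : sC n <= A + 1.
Proof.
rewrite /sC big_split/= lerD// -[X in _ <= X](@subrK _ (2^-1 ^+ n)) -lerBlDr.
suff -> : \sum_(0 <= i < n) 2^-1 ^+ i.+1 = 1 - 2^-1 ^+ n :> R by rewrite lerBlDr lerDl exprn_ge0// invr_ge0.
elim: n => [|n IH]; first by rewrite big_nil expr0 subrr.
by rewrite big_nat_recr//= IH exprS; field.
Qed.

Let sC_nd n m : (n <= m)%N -> sC n <= sC m.
Proof.
move/subnKC => <-; rewrite /sC [X in _ <= X](big_cat_nat _ (n := n))//= ?leq_addr// lerDl.
by apply: sumr_ge0 => j _; exact: ltW.
Qed.

Let sC_cvg : cvgn sC.
Proof.
apply: nondecreasing_is_cvgn; first by move=> n m; exact: sC_nd.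
by exists (A + 1) => _ [n _ <-]; exact: sC_le.
Qed.

Let C : R := limn sC.
Let sC_leC n : sC n <= C.
Proof. by apply: nondecreasing_cvgn_le => //; move=> i j; exact: sC_nd. Qed.

Let wt m : R := C - sC m.
Let wt0 m : 0 <= wt m. Proof. by rewrite subr_ge0. Qed.
Let wt_cvg : wt m @[m --> \oo] --> 0.
Proof. by rewrite -[X in _ --> X](subrr C); apply: cvgB => //; exact: cvg_cst. Qed.

Let q j w : R := Y j w ^+ 2 / c j.
Let q0 j w : 0 <= q j w. Proof. by rewrite divr_ge0 ?sqr_ge0// ltW. Qed.
Let mq j : measurable_wrt (F 0) (q j).
Proof. by apply: measurable_funM; [exact: (measurable_funX 2 (@mY j))|exact: measurable_cst]. Qed.
Let iq j : intg (q j).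
Proof.
rewrite (_ : q j = fun w => (c j)^-1 * Y j w ^+ 2); first exact: (intgZ _ (iY2 j)).
by apply/funext => w; rewrite mulrC.
Qed.

Let eH w := (\sum_(0 <= j <oo) (q j w)%:E)%E.

Let meH : @measurable_fun _ _ (g_sigma_algebraType (F 0)) _ setT eH.
Proof.
apply: ge0_emeasurable_sum => [k x _ _|k _]; first by rewrite lee_fin.
by apply/measurable_EFinP; exact: mq.
Qed.

Let meH0 : measurable_fun [set: Om] eH.
Proof. by move=> _ B mB; apply: (sub_measurable (@F_ 0)); exact: meH. Qed.

Let eH0 w : (0 <= eH w)%E.
Proof. by apply: nneseries_ge0 => n _ _; rewrite lee_fin. Qed.

(** The mean of [q j] is at most [a j ^ 2 / c j], hence at most [a j]. *)
Let eH_int : (\int[P]_w eH w <= A%:E)%E.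
Proof.
rewrite integral_nneseries//; last by move=> n x _; rewrite lee_fin.
  apply: lime_le.
    by apply: is_cvg_nneseries => n _ _; apply: integral_ge0 => w _; rewrite lee_fin.
  apply: nearW => n; apply: le_trans (_ : (\sum_(0 <= j < n) (a j)%:E <= _)%E); last first.
    by rewrite sumEFin lee_fin.
  apply: lee_sum => j _.
  have -> : (\int[P]_w (q j w)%:E)%E = (Ex (q j))%:E by rewrite fineK//; exact: integrable_fin_num (iq j).
  rewrite lee_fin /q; under eq_Rintegral do rewrite mulrC.
  rewrite ExZ// mulrC ler_pdivrMr// (le_trans (Ya j))// expr2 ler_wpM2l// lerDl.
  by rewrite exprn_ge0// invr_ge0.
by move=> n; apply/measurable_EFinP; exact: intg_meas (iq n).
Qed.

Let good := [set w | (eH w < +oo)%E].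

Let mgood : (F 0).-sigma.-measurable good.
Proof.
rewrite -[good]setTI; apply: (@measurable_lte _ (g_sigma_algebraType (F 0))) => //.
Qed.

Let ieH : P.-integrable setT eH.
Proof.
apply/integrableP; split => //; under eq_integral do rewrite gee0_abs//.
by rewrite (le_lt_trans eH_int)// ltry.
Qed.

Let ae_good : {ae P, forall w, good w}.
Proof.
have := integrable_ae measurableT ieH; apply: filterS => w /(_ I).
by rewrite /good/= ge0_fin_numE.
Qed.

Let H w : R := fine (eH w).

Let mH : measurable_wrt (F 0) H.
Proof. exact: (@measurableT_comp _ _ _ _ _ _ fine _ (eH : g_sigma_algebraType (F 0) -> _)). Qed.

Let H0 w : 0 <= H w. Proof. exact: fine_ge0. Qed.

Let iH : intg H.
Proof.
apply: le_integrable ieH => //.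
  by apply/measurable_EFinP; exact: (wrt_measurable (@F_ 0) mH).
move=> w _; rewrite (gee0_abs (eH0 w)) /= ger0_norm; last exact: H0.
by rewrite /H; case: (eH w) (eH0 w) => [r||]//= _; rewrite leey.
Qed.

Let h_le n w : good w -> \sum_(0 <= j < n) q j w <= H w.
Proof.
move=> gw; rewrite -lee_fin /H fineK ?ge0_fin_numE// -sumEFin.
by apply: nneseries_lim_ge => // k _ _; rewrite lee_fin.
Qed.

Let S n w : R := \sum_(0 <= j < n) Y j w.

Let SB m n w : (m <= n)%N -> good w -> (S n w - S m w) ^+ 2 <= wt m * H w.
Proof.
move=> mn gw; rewrite /S (big_cat_nat _ (n := m))//= addrAC subrr add0r.
apply: (le_trans (cauchy_schwarz_weighted _ _ c0)).
apply: ler_pM.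
- by apply: sumr_ge0 => j _; exact: ltW.
- by apply: sumr_ge0 => j _; exact: q0.
- by have := sC_leC n; rewrite /sC (big_cat_nat _ (n := m))//= -/(sC m) lerBrDl.
apply: le_trans (h_le n gw); rewrite [X in _ <= X](big_cat_nat _ (n := m))//= lerDr.
by apply: sumr_ge0 => j _; exact: q0.
Qed.

Let S_cvg w : good w -> cvgn (S^~ w).
Proof.
move=> gw; apply: normed_cvg => //=.
apply: nondecreasing_is_cvgn; first by apply: nondecreasing_series => *; exact: normr_ge0.
exists (C + H w) => _ [n _ <-].
apply: (@le_trans _ _ (\sum_(0 <= j < n) (c j + q j w))).
  rewrite /series/=; apply: ler_sum => j _; rewrite /q.
  have cj := c0 j; have : 0 <= (`|Y j w| - c j) ^+ 2 / c j by rewrite divr_ge0 ?sqr_ge0// ltW.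
  have -> : (`|Y j w| - c j) ^+ 2 / c j = `|Y j w| ^+ 2 / c j + c j - 2 * `|Y j w|.
    by field; rewrite gt_eqF.
  rewrite real_normK ?num_real// => h; have := normr_ge0 (Y j w); lra.
by rewrite big_split/= lerD// ?h_le//; exact: sC_leC.
Qed.

(** With [H = sum_j Y_j^2 / c_j] and [wt m] the tail of the weights, Cauchy-Schwarz bounds every
    tail of the series by [wt m * H] pointwise. A single integrable majorant for all tails is what
    allows [quenched_ergodic] to act on the remainder. *)
Lemma weighted_series : exists D H wt, [/\ measurable_wrt (F 0) D,
  intg (fun w => D w ^+ 2), is_cond_exp P (F (-1)) D (fun=> 0) &
  [/\ measurable_wrt (F 0) H, intg H, (forall w, 0 <= H w) /\ (forall m, 0 <= wt m),
    wt m @[m --> \oo] --> (0 : R) &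
   {ae P, forall w m, (D w - \sum_(0 <= j < m) Y j w) ^+ 2 <= wt m * H w}]].
Proof.
(* Cutting off at the [F 0]-measurable set [good] makes the limit exist everywhere, so that [D] is
   measurable for [F 0] itself and not merely up to null sets. *)
pose y n w := \1_good w * S n w; pose D w := limn (y^~ w).
have ycv w : y^~ w n @[n --> \oo] --> D w.
  suff : cvgn (y^~ w) by [].
  case: (pselect (good w)) => gw.
    have -> : y^~ w = S^~ w by apply/funext => n; rewrite /y indicE mem_set// mul1r.
    exact: S_cvg.
  have -> : y^~ w = fun=> 0 by apply/funext => n; rewrite /y indicE memNset// mul0r.
  exact: is_cvg_cst.
have mS n : measurable_wrt (F 0) (S n) by apply: measurable_sum => j; exact: mY.
have mD : measurable_wrt (F 0) D.
  apply: (@measurable_fun_cvg _ (g_sigma_algebraType (F 0)) _ _ y) => [n|w _]; last exact: ycv.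
  by apply: measurable_funM; [exact: (wrt_indic mgood)|exact: mS].
have mD0 := wrt_measurable (@F_ 0) mD.
have DS w : good w -> S n w @[n --> \oo] --> D w.
  move=> gw; have := ycv w.
  have -> // : y^~ w = S^~ w by apply/funext => n; rewrite /y indicE mem_set// mul1r.
have Dbd w m : good w -> (D w - S m w) ^+ 2 <= wt m * H w.
  move=> gw; have h : (S n w - S m w) ^+ 2 @[n --> \oo] --> (D w - S m w) ^+ 2.
    rewrite expr2; under eq_fun do rewrite expr2.
    by apply: cvgM; apply: cvgB; [exact: DS|exact: cvg_cst|exact: DS|exact: cvg_cst].
  rewrite -(cvg_lim (@Rhausdorff R) h); apply: limr_le; first exact: cvgP h.
  by exists m => // n /= mn; exact: SB.
have S0 w : S 0 w = 0 by rewrite /S big_nil.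
have iD2 : intg (fun w => D w ^+ 2).
  apply: (@intg_ae _ _ _ _ (fun w => \1_good w * D w ^+ 2)).
  - exact: measurable_funX.
  - apply: intg_le (intgZ (wt 0%N) iH) _.
      apply: measurable_funM; last exact: measurable_funX.
      by apply: measurable_indic; exact: (sub_measurable (@F_ 0)).
    move=> w; rewrite indicE ger0_norm; last by apply: mulr_ge0; rewrite ?sqr_ge0.
    case: (boolP (w \in good)) => [|_]; last by rewrite mul0r mulr_ge0.
    by rewrite inE => gw; rewrite mul1r -[D w]subr0 -(S0 w); exact: Dbd.
  - by apply: filterS ae_good => w gw; rewrite indicE mem_set// mul1r.
exists D, H, wt; split => //.
  have iD := intg_sqr mD0 iD2.
  have mF1 := @F_ (-1).
  have i1 j : intg (Y j) by apply: intg_sqr => //; exact: (wrt_measurable (@F_ 0)).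
  have iS n : intg (S n) by exact: intg_sum.
  apply: (is_cond_exp_indic mF1) => //; [exact: measurable_cst|exact: intg_cst|].
  move=> B mB; have mB0 := sub_measurable mF1 mB.
  have cS n : is_cond_exp P (F (-1)) (S n) (fun=> 0).
    have := is_cond_exp_sum mF1 (index_iota 0 n) i1 cY.
    by rewrite (_ : (fun w => \sum_(i <- _) 0) = fun=> 0)//; apply/funext => w; rewrite big1.
  have e n : Ex (fun w => \1_B w * S n w) = Ex (fun w => \1_B w * 0).
    by rewrite (cond_exp_indic mF1 (cS n)).
  (* The majorant comes from [|S n| <= 1 + S n ^ 2] and the tail bound at [m = 0]. *)
  have dom := proj2 (@Ex_dct _ _ _ P (fun n w => \1_B w * S n w) (fun w => \1_B w * D w)
      (fun w => 1 + wt 0%N * H w) _ _ _ _ _).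
  have : Ex (fun w => \1_B w * S n w) @[n --> \oo] --> Ex (fun w => \1_B w * D w).
    apply: dom.
    - by move=> n; exact: intg_meas (intg_indicM mB0 (iS n)).
    - exact: intg_meas (intg_indicM mB0 iD).
    - by apply: intgD; [exact: intg_cst|exact: intgZ].
    - apply: filterS ae_good => w gw; apply: cvgM; first exact: cvg_cst.
      exact: DS.
    - move=> n; apply: filterS ae_good => w gw.
      have h1 : (S n w) ^+ 2 <= wt 0%N * H w.
        by have := SB (leq0n n) gw; rewrite S0 subr0.
      have h2 : `|S n w| <= 1 + wt 0%N * H w.
        apply: le_trans (_ : 1 + S n w ^+ 2 <= _); last by rewrite lerD2l.
        rewrite ler_norml; have := sqr_ge0 (S n w + 1); have := sqr_ge0 (S n w - 1).
        have := sqr_ge0 (S n w).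
        by move=> *; apply/andP; split; lra.
      rewrite normrM (le_trans _ h2)// ler_piMl// indicE ger0_norm//.
      by case: (_ \in _).
  have e' : (fun n => Ex (fun w => \1_B w * S n w)) = fun=> Ex (fun w => \1_B w * 0).
    by apply/funext => n; exact: e.
  rewrite e' => h; exact: (cvg_unique (@Rhausdorff R) (cvg_cst _) h).
split => //; apply: filterS ae_good => w gw m; exact: Dbd.
Qed.

End weighted_series.

(** * Cesaro means with vanishing weights *)

Section weighted_cesaro.
Context {R : realType}.

(** The weight is small unless [k] is within a fixed distance [m] of the end. Those few last terms
    vanish one by one after division by [n+1], and the others are at most [dl] times a bounded
    Cesaro mean. *)
Lemma weighted_cesaro (v wt : nat -> R) (l : R) : (forall k, 0 <= v k) -> (forall m, 0 <= wt m) ->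
  (\sum_(0 <= k < n) v k) / n%:R @[n --> \oo] --> l -> wt m @[m --> \oo] --> 0 ->
  (\sum_(0 <= k < n.+1) wt (n.+1 - k)%N * v k.+1) / n.+1%:R @[n --> \oo] --> 0.
Proof.
move=> v0 wt0 hv hwt.
have last i : v (n.+1 - i)%N / n.+1%:R @[n --> \oo] --> 0.
  rewrite -(cvg_shiftn i (fun n => _ / _ : R)).
  apply: (@squeeze_cvgr _ _ _ _ (fun=> 0) (fun n => v (n + 1)%N / n.+1%:R)).
  - apply: nearW => n; rewrite divr_ge0//= -addSn addnK addn1 ler_wpM2l//.
    by rewrite lef_pV2 ?posrE ?ltr0n// ler_nat addSn ltnS leq_addr.
  - exact: cvg_cst.
  - exact: cesaro_last_shift hv.
have fin m : (\sum_(0 <= i < m) wt i.+1 * v (n.+1 - i)%N) / n.+1%:R @[n --> \oo] --> 0.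
  elim: m => [|m IH].
    by under eq_fun do rewrite big_nil mul0r; exact: cvg_cst.
  have h : (\sum_(0 <= i < m) wt i.+1 * v (n.+1 - i)%N) / n.+1%:R +
      wt m.+1 * (v (n.+1 - m)%N / n.+1%:R) @[n --> \oo] --> 0 + wt m.+1 * 0.
    by apply: cvgD => //; apply: cvgM => //; exact: cvg_cst.
  rewrite mulr0 addr0 in h; apply: (eq_cvgn _ h) => n.
  by rewrite big_nat_recr//= mulrDl mulrA.
have hs := cesaro_shift hv.
have l0 : 0 <= l.
  rewrite -(cvg_lim (@Rhausdorff R) hs); apply: limr_ge; first exact: cvgP hs.
  by apply: nearW => n; rewrite divr_ge0//; apply: sumr_ge0.
apply/cvgrPdist_le => e e0.
pose dl := e / (2 * (l + 1)); have dl0 : 0 < dl by rewrite divr_gt0// mulr_gt0// ltr_wpDl.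
have [m _ hm] : \forall m \near \oo, wt m <= dl.
  by move/cvgrPdist_le: hwt => /(_ _ dl0); apply: filterS => m; rewrite sub0r normrN => /(le_trans (ler_norm _)).
have e2 : 0 < e / 2 by rewrite divr_gt0.
have [N1 _ hN1] : \forall n \near \oo, (\sum_(0 <= i < m) wt i.+1 * v (n.+1 - i)%N) / n.+1%:R <= e / 2.
  by move/cvgrPdist_le: (fin m) => /(_ _ e2); apply: filterS => n; rewrite sub0r normrN => /(le_trans (ler_norm _)).
have [N2 _ hN2] : \forall n \near \oo, (\sum_(0 <= k < n.+1) v k.+1) / n.+1%:R <= l + 1.
  move/cvgrPdist_le: hs => /(_ 1 ltr01); apply: filterS => n.
  by rewrite distrC => /(le_trans (ler_norm _)); rewrite lerBlDr addrC.
exists (maxn m (maxn N1 N2)) => // n /=; rewrite !geq_max => /andP[mn /andP[n1 n2]].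
rewrite sub0r normrN ger0_norm; last first.
  by rewrite divr_ge0//; apply: sumr_ge0 => k _; rewrite mulr_ge0.
have rev (g : nat -> nat -> R) : \sum_(0 <= k < n.+1) g (n.+1 - k)%N k.+1 =
    \sum_(0 <= i < n.+1) g i.+1 (n.+1 - i)%N.
  rewrite big_nat_rev/= add0n [LHS]big_nat [RHS]big_nat; apply: eq_bigr => i /andP[_ ile].
  by rewrite subSS subnA ?subSn// ?subnn ?leqW// ?add1n// -?ltnS//; congr g; lia.
have -> : \sum_(0 <= k < n.+1) wt (n.+1 - k)%N * v k.+1 = \sum_(0 <= i < n.+1) wt i.+1 * v (n.+1 - i)%N.
  exact: (rev (fun a b => wt a * v b)).
rewrite (big_cat_nat _ (n := m))//=; last exact: leqW.
rewrite mulrDl (_ : e = e / 2 + e / 2); last by lra.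
apply: lerD; first exact: hN1.
apply: (@le_trans _ _ (dl * ((\sum_(0 <= k < n.+1) v k.+1) / n.+1%:R))); last first.
  apply: (@le_trans _ _ (dl * (l + 1))); first by rewrite ler_wpM2l ?(ltW dl0)//; exact: hN2.
  rewrite /dl invfM; suff -> : e * (2^-1 * (l + 1)^-1) * (l + 1) = e / 2 by [].
  by field; rewrite gt_eqF// ltr_wpDl.
rewrite mulrA ler_wpM2r ?invr_ge0// (rev (fun a b => v b)) mulr_sumr.
rewrite [X in _ <= X](big_cat_nat _ (n := m))//=; last exact: leqW.
rewrite -[X in X <= _]add0r; apply: lerD.
  by apply: sumr_ge0 => i _; rewrite mulr_ge0// ltW.
rewrite [X in X <= _]big_nat [X in _ <= X]big_nat; apply: ler_sum => i /andP[mi _].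
by rewrite ler_wpM2r//; apply: hm => /=; exact: leqW.
Qed.

End weighted_cesaro.

(** * Hannan's condition: the decomposition into martingale and remainder *)

Section hannan.
Context d (Om : measurableType d) (R : realType) (P : probability Om R).
Variables (T : Om -> Om) (F : int -> set (set Om)).
Hypothesis ef : ergodic_filtration P T F.
Local Notation intg f := (P.-integrable setT (EFin \o f)).
Local Notation Ex f := (Rintegral P setT f).
Local Notation E0 := (cond_exp P (F 0)).
Let F_ i := @F_meas _ _ _ _ _ _ ef i.

Variable f : Om -> R.
Hypothesis if_ : intg f.
Hypothesis mf : measurable_wrt (F 0) f.

Let G i := cond_exp P (F i) f.
Let pd j := proj_diff P F (- j%:Z) f.

Variables (a : nat -> R) (A : R).
Hypothesis ipd2 : forall j, intg (fun w => pd j w ^+ 2).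
Hypothesis a0 : forall j, 0 <= a j.
Hypothesis pda : forall j, Ex (fun w => pd j w ^+ 2) <= a j ^+ 2.
Hypothesis aA : forall n, \sum_(0 <= j < n) a j <= A.

Let GP i : is_cond_exp P (F i) f (G i). Proof. exact: cond_expP. Qed.

(** Shifting by [T^j] brings every projection to the same level: measurable for [F 0], centred given
    [F (-1)]. *)
Let Y j w := pd j (iter j T w).

Let mY j : measurable_wrt (F 0) (Y j).
Proof.
have [m1 _ _] := GP (- j%:Z); have [m2 _ _] := GP (- j%:Z - 1).
have m3 : measurable_wrt (F (- j%:Z)) (G (- j%:Z - 1)).
  by apply: (wrt_mono ef) m2; rewrite gerBl.
have := @wrt_iter _ _ _ _ _ _ ef (- j%:Z) j (pd j) (measurable_funB m1 m3).
by rewrite addNr.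
Qed.

Let iY2 j : intg (fun w => Y j w ^+ 2).
Proof. exact: (intg_iter ef j (ipd2 j)). Qed.

Let Ya j : Ex (fun w => Y j w ^+ 2) <= a j ^+ 2.
Proof. by rewrite (Ex_iter ef j (ipd2 j)). Qed.

Let cY j : is_cond_exp P (F (-1)) (Y j) (fun=> 0).
Proof.
have [_ i1 _] := GP (- j%:Z); have [m2 i2 _] := GP (- j%:Z - 1).
have sub : F (- j%:Z - 1) `<=` F (- j%:Z) by apply: (F_mono ef); rewrite gerBl.
have c1 : is_cond_exp P (F (- j%:Z - 1)) (G (- j%:Z)) (G (- j%:Z - 1)).
  apply: (is_cond_exp_indic (@F_ _)) => // B mB.
  rewrite (cond_exp_indic (@F_ _) (GP (- j%:Z - 1)) mB).
  rewrite (cond_exp_indic (@F_ _) (GP (- j%:Z)))//.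
  exact: (sub_sigma_algebra2 sub).
have c2 := is_cond_expB (@F_ _) i1 i2 c1 (is_cond_exp_id m2 i2).
have := is_cond_exp_iter ef j (intgB i1 i2) c2.
rewrite addrAC addNr add0r; congr is_cond_exp.
by apply/funext => w; rewrite subrr.
Qed.

Let W n w := birkhoff_sum T f n w - E0 (birkhoff_sum T f n) w.

Let ibs n : intg (birkhoff_sum T f n).
Proof. by apply: intg_sum => i; exact: (intg_iter ef). Qed.

Let iW n : intg (W n).
Proof. by apply: intgB => //; exact: (E0_int ef). Qed.

(** Passing from [n] to [n+1] adds the antidiagonal [j + k = n]; all its terms are evaluated at
    [T^(n+1) w], where the projections telescope. *)
Let telescoped n w : \sum_(0 <= k < n) \sum_(0 <= j < n - k) Y j (iter k.+1 T w) =
  \sum_(0 <= i < n) (G 0 (iter i.+1 T w) - G (- i.+1%:Z) (iter i.+1 T w)).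
Proof.
elim: n => [|n IH]; first by rewrite !big_nil.
have -> : \sum_(0 <= k < n.+1) \sum_(0 <= j < n.+1 - k) Y j (iter k.+1 T w) =
    \sum_(0 <= k < n) \sum_(0 <= j < n - k) Y j (iter k.+1 T w) +
    \sum_(0 <= k < n.+1) pd (n - k)%N (iter n.+1 T w).
  rewrite [LHS]big_nat_recr//= [X in _ = _ + X]big_nat_recr//= addrA; congr (_ + _); last first.
    by rewrite subSnn big_nat1 subnn /Y.
  rewrite -big_split/= [LHS]big_nat [RHS]big_nat; apply: eq_bigr => k /andP[_ kn].
  rewrite subSn ?(ltnW kn)// big_nat_recr//=; congr (_ + _).
  rewrite -[LHS]/(pd (n - k)%N (iter (n - k) T (iter k.+1 T w))).
  by rewrite -iterD -[RHS]/(pd (n - k)%N (iter n.+1 T w)); congr (pd _ (iter _ _ _)); lia.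
rewrite IH [RHS]big_nat_recr//=; congr (_ + _).
rewrite big_nat_rev/= add0n.
have -> : \sum_(0 <= k < n.+1) pd (n - (n.+1 - k.+1))%N (iter n.+1 T w) =
    \sum_(0 <= k < n.+1) pd k (iter n.+1 T w).
  rewrite [LHS]big_nat [RHS]big_nat; apply: eq_bigr => k /andP[_ kn].
  by congr pd; lia.
rewrite -[T (iter n T w)]/(iter n.+1 T w).
move: (iter n.+1 T w) => x; elim: (n.+1) => [|m IHm]; first by rewrite big_nil subrr.
rewrite big_nat_recr//= IHm /pd /proj_diff /= -/(G _) -/(G _).
rewrite (_ : - m%:Z - 1 = - m.+1%:Z); last by lia.
by ring.
Qed.

(** By stationarity [E0 (f o T^i)] is [G (- i)] composed with [T^i], and [f = G 0] almost everywhere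
    since [f] is [F 0]-measurable. *)
Let W_eq : {ae P, forall w, forall n,
  W n w = \sum_(0 <= k < n) \sum_(0 <= j < n - k) Y j (iter k.+1 T w)}.
Proof.
apply: ae_foralln => n.
have h1 : {ae P, forall w, forall i, G 0 (iter i.+1 T w) = f (iter i.+1 T w)}.
  apply: ae_foralln => i.
  exact: (ae_iter ef i.+1 (E0_unique ef if_ (is_cond_exp_id mf if_))).
have e w : birkhoff_sum T f n w = \sum_(0 <= i < n) f (iter i.+1 T w).
  by rewrite /birkhoff_sum big_add1.
have h2 : {ae P, forall w, E0 (birkhoff_sum T f n) w =
    \sum_(0 <= i < n) G (- i.+1%:Z) (iter i.+1 T w)}.
  apply: (E0_unique ef (ibs n)).
  rewrite (_ : birkhoff_sum T f n = fun w => \sum_(0 <= i < n) f (iter i.+1 T w)); last exact/funext.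
  apply: (is_cond_exp_sum (@F_ 0)) => i; first exact: (intg_iter ef i.+1 if_).
  by have := is_cond_exp_iter ef i.+1 if_ (GP (- i.+1%:Z)); rewrite addNr.
apply: filterS2 h1 h2 => w h1 h2.
rewrite telescoped /W h2 e sumrB; congr (_ - _); apply: eq_bigr => i _.
by rewrite h1.
Qed.

(** [s2] is the second moment of [D]. The cosines of the normalised [W n] and [M n] have the same
    conditional limit because [E0 (R_n^2) / n] tends to zero; the last clause supplies the tightness
    needed for weak convergence. *)
Theorem hannan_quenched : exists s2 : R, [/\ 0 <= s2,
  (forall t th, {ae P, forall w,
    E0 (fun w => cos (t * (W n w / Num.sqrt n%:R) + th)) w @[n --> \oo] -->
      expR (- (s2 * t ^+ 2 / 2)) * cos th}),
  (forall n, intg (fun w => W n w ^+ 2)) &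
  {ae P, forall w, exists B : R, forall n, E0 (fun w => W n.+1 w ^+ 2) w / n.+1%:R <= B}].
Proof.
have [D [H [wt [mD iD2 Dc [mH iH [H0 wt0] wtcv Dle]]]]] :=
  weighted_series ef mY iY2 cY a0 Ya aA.
have mD0 := wrt_measurable (@F_ 0) mD.
pose rho m w := D w - \sum_(0 <= j < m) Y j w.
pose M n w := martingale T D n w.
pose Rn n w := \sum_(0 <= k < n) rho (n - k)%N (iter k.+1 T w).
have iD := intg_sqr mD0 iD2.
have iY j : intg (Y j) by apply: intg_sqr => //; exact: (wrt_measurable (@F_ 0) (@mY j)).
have mrho m : measurable_wrt (F 0) (rho m).
  by apply: measurable_funB => //; apply: measurable_sum => j; exact: mY.
have mrho0 m := wrt_measurable (@F_ 0) (@mrho m).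
have irho2 m : intg (fun w => rho m w ^+ 2).
  apply: (@intg_ae _ _ _ _ (fun w => Num.min (rho m w ^+ 2) (wt m * H w))).
  - exact: measurable_funX.
  - apply: intg_le (intgZ (wt m) iH) _.
      apply: measurable_minr; first exact: measurable_funX.
      exact: intg_meas (intgZ (wt m) iH).
    move=> w; rewrite ger0_norm; first by rewrite ge_min lexx orbT.
    by rewrite le_min sqr_ge0 /= mulr_ge0 ?wt0 ?H0.
  - by apply: filterS Dle => w h; rewrite min_l//; exact: h.
have crho m : is_cond_exp P (F (-1)) (rho m) (fun=> 0).
  have := is_cond_expB (@F_ _) iD (intg_sum _ _ iY) Dc (is_cond_exp_sum (@F_ _) (index_iota 0 m) iY cY).
  by congr is_cond_exp; apply/funext => w; rewrite big1// subrr.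
have WMR : {ae P, forall w, forall n, W n w = M n w - Rn n w}.
  apply: filterS W_eq => w h n; rewrite h /M /martingale big_add1/= /Rn -sumrB.
  by apply: eq_bigr => k _; rewrite /rho opprB addrC subrK.
have domR n := @second_moment_dom _ _ _ P T F ef (fun k => rho (n - k)%N)
  (fun k => mrho _) (fun k => irho2 _) (fun k => crho _) n.
have domM n := @second_moment_dom _ _ _ P T F ef (fun k => D)
  (fun k => mD) (fun k => iD2) (fun k => Dc) n.
have iR2 n : intg (fun w => Rn n w ^+ 2) by have [] := domR n.
have eM n : (fun w => (\sum_(0 <= k < n) D (iter k.+1 T w)) ^+ 2) = (fun w => M n w ^+ 2).
  by apply/funext => w; rewrite /M /martingale big_add1.
have iM2 n : intg (fun w => M n w ^+ 2) by have [] := domM n; rewrite eM.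
have mR n : measurable_fun setT (Rn n).
  exact: (wrt_measurable (@F_ n%:Z) (@second_moment_wrt _ _ _ P T F ef (fun k => rho (n - k)%N) (fun k => mrho _) n)).
have mM n : measurable_fun setT (M n).
  exact: (wrt_measurable (@F_ n%:Z) (@martingale_wrt _ _ _ _ _ _ ef D mD n)).
have iWt n : intg (fun w => \sum_(0 <= k < n) wt (n - k)%N * H (iter k.+1 T w)).
  by apply: intg_sum => k; apply: intgZ; exact: (intg_iter ef k.+1 iH).
have cWt n : is_cond_exp P (F 0) (fun w => \sum_(0 <= k < n) wt (n - k)%N * H (iter k.+1 T w))
    (fun w => \sum_(0 <= k < n) wt (n - k)%N * E0 (fun w => H (iter k.+1 T w)) w).
  apply: (is_cond_exp_sum (@F_ 0)) => k; first by apply: intgZ; exact: (intg_iter ef k.+1 iH).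
  have ik := intg_iter ef k.+1 iH.
  by apply: (is_cond_expZ (@F_ 0)) => //; exact: (E0P ef).
have ER : {ae P, forall w, forall n, E0 (fun w => Rn n w ^+ 2) w <=
    \sum_(0 <= k < n) wt (n - k)%N * E0 (fun w => H (iter k.+1 T w)) w}.
  apply: ae_foralln => n.
  have h1 : E0_dom P F (fun w => \sum_(0 <= k < n) rho (n - k)%N (iter k.+1 T w) ^+ 2)
      (fun w => \sum_(0 <= k < n) wt (n - k)%N * H (iter k.+1 T w)).
    apply: (E0_dom_ae ef) => //.
      by apply: intg_sum => k; exact: (intg_iter ef k.+1 (irho2 _)).
    have : {ae P, forall w, forall k m, (D (iter k T w) - \sum_(0 <= j < m) Y j (iter k T w)) ^+ 2
        <= wt m * H (iter k T w)}.
      by apply: ae_foralln => k; exact: (ae_iter ef k Dle).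
    by apply: filterS => w h; apply: ler_sum => k _; exact: h.
  have h2 := E0_dom_le ef (E0_dom_trans (domR n) h1).
  have h3 := E0_unique ef (iWt n) (cWt n).
  by apply: filterS2 h2 h3 => w h2 h3; rewrite -h3.
have EM : {ae P, forall w, forall n, E0 (fun w => M n w ^+ 2) w <=
    \sum_(0 <= k < n) E0 (fun w => D (iter k.+1 T w) ^+ 2) w}.
  apply: ae_foralln => n.
  have h2 := E0_dom_le ef (domM n).
  have iS : intg (fun w => \sum_(0 <= k < n) D (iter k.+1 T w) ^+ 2).
    by apply: intg_sum => k; exact: (intg_iter ef k.+1 iD2).
  have h3 := E0_unique ef iS (is_cond_exp_sum (@F_ 0) (index_iota 0 n)
    (fun k => intg_iter ef k.+1 iD2) (fun k => E0P ef (intg_iter ef k.+1 iD2))).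
  by apply: filterS2 h2 h3 => w; rewrite eM => h2 h3; rewrite -h3.
have H0ae : {ae P, forall w, forall k, 0 <= E0 (fun w => H (iter k T w)) w}.
  apply: ae_foralln => k; apply: (E0_ge0 ef); first exact: (intg_iter ef k iH).
  by apply: aeW => w.
have R0 : {ae P, forall w, forall n, 0 <= E0 (fun w => Rn n w ^+ 2) w}.
  apply: ae_foralln => n; apply: (E0_ge0 ef) => //; apply: aeW => w; exact: sqr_ge0.
(* [E0 (R_n^2)] is at most the sum of [wt (n - k) E0 (H o T^(k+1))]: a weighted Cesaro sum over a
   sequence whose plain averages converge. *)
have Rcv : {ae P, forall w, E0 (fun w => Rn n.+1 w ^+ 2) w / n.+1%:R @[n --> \oo] --> 0}.
  apply: filterS2 (filterI ER H0ae) (filterI R0 (quenched_ergodic ef mH iH)) => w [er h0] [r0 q].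
  apply: (@squeeze_cvgr _ _ _ _ (fun=> 0) (fun n => (\sum_(0 <= k < n.+1)
     wt (n.+1 - k)%N * E0 (fun w => H (iter k.+1 T w)) w) / n.+1%:R)).
  - apply: nearW => n; rewrite divr_ge0//= ler_wpM2r ?invr_ge0//; exact: er.
  - exact: cvg_cst.
  - exact: (weighted_cesaro h0 wt0 q wtcv).
have iW2 n : intg (fun w => W n w ^+ 2).
  apply: (@intg_ae _ _ _ _ (fun w => (M n w - Rn n w) ^+ 2)).
  - by apply: measurable_funX; exact: intg_meas (iW n).
  - have h := @intg_sqrD _ _ _ P (M n) (fun w => - Rn n w) (mM n).
    apply: h => //; first exact: measurableT_comp.
    by under eq_fun do rewrite sqrrN.
  - by apply: filterS WMR => w ->.
exists (Ex (fun w => D w ^+ 2)); split => //.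
- by apply: Rintegral_ge0 => w _; exact: sqr_ge0.
- move=> t th.
  have mcos : measurable_fun setT (@cos R).
    by apply: continuous_measurable_fun => x; exact: continuous_cos.
  pose cW n w := cos (t * (W n w / Num.sqrt n%:R) + th).
  pose cM n w := cos (t * martingale T D n w / Num.sqrt n%:R + th).
  have icos (h : Om -> R) : measurable_fun setT h -> intg (fun w => cos (h w)).
    move=> mh; apply: intg_le (intg_cst P 1) _; first exact: (measurableT_comp mcos mh).
    by move=> w; rewrite ler_norml cos_geN1 cos_le1.
  have icM n : intg (cM n).
    apply: icos; apply: measurable_funD; last exact: measurable_cst.
    apply: measurable_funM; last exact: measurable_cst.
    by apply: measurable_funM; [exact: measurable_cst|exact: mM].
  have icW n : intg (cW n).
    apply: icos; apply: measurable_funD; last exact: measurable_cst.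
    apply: measurable_funM; first exact: measurable_cst.
    by apply: measurable_funM; [exact: intg_meas (iW n)|exact: measurable_cst].
  (* The cosine is 1-Lipschitz, and [x <= e + x^2 / e] for [x >= 0] trades the size of the remainder
     for its second moment. *)
  have close (e : R) n : 0 < e -> {ae P, forall w,
      `|E0 (cW n.+1) w - E0 (cM n.+1) w| <= `|t| * (e + E0 (fun w => Rn n.+1 w ^+ 2) w / n.+1%:R / e)}.
    move=> e0.
    pose b w : R := `|t| * e + `|t| / n.+1%:R / e * Rn n.+1 w ^+ 2.
    have ib : intg b by apply: intgD; [exact: intg_cst|exact: intgZ].
    have cb : is_cond_exp P (F 0) b (fun w => `|t| * e + `|t| / n.+1%:R / e * E0 (fun w => Rn n.+1 w ^+ 2) w).
      apply: (is_cond_expD (@F_ 0)); [exact: intg_cst|exact: intgZ| |].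
        by apply: is_cond_exp_id; [exact: measurable_cst|exact: intg_cst].
      by apply: (is_cond_expZ (@F_ 0)) => //; exact: (E0P ef).
    have bnd : {ae P, forall w, `|cW n.+1 w - cM n.+1 w| <= b w}.
      apply: filterS WMR => w wmr; rewrite (le_trans (cos_lipschitz _ _))//.
      set sq := Num.sqrt _; have sq0 : 0 < sq by rewrite sqrtr_gt0.
      rewrite wmr (_ : _ - _ = t * (- Rn n.+1 w / sq)); last by rewrite -/(M n.+1 w); ring.
      rewrite normrM normrM normrN normfV (gtr0_norm sq0) /b.
      rewrite (_ : _ + _ = `|t| * (e + Rn n.+1 w ^+ 2 / n.+1%:R / e)); last by ring.
      rewrite ler_wpM2l// -(real_normK (num_real (Rn n.+1 w))).
      rewrite -(@sqr_sqrtr R n.+1%:R)// -/sq.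
      set x := `|_| / sq; rewrite (_ : _ / sq ^+ 2 = x ^+ 2); last by rewrite /x exprMn exprVn.
      have : 0 <= (x - e) ^+ 2 / e by rewrite divr_ge0 ?sqr_ge0// ltW.
      rewrite (_ : (x - e) ^+ 2 / e = x ^+ 2 / e - 2 * x + e); last by field; rewrite gt_eqF.
      have x0 : 0 <= x by rewrite divr_ge0// ltW.
      by lra.
    have d1 : {ae P, forall w, cW n.+1 w - cM n.+1 w <= b w}.
      by apply: filterS bnd => w h; exact: le_trans (ler_norm _) h.
    have d2 : {ae P, forall w, cM n.+1 w - cW n.+1 w <= b w}.
      by apply: filterS bnd => w; rewrite distrC => h; exact: le_trans (ler_norm _) h.
    have e1 := cond_exp_mono (@F_ 0) (intgB (icW _) (icM _)) ib
      (is_cond_expB (@F_ 0) (icW _) (icM _) (E0P ef (icW _)) (E0P ef (icM _))) cb d1.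
    have e2 := cond_exp_mono (@F_ 0) (intgB (icM _) (icW _)) ib
      (is_cond_expB (@F_ 0) (icM _) (icW _) (E0P ef (icM _)) (E0P ef (icW _))) cb d2.
    apply: filterS2 e1 e2 => w e1 e2.
    rewrite mulrDr (_ : `|t| * (E0 (fun w => Rn n.+1 w ^+ 2) w / n.+1%:R / e) = `|t| / n.+1%:R / e * E0 (fun w => Rn n.+1 w ^+ 2) w); last by ring.
    by move: e1 e2 => /= e1 e2; rewrite ler_norml lerNl opprB e1 e2.
  have closeall : {ae P, forall w, forall j n : nat,
      `|E0 (cW n.+1) w - E0 (cM n.+1) w| <= `|t| * (j.+1%:R^-1 + E0 (fun w => Rn n.+1 w ^+ 2) w / n.+1%:R / j.+1%:R^-1)}.
    by apply: ae_foralln => j; apply: ae_foralln => n; apply: close; rewrite invr_gt0.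
  apply: filterS3 closeall Rcv (quenched_martingale_clt ef mD iD2 Dc t th) => w hc rcv hM.
  suff hd : (E0 (cW n.+1) w - E0 (cM n.+1) w) @[n --> \oo] --> 0.
    rewrite -(cvg_shiftS (fun n => E0 (cW n) w)).
    rewrite -(cvg_shiftS (fun n => E0 (cM n) w)) in hM.
    have h : E0 (cW n.+1) w - E0 (cM n.+1) w + E0 (cM n.+1) w @[n --> \oo] -->
        0 + expR (- (Ex (fun w => D w ^+ 2) * t ^+ 2 / 2)) * cos th by apply: cvgD.
    by rewrite add0r in h; apply: (eq_cvgn _ h) => n; rewrite subrK.
  apply/cvgrPdist_le => e e0.
  have t1 : 0 < `|t| + 1 by rewrite ltr_wpDl.
  have [j hj] := natr_ge (e / 2 / (`|t| + 1))^-1.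
  have je : j.+1%:R^-1 <= e / 2 / (`|t| + 1).
    by rewrite -[X in _ <= X]invrK lef_pV2 ?posrE ?invr_gt0 ?divr_gt0//; apply: hj.
  have j0 : 0 < j.+1%:R^-1 :> R by rewrite invr_gt0.
  (* The tolerance is squared because [close] divides the second moment by [1/(j+1)]. *)
  move/cvgrPdist_le : rcv => /(_ (j.+1%:R^-1 ^+ 2)); rewrite exprn_gt0// => /(_ isT).
  apply: filterS => n; rewrite !sub0r !normrN => /(le_trans (ler_norm _)) hn.
  rewrite (le_trans (hc j n))//.
  apply: (@le_trans _ _ (`|t| * (j.+1%:R^-1 + j.+1%:R^-1))).
    by rewrite ler_wpM2l// lerD2l ler_pdivrMr.
  rewrite -mulr2n -[_ *+ 2]mulr_natl.
  apply: (@le_trans _ _ ((`|t| + 1) * (2 * (e / 2 / (`|t| + 1))))); last first.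
    by rewrite le_eqVlt; apply/orP; left; apply/eqP; field; rewrite gt_eqF.
  by apply: ler_pM; rewrite ?normr_ge0 ?lerDl ?mulr_ge0 ?(ltW j0) ?ler_wpM2l.
(* From [W = M - R] one has [W^2 <= 2 M^2 + 2 R^2]. The first part has convergent conditional
   averages by [quenched_ergodic] for [D^2], the second tends to zero. *)
- have EW : {ae P, forall w, forall n, E0 (fun w => W n w ^+ 2) w <=
      2 * E0 (fun w => M n w ^+ 2) w + 2 * E0 (fun w => Rn n w ^+ 2) w}.
    apply: ae_foralln => n.
    have ib := intgD (intgZ 2 (iM2 n)) (intgZ 2 (iR2 n)).
    apply: (cond_exp_mono (@F_ 0) (iW2 n) ib (E0P ef (iW2 n))
       (is_cond_expD (@F_ 0) (intgZ 2 (iM2 n)) (intgZ 2 (iR2 n))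
         (is_cond_expZ (@F_ 0) 2 (iM2 n) (E0P ef (iM2 n)))
         (is_cond_expZ (@F_ 0) 2 (iR2 n) (E0P ef (iR2 n))))).
    apply: filterS WMR => w ->; have := sqr_ge0 (M n w + Rn n w); lra.
  have qD := quenched_ergodic ef (measurable_funX 2 mD) iD2.
  apply: filterS3 (filterI EW EM) qD Rcv => w [ew em] qd rcv.
  have mcv := cesaro_shift qd.
  have : cvgn (fun n => 2 * ((\sum_(0 <= k < n.+1) E0 (fun w => D (iter k.+1 T w) ^+ 2) w) / n.+1%:R) +
      2 * (E0 (fun w => Rn n.+1 w ^+ 2) w / n.+1%:R)).
    apply/cvg_ex; eexists; apply: cvgD; apply: cvgM; [exact: cvg_cst|exact: mcv|exact: cvg_cst|exact: rcv].
  move=> /cvg_seq_bounded[B [_ hB]]; exists (B + 1) => n.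
  have := hB (B + 1); rewrite ltrDl ltr01 => /(_ isT n I) /(le_trans (ler_norm _)); apply: le_trans.
  rewrite !mulrA -mulrDl ler_wpM2r ?invr_ge0// (le_trans (ew _))// lerD2r ler_wpM2l//.
Qed.

End hannan.


(** * Integrals against a regular conditional distribution *)

Lemma probability_of_measure d (T : measurableType d) (R : realType)
    (m : {measure set T -> \bar R}) : m setT = 1%E ->
  exists Q : probability T R, (Q : {measure set T -> \bar R}) = m.
Proof.
case: m => m cm m1.
pose h := Measure_isProbability.Build _ _ _ (Measure.Pack cm) m1.
pose Q : probability T R := HB.pack m (Measure.Pack cm) h.
exists Q; rewrite /Q; case: cm m1 @h @Q => [c1 c2] m1 h Q; reflexivity.
Qed.

Section kernel_cond_exp.
Import HBNNSimple.
Context d (T : measurableType d) (R : realType) (P : probability T R).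
Variables (G : set (set T)).
Hypothesis GA : G `<=` measurable.
Local Notation mR := (measurableTypeR R).
Variables (X : T -> R) (k : R.-pker (g_sigma_algebraType G) ~> mR).
Hypothesis mX : measurable_fun setT X.
Hypothesis kX : is_cond_distribution P X k.

Local Notation intg f := (P.-integrable setT (EFin \o f)).

Let sub_emeasurable_fun (h : T -> \bar R) :
  measurable_fun [set: g_sigma_algebraType G] h -> measurable_fun [set: T] h.
Proof. by move=> mh _ C mC; apply: (sub_measurable GA); exact: mh. Qed.

Let mk B : measurable B -> measurable_fun [set: T] (k ^~ B).
Proof.
move=> mB _ C mC; apply: (sub_measurable GA).
by rewrite setTI -[X in measurable X]setTI; exact: (measurable_kernel k B mB).
Qed.

Local Open Scope ereal_scope.

Let kernel_nnsfun (A : set T) (phi : {nnsfun mR >-> R}) : G.-sigma.-measurable A ->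
  \int[P]_(w in A) (\int[k w]_x (phi x)%:E) = \int[P]_(w in A) (phi (X w))%:E.
Proof.
move=> mA; have mA' := sub_measurable GA mA.
have mphi r : measurable (phi @^-1` [set r] : set mR).
  by rewrite -[X in measurable X]setTI; exact: (@measurable_funPT _ _ _ _ phi).
have mXphi r : measurable (X @^-1` (phi @^-1` [set r])).
  by rewrite -[X in measurable X]setTI; exact: (mX measurableT (mphi r)).
rewrite [RHS](_ : _ = \int[P]_(w in A)
    (\sum_(r \in range phi) (r * \1_(X @^-1` (phi @^-1` [set r])) w)%:E)); last first.
  by apply: eq_integral => w _; rewrite [in LHS](fimfunE phi (X w)) -fsumEFin.
rewrite ge0_integral_fsum//; last 2 first.
  - move=> r; apply/measurable_EFinP; apply: measurable_funM => //.
  - by move=> r z _; exact: (nnfun_muleindic_ge0 phi r (X z)).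
under [in LHS]eq_integral.
  move=> y _.
  under eq_integral.
    by move=> z _; rewrite fimfunE -fsumEFin//; over.
  rewrite /= ge0_integral_fsum//; last 2 first.
    - by move=> r; apply/measurable_EFinP/measurableT_comp.
    - by move=> r z _; rewrite EFinM nnfun_muleindic_ge0.
  under eq_fsbigr.
    move=> r _.
    rewrite (integralZl_indic _ (fun r => phi @^-1` [set r]))//; last first.
      by move=> r0; rewrite preimage_nnfun0.
    rewrite integral_indic// setIT.
    over.
  over.
rewrite /= ge0_integral_fsum//; last 2 first.
  - move=> r; apply: measurable_funeM.
    by apply: measurable_funTS; exact: mk.
  - move=> n y _.
    have := mulemu_ge0 (fun n => phi @^-1` [set n]).
    by apply; exact: preimage_nnfun0.
apply: eq_fsbigr => r _.
have [r0|r0] := leP 0%R r.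
  rewrite ge0_integralZl//; last by apply: measurable_funTS; exact: mk.
  rewrite (kX mA)//.
  rewrite (_ : (fun x => _) = (fun w => r%:E * (\1_(X @^-1` (phi @^-1` [set r])) w)%:E))//.
  rewrite ge0_integralZl//; last first.
    by apply/measurable_EFinP; apply: measurable_indic; exact: mXphi.
  by rewrite integral_indic// setIC.
rewrite integral0_eq; last by move=> y _; rewrite preimage_nnfun0// measure0 mule0.
by rewrite integral0_eq// => y _; rewrite preimage_nnfun0// indic0 mulr0.
Qed.

(** The defining identity on sets extends to simple functions and then, by monotone convergence in
    the extended reals, to nonnegative [phi]. *)
Lemma integral_cond_distribution (A : set T) (phi : R -> R) : G.-sigma.-measurable A ->
  (forall x, 0 <= phi x)%R -> measurable_fun setT phi ->
  \int[P]_(w in A) (\int[k w]_x (phi x)%:E) = \int[P]_(w in A) (phi (X w))%:E.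
Proof.
move=> mA phi0 mphi; have mA' := sub_measurable GA mA.
have mf : measurable_fun [set: mR] (EFin \o phi) by exact/measurable_EFinP.
pose f_ := nnsfun_approx measurableT mf.
have f_cvg x : (f_ n x)%:E @[n --> \oo] --> (phi x)%:E.
  by apply: (cvg_nnsfun_approx measurableT mf) => // y _; rewrite /= lee_fin.
have f_nd x : {homo (fun n => (f_ n x)%:E) : m n / (m <= n)%N >-> m <= n}.
  by move=> m n mn; rewrite lee_fin; exact/lefP/nd_nnsfun_approx.
have f_int w : \int[k w]_x (f_ n x)%:E @[n --> \oo] --> \int[k w]_x (phi x)%:E.
  rewrite (_ : (fun x => (phi x)%:E) = (fun x => lim ((f_ n x)%:E @[n --> \oo]))).
    apply: cvg_monotone_convergence => // [n|n x _].
      by apply/measurable_EFinP.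
    by rewrite lee_fin.
  by apply/funext => x; apply/esym/cvg_lim => //; exact: f_cvg.
have mint n : measurable_fun A (fun w => \int[k w]_x (f_ n x)%:E).
  apply: measurable_funTS; apply: sub_emeasurable_fun.
  apply: measurable_fun_integral_kernel => //.
  - by move=> U mU; exact: measurable_kernel.
  - by move=> z; rewrite lee_fin.
  - exact/measurable_EFinP.
transitivity (lim ((\int[P]_(w in A) (\int[k w]_x (f_ n x)%:E)) @[n --> \oo])).
  rewrite -monotone_convergence//.
  - apply: eq_integral => w _; apply/esym/cvg_lim => //; exact: f_int.
  - by move=> n w _; apply: integral_ge0 => // z _; rewrite lee_fin.
  - move=> w _ m n mn; apply: ge0_le_integral => //.
    + by move=> z _; rewrite lee_fin.
    + exact/measurable_EFinP.
    + exact/measurable_EFinP.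
    + by move=> z _; exact: f_nd.
under eq_fun do rewrite (kernel_nnsfun _ mA).
rewrite -monotone_convergence//.
- by apply: eq_integral => w _; apply/cvg_lim => //; exact: f_cvg.
- move=> n; apply/measurable_EFinP; apply: measurable_funTS.
  by apply: (@measurableT_comp _ _ _ T mR R (f_ n) _ X).
- by move=> n w _; rewrite lee_fin.
Qed.

Local Open Scope ring_scope.

(** The kernel integral, made real where it is finite, is itself a version of the conditional
    expectation; it is finite almost everywhere because its mean is that of [phi (X w)]. *)
Lemma cond_distribution_cond_exp (phi : R -> R) : (forall x, 0 <= phi x) ->
  measurable_fun setT phi -> intg (fun w => phi (X w)) ->
  {ae P, forall w : T, (k w).-integrable setT (EFin \o phi) /\
     \int[k w]_x phi x = cond_exp P G (fun w => phi (X w)) w}.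
Proof.
move=> phi0 mphi iphi.
pose h (w : T) : \bar R := (\int[k w]_x (phi x)%:E)%E.
have h0 w : (0 <= h w)%E by apply: integral_ge0 => x _; rewrite lee_fin.
have mh : measurable_fun [set: g_sigma_algebraType G] h.
  apply: measurable_fun_integral_kernel => //.
  - by move=> U mU; exact: measurable_kernel.
  - exact/measurable_EFinP.
have mhT : measurable_fun [set: T] h.
  by move=> _ C mC; apply: (sub_measurable GA); exact: mh.
have ih : P.-integrable setT h.
  apply/integrableP; split => //.
  under eq_integral do rewrite gee0_abs//.
  rewrite (integral_cond_distribution _ phi0 mphi)//.
  have /integrableP[_] := iphi.
  by under eq_integral do rewrite /= ger0_norm//.
have hfin : {ae P, forall w, h w \is a fin_num}.
  by move: (integrable_ae measurableT ih); apply: filterS => w; apply.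
have ehf : {ae P, forall w, h w = (fine (h w))%:E}.
  by move: hfin; apply: filterS => w hw; rewrite fineK.
have mfh : measurable_fun setT (fine \o h) by exact: measurableT_comp mhT.
have ifh : intg (fine \o h).
  have /integrableP[_ hoo] := ih.
  apply/integrableP; split; first exact/measurable_EFinP.
  rewrite (@ae_eq_integral _ _ _ _ _ (fun w => `|h w|)%E)//.
  - by apply: measurableT_comp => //; exact/measurable_EFinP.
  - exact: measurableT_comp.
  - by move: ehf; apply: filterS => w e _; rewrite [in RHS]e.
have hc : is_cond_exp P G (fun w => phi (X w)) (fine \o h).
  split => //; first exact: (measurableT_comp _ mh).
  move=> A mA; rewrite -(integral_cond_distribution mA phi0 mphi).
  have mA' := sub_measurable GA mA.
  apply: ae_eq_integral => //; try exact: measurable_funTS.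
  - by apply/measurable_EFinP; exact: measurable_funTS.
  - by move: ehf; apply: filterS => w e _; rewrite [in RHS]/= -/(h w) e.
have := cond_exp_unique GA iphi iphi hc (cond_expP GA iphi) (fun A _ => erefl).
move: hfin; apply: filterS2 => w hw hE; split; last exact: hE.
apply/integrableP; split; first exact/measurable_EFinP.
under eq_integral do rewrite /= ger0_norm//.
by rewrite -ge0_fin_numE ?h0.
Qed.

Lemma cond_distribution_cos (t th : R) :
  {ae P, forall w : T, \int[k w]_x cos (t * x + th) =
    cond_exp P G (fun w => cos (t * X w + th)) w}.
Proof.
pose c x := cos (t * x + th).
have mc : measurable_fun setT c.
  apply: continuous_measurable_fun => x.
  apply: continuous_comp; last exact: continuous_cos.
  by apply: cvgD; [exact: cvgMr|exact: cvg_cst].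
have mcX : measurable_fun setT (c \o X) by exact: measurableT_comp mc mX.
have icX : intg (c \o X).
  apply: intg_le (intg_cst P 1) _ => // w.
  by rewrite ler_norml cos_geN1 cos_le1.
(* Adding one makes the cosine nonnegative; the constant cancels at the end since [k w] has mass
   one. *)
have i1cX : intg (fun w => 1 + c (X w)) by apply: intgD => //; exact: intg_cst.
have c10 x : 0 <= 1 + c x by have := cos_geN1 (t * x + th); rewrite /c; lra.
have mc1 : measurable_fun setT (fun x => 1 + c x) by exact: measurable_funD.
have h1 : is_cond_exp P G (fun w => 1 + c (X w)) (fun w => 1 + cond_exp P G (c \o X) w).
  apply: is_cond_expD => //; [exact: intg_cst| |exact: cond_expP].
  by apply: is_cond_exp_id => //; [exact: measurable_cst|exact: intg_cst].
have := cond_exp_unique GA i1cX i1cX (cond_expP GA i1cX) h1 (fun A _ => erefl).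
have := cond_distribution_cond_exp c10 mc1 i1cX.
apply: filterS2 => w [_ +] e2; rewrite e2.
have [Q <-] := probability_of_measure (@prob_kernel _ _ _ _ _ k w).
have ic : Q.-integrable setT (EFin \o c).
  apply: intg_le (intg_cst Q 1) _ => // x.
  by rewrite ler_norml cos_geN1 cos_le1.
rewrite ExD//; last exact: intg_cst.
by rewrite Ex_cst => /addrI.
Qed.

End kernel_cond_exp.


(** * Bernstein polynomials in a sine *)

Section bernstein.
Variable R : realType.
Implicit Types (a b : nat -> R) (y : R).

(* [bernstein n a y] is the expectation of [a] at a binomial variable with
   parameters [n] and [y], obtained by conditioning on the first trial. *)
Fixpoint bernstein n a y : R :=
  if n is m.+1 then y * bernstein m (fun k => a k.+1) y + (1 - y) * bernstein m a y
  else a 0.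

Lemma bernstein_le n a b y : 0 <= y <= 1 ->
  (forall k, (k <= n)%N -> `|a k| <= b k) -> `|bernstein n a y| <= bernstein n b y.
Proof.
move=> /andP[y0 y1]; elim: n a b => [|n ih] a b ab /=; first exact: ab.
have y1' : 0 <= 1 - y by rewrite subr_ge0.
rewrite (le_trans (ler_normD _ _))// !normrM (ger0_norm y0) (ger0_norm y1').
by rewrite lerD// ler_wpM2l// ih// => k kn; apply: ab => //; exact: leqW.
Qed.

Lemma bernsteinB n a (c y : R) : bernstein n (fun k => a k - c) y = bernstein n a y - c.
Proof. by elim: n a => [//|n ih] a /=; rewrite !ih; ring. Qed.

Lemma bernstein_affine n a (c e y : R) :
  bernstein n (fun k => c + e * a k) y = c + e * bernstein n a y.
Proof. by elim: n a => [//|n ih] a /=; rewrite !ih; ring. Qed.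

Let bernstein_mean n (s y : R) : bernstein n (fun k => k%:R + s) y = n%:R * y + s.
Proof.
elim: n s => [|n ih] s /=; first by rewrite mul0r.
rewrite (_ : (fun k => _) = (fun k => k%:R + (1 + s))).
  by rewrite !ih -[in RHS]natr1; ring.
by apply/funext => k; rewrite -natr1 addrA.
Qed.

(** The shift [s] is what the induction needs, as a success in the first trial adds one to the
    count. At [s = - n y] this is the binomial variance. *)
Lemma bernstein_variance n (s y : R) :
  bernstein n (fun k => (k%:R + s) ^+ 2) y = n%:R * y * (1 - y) + (n%:R * y + s) ^+ 2.
Proof.
elim: n s => [|n ih] s /=; first by rewrite !mul0r !add0r.
rewrite (_ : (fun k => _) = (fun k => (k%:R + (1 + s)) ^+ 2)).
  by rewrite !ih -[in RHS]natr1; ring.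
by apply/funext => k; rewrite -natr1 addrA.
Qed.

End bernstein.

Section uniform_modulus.
Variable R : realType.

(** For [z] close to [x], continuity with one radius [r] for the whole segment; otherwise the
    trivial bound [2 M] is below [2 M (z - x)^2 / r^2]. The quadratic shape fits the binomial
    variance. *)
Lemma bounded_continuous_modulus (phi : R -> R) (M A e : R) : continuous phi ->
  (forall x, `|phi x| <= M) -> 0 < e ->
  exists2 K, 0 <= K & forall x z, `|x| <= A -> `|phi z - phi x| <= e + K * (z - x) ^+ 2.
Proof.
move=> cphi bphi e0.
have M0 : 0 <= M := le_trans (normr_ge0 _) (bphi 0).
have [r r0 rP] : exists2 r : R, 0 < r &
    forall x z, `|x| <= A -> `|z - x| < r -> `|phi z - phi x| <= e.
  pose Q (r : R) (x : R) := forall z, `|z - x| < r -> `|phi z - phi x| <= e.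
  have nc : near_covering `[- A, A] by apply/compact_near_coveringP; exact: segment_compact.
  have : \forall r \near 0^'+, `[- A, A] `<=` Q r.
    apply: nc => x _.
    have e2 : 0 < e / 2 by rewrite divr_gt0.
    have /cvgrPdist_le /(_ _ e2) /nbhs_ballP[r /= r0 rP] := cphi x.
    have r2 : 0 < r / 2 by rewrite divr_gt0.
    near=> x' r' => z zx'.
    have x'x : `|x - x'| < r / 2 by near: x'; exact: nbhsx_ballx.
    have r'r : r' < r / 2 by near: r'; exact: nbhs_right_lt.
    have h1 : `|phi x - phi x'| <= e / 2.
      by apply: rP; rewrite /ball/=; lra.
    have h2 : `|phi x - phi z| <= e / 2.
      apply: rP; rewrite /ball/= (_ : x - z = (x - x') - (z - x')); last by ring.
      by rewrite (le_lt_trans (ler_normB _ _))//; rewrite /= in zx'; lra.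
    rewrite /= (_ : phi z - phi x' = (phi x - phi x') - (phi x - phi z)); last by ring.
    by rewrite (le_trans (ler_normB _ _))//; lra.
  move=> H; have : \forall r \near 0^'+, 0 < r /\ `[- A, A] `<=` Q r.
    near=> r; split; [by near: r; exact: nbhs_right_gt|by near: r].
  move=> /filter_ex[r [r0 rP]]; exists r => // x z xA; apply: rP.
  by rewrite /= in_itv/= -ler_norml.
have K0 : 0 <= 2 * M / r ^+ 2 by rewrite divr_ge0 ?sqr_ge0// mulr_ge0.
exists (2 * M / r ^+ 2) => //.
move=> x z xA; have [zx|zx] := ltP `|z - x| r.
  by rewrite (le_trans (rP _ _ xA zx))// lerDl mulr_ge0// ?sqr_ge0.
rewrite (le_trans (ler_normB _ _))//.
have h : 1 <= (z - x) ^+ 2 / r ^+ 2.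
  rewrite ler_pdivlMr ?exprn_gt0// mul1r -[leRHS]real_normK ?num_real//.
  by rewrite ler_sqr ?nnegrE// ltW.
have := bphi z; have := bphi x.
have : 2 * M * 1 <= 2 * M * ((z - x) ^+ 2 / r ^+ 2) by rewrite ler_wpM2l// mulr_ge0.
by rewrite mulr1 -mulrAC mulrA; lra.
Unshelve. all: by end_near. Qed.

End uniform_modulus.


Section sin_section.
Variable R : realType.

Lemma sin_diff_ge (u v : R) : `|u| <= 1 -> `|v| <= 1 -> u <= v ->
  (v - u) / 2 <= sin v - sin u.
Proof.
rewrite !ler_norml => /andP[u1 u2] /andP[v1 v2] uv.
have [c cuv ->] : exists2 c, c \in `[u, v] & sin v - sin u = cos c * (v - u).
  apply: (@MVT_segment R sin cos) => //.
  by apply: continuous_subspaceT => x; exact: continuous_sin.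
have : 1 / 2 <= cos c.
  move: cuv; rewrite in_itv/= => /andP[uc cv].
  have c1 : `|c| <= 1 by rewrite ler_norml; lra.
  have : 1 - cos `|c| <= `|c| ^+ 2 / 2 by exact: cos_ge.
  have -> : cos `|c| = cos c by case: (ger0P c) => // _; rewrite cosN.
  have : `|c| ^+ 2 <= 1 by rewrite expr_le1.
  lra.
by move=> h; rewrite mulrC; apply: ler_wpM2r; lra.
Qed.

Lemma sin_section : exists g : R -> R, forall t,
  `|g t| <= 1 /\ forall u, `|u| <= 1 -> `|g t - u| <= 2 * `|t - sin u|.
Proof.
suff /choice[g gP] : forall t : R, exists v, `|v| <= 1 /\
    forall u, `|u| <= 1 -> `|v - u| <= 2 * `|t - sin u| by exists g.
move=> t.
have lip (u v : R) : `|u| <= 1 -> `|v| <= 1 -> `|v - u| <= 2 * `|sin v - sin u|.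
  move=> u1 v1; wlog uv : u v u1 v1 / u <= v.
    move=> H; have [uv|/ltW vu] := leP u v; first exact: H.
    by rewrite distrC (distrC (sin v)); exact: H.
  have := sin_diff_ge u1 v1 uv; have := ler_norm (sin v - sin u).
  by rewrite (ger0_norm (_ : 0 <= v - u)) ?subr_ge0//; lra.
have [t1|t1] := leP (sin 1) t.
  exists 1; rewrite normr1; split=> // u u1.
  have u1' : u <= 1 by rewrite (le_trans (ler_norm u)).
  have := @sin_diff_ge u 1 u1 _ u1'; rewrite normr1 => /(_ (lexx _)) h.
  by have := ler_norm (t - sin u); rewrite (ger0_norm (_ : 0 <= 1 - u)) ?subr_ge0//; lra.
have [t2|t2] := leP t (- sin 1).
  exists (-1); rewrite normrN1; split=> // u u1.
  have u1' : - 1 <= u by move: u1; rewrite ler_norml => /andP[].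
  have := @sin_diff_ge (-1) u _ u1 u1'; rewrite normrN1 sinN => /(_ (lexx _)) h.
  by rewrite distrC (distrC t); have := ler_norm (sin u - t); rewrite (ger0_norm (_ : 0 <= u - -1)) ?subr_ge0//; lra.
have [|||v v1 <-] := @IVT R sin (-1) 1 t.
- lra.
- by apply: continuous_subspaceT => x; exact: continuous_sin.
- by rewrite sinN ge_min le_max (ltW t2) (ltW t1) !orbT.
have v1' : `|v| <= 1 by rewrite ler_norml; move: v1; rewrite in_itv.
by exists v; split => // u u1; exact: lip.
Qed.
End sin_section.

Section trigonometric_approximation.
Variable R : realType.

(** Bernstein's proof of the Weierstrass theorem in the variable [y = (1 + sin (x / N)) / 2]. The
    result is a trigonometric polynomial with coefficients bounded by [M], hence bounded by [M] on
    the whole line, not only near the segment. *)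
Lemma bernstein_sin_approx (phi : R -> R) (M e N : R) : continuous phi ->
  (forall x, `|phi x| <= M) -> 0 < e -> 0 < N ->
  exists n (a : nat -> R), (forall k, `|a k| <= M) /\
    forall x, `|x| <= N -> `|bernstein n a ((1 + sin (N^-1 * x)) / 2) - phi x| <= 2 * e.
Proof.
move=> cphi bphi e0 N0.
have [K K0 KP] := bounded_continuous_modulus N cphi bphi e0.
have [g gP] := sin_section R.
have [m mP] := natr_ge (16 * K * N ^+ 2 / e).
pose n := m.+1; pose a k := phi (N * g (2 * (k%:R / n%:R) - 1)).
have n0 : 0 < n%:R :> R by rewrite ltr0n.
exists n, a; split => [k|x xN]; first exact: bphi.
set u := N^-1 * x; set y := (1 + sin u) / 2.
have u1 : `|u| <= 1 by rewrite normrM gtr0_norm ?invr_gt0// mulrC ler_pdivrMr// mul1r.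
have xE : x = N * u by rewrite /u mulrA divff ?mul1r// gt_eqF.
have y01 : 0 <= y <= 1.
  by have := sin_le1 u; have := sin_geN1 u; rewrite /y; lra.
(* The factor is [16 = 2^2 * 2^2]: the constant of [g], and
   [2 (k / n) - 1 - sin u = 2 (k - n y) / n]. *)
clearbody u; set c := 16 * K * N ^+ 2 / n%:R ^+ 2.
have ak k : `|a k - phi x| <= e + c * (k%:R + - (n%:R * y)) ^+ 2.
  rewrite (le_trans (KP _ _ xN))// lerD2l /c xE.
  set v := g _; have h : `|v - u| <= 2 * `|2 * (k%:R / n%:R) - 1 - sin u| by apply: (gP _).2.
  rewrite (_ : K * _ = K * N ^+ 2 * (v - u) ^+ 2); last by ring.
  rewrite (_ : _ * _ * _ / _ * _ = K * N ^+ 2 * (2 * (2 * (k%:R / n%:R) - 1 - sin u)) ^+ 2).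
    apply: ler_wpM2l; first by rewrite mulr_ge0 ?sqr_ge0.
    rewrite -[leLHS]real_normK ?num_real// -[leRHS]real_normK ?num_real//.
    by rewrite ler_sqr ?nnegrE// normrM (ger0_norm (ler0n R 2)).
  by rewrite /y; field; rewrite gt_eqF.
rewrite -bernsteinB (le_trans (bernstein_le y01 (fun k _ => ak k)))//.
rewrite bernstein_affine bernstein_variance subrr expr0n addr0.
have : c * (n%:R * y * (1 - y)) <= e.
  have mn : 16 * K * N ^+ 2 / e <= n%:R by apply: mP; exact: leqnSn.
  have y1 : y * (1 - y) <= 1 by have := sqr_ge0 y; case/andP: y01 => *; nra.
  rewrite (_ : c * _ = 16 * K * N ^+ 2 * (y * (1 - y)) / n%:R); last first.
    by rewrite /c; field; rewrite gt_eqF.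
  rewrite ler_pdivrMr//; move: mn; rewrite ler_pdivrMr// mulrC => mn.
  rewrite (mulrC e) (le_trans _ mn)// ler_piMr//.
  by rewrite mulrC -mulrA; apply: mulr_ge0 => //; exact: (mulr_ge0 K0 (sqr_ge0 N)).
lra.
Qed.
End trigonometric_approximation.


(** * Weak convergence from countably many cosines and bounded second moments *)

Section levy_criterion.
Variable R : realType.
Local Notation mR := (measurableTypeR R).
Variables (nu_ : nat -> probability mR R) (nu : probability mR R).

Let C (g : R -> R) := [/\ measurable_fun setT g,
  (exists M, forall x, `|g x| <= M) &
  \int[nu_ n]_x g x @[n --> \oo] --> \int[nu]_x g x].

Hypothesis nu_cos : forall (q : rat) (j : nat),
  \int[nu_ n]_x cos (ratr q * x - j%:R * (pi / 2)) @[n --> \oo] -->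
  \int[nu]_x cos (ratr q * x - j%:R * (pi / 2)).

Let C_intg g (Q : probability mR R) : C g -> Q.-integrable setT (EFin \o g).
Proof. by move=> [mg [M gM] _]; apply: intg_le (intg_cst Q M) _. Qed.

Let C_comb g h (a b : R) : C g -> C h -> C (fun x => a * g x + b * h x).
Proof.
move=> Cg Ch; have [[mg [M gM] cg] [mh [L hL] ch]] := (Cg, Ch); split.
- by apply: measurable_funD; exact: measurable_funM.
- exists (`|a| * M + `|b| * L) => x; rewrite (le_trans (ler_normD _ _))// !normrM.
  by rewrite lerD// ler_wpM2l.
- have E (Q : probability mR R) : \int[Q]_x (a * g x + b * h x) =
      a * \int[Q]_x g x + b * \int[Q]_x h x.
    by rewrite ExD ?ExZ//; try apply: intgZ; exact: C_intg.
  rewrite E; apply: (eq_cvgn (fun n => esym (E (nu_ n)))).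
  by apply: cvgD; apply: cvgMr.
Qed.

(** Strengthens [C g] so as to be stable under multiplication by a sine: the extra cosine factor
    absorbs the product formulas. *)
Let trig (g : R -> R) := forall (q : rat) (j : nat),
  C (fun x => g x * cos (ratr q * x - j%:R * (pi / 2))).

Let trig_cst (c : R) : trig (fun=> c).
Proof.
move=> q j; pose h x : R := cos (ratr q * x - j%:R * (pi / 2)).
have Ch : C h.
  split => //.
  - apply: continuous_measurable_fun => x.
    apply: continuous_comp; last exact: continuous_cos.
    by apply: cvgB; [exact: cvgMr|exact: cvg_cst].
  - by exists 1 => x; rewrite ler_norml cos_geN1 cos_le1.
  - exact: nu_cos.
rewrite (_ : (fun x => _) = fun x => c * h x + 0 * h x); first exact: C_comb.
by apply/funext => x; rewrite mul0r addr0.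
Qed.

Let trig_comb g h (a b : R) : trig g -> trig h -> trig (fun x => a * g x + b * h x).
Proof.
move=> tg th q j; have := C_comb a b (tg q j) (th q j).
by congr C; apply/funext => x; ring.
Qed.

(** [2 sin v cos u = sin (u + v) - sin (u - v)], and a sine is a cosine delayed by [pi / 2]. This is
    why phases are multiples of [pi / 2] and frequencies range over all rationals. *)
Let trig_sin (p : rat) g : trig g -> trig (fun x => sin (ratr p * x) * g x).
Proof.
move=> tg q j; have := C_comb (1/2) (- (1/2)) (tg (q + p) j.+1) (tg (q - p) j.+1).
congr C; apply/funext => x.
rewrite rmorphD rmorphB -[j.+1%:R]natr1 /=.
set u : R := ratr q * x - j%:R * (pi / 2); set v := ratr p * x.
have -> : (ratr q + ratr p) * x - (j%:R + 1) * (pi / 2) = (u + v) - pi / 2 by rewrite /u /v; ring.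
have -> : (ratr q - ratr p) * x - (j%:R + 1) * (pi / 2) = (u - v) - pi / 2 by rewrite /u /v; ring.
by clearbody u v; rewrite !cosBpihalf sinD sinB; field.
Qed.

Let trig_bernstein (p : rat) n (a : nat -> R) :
  trig (fun x => bernstein n a ((1 + sin (ratr p * x)) / 2)).
Proof.
elim: n a => [|n ih] a /=; first exact: trig_cst.
have h1 := trig_comb (1/2) (1/2) (ih (fun k => a k.+1)) (ih a).
have h2 := trig_sin p (trig_comb (1/2) (- (1/2)) (ih (fun k => a k.+1)) (ih a)).
have := trig_comb 1 1 h1 h2.
by congr trig; apply/funext => x; field.
Qed.

Let C_bernstein (p : rat) n (a : nat -> R) :
  C (fun x => bernstein n a ((1 + sin (ratr p * x)) / 2)).
Proof.
have := trig_bernstein p n a 0 0%N; congr C; apply/funext => x.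
by rewrite rmorph0 !mul0r subr0 cos0 mulr1.
Qed.

(** On [[-N, N]] the test function is close to a Bernstein polynomial [g] in a sine, for which
    convergence is known. Outside, both are bounded by [M], and [2 M <= 2 M x^2 / N^2] is controlled
    by the second moments. *)
Lemma levy_criterion (B : R) :
  (forall n, (nu_ n).-integrable setT (EFin \o (fun x => x ^+ 2))) ->
  (forall n, \int[nu_ n]_x (x ^+ 2) <= B) ->
  nu.-integrable setT (EFin \o (fun x => x ^+ 2)) ->
  weak_cvg nu_ nu.
Proof.
move=> i2 B2 inu phi cphi bphi.
have [M bM] : exists M, forall x, `|phi x| <= M.
  case: bphi => M0 [_ /(_ (M0 + 1))]; rewrite ltrDl => /(_ ltr01) bM.
  by exists (M0 + 1) => x; exact: bM.
have M0 : 0 <= M := le_trans (normr_ge0 _) (bM 0).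
have mphi : measurable_fun [set: mR] phi by exact: continuous_measurable_fun.
have iphi (Q : probability mR R) : Q.-integrable setT (EFin \o phi).
  by apply: intg_le (intg_cst Q M) _.
pose B' := Num.max B (\int[nu]_x (x ^+ 2)).
apply/cvgrPdist_le => e e0.
(* The second entry makes [2 M B' <= N e / 8]; together with [N >= 1] this bounds [2 M B' / N^2] by
   [e / 8]. *)
have [N NP] := natr_ge (Num.max 1 (2 * M * B' / (e / 8))).
have := NP N (leqnn N); rewrite ge_max => /andP[N1 NB].
have e8 : 0 < e / 8 by rewrite divr_gt0.
have N0 : 0 < N%:R :> R by exact: lt_le_trans N1.
have [n [a [aM ap]]] := bernstein_sin_approx cphi bM e8 N0.
pose p : rat := (N%:R)^-1; pose g x := bernstein n a ((1 + sin (ratr p * x)) / 2).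
have pE : ratr p = N%:R^-1 :> R by rewrite /p fmorphV rmorph_nat.
have Cg : C g by exact: C_bernstein.
have gM x : `|g x| <= M.
  set y : R := (1 + sin (ratr p * x)) / 2.
  have y01 : 0 <= y <= 1.
    by have := sin_le1 (ratr p * x); have := sin_geN1 (ratr p * x); rewrite /y; lra.
  have := @bernstein_le R n a (fun=> M) y y01 (fun k _ => aM k).
  by have := bernstein_affine n (fun=> 0) M 0 y; rewrite !mul0r !addr0 => ->.
have gphi x : `|g x - phi x| <= 2 * (e / 8) + 2 * M / N%:R ^+ 2 * x ^+ 2.
  have [xN|/ltW xN] := leP `|x| N%:R.
    rewrite /g pE (le_trans (ap _ xN))// lerDl mulr_ge0 ?sqr_ge0//.
    by rewrite divr_ge0 ?sqr_ge0// mulr_ge0.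
  rewrite (le_trans (ler_normB _ _))// (@le_trans _ _ (2 * M * 1))//.
    by have := gM x; have := bM x; lra.
  rewrite -[leLHS]add0r lerD//; first by rewrite mulr_ge0// ltW.
  rewrite -[leRHS]mulrA ler_wpM2l ?mulr_ge0// mulrC ler_pdivlMr ?exprn_gt0// mul1r.
  by rewrite -[leRHS]real_normK ?num_real// ler_sqr ?nnegrE// ltW.
have close (Q : probability mR R) : Q.-integrable setT (EFin \o (fun x => x ^+ 2)) ->
    \int[Q]_x (x ^+ 2) <= B' -> `|\int[Q]_x g x - \int[Q]_x phi x| <= 3 * (e / 8).
  move=> iQ QB; have ig := C_intg Q Cg.
  rewrite -ExB//; last exact: iphi.
  apply: le_trans (Ex_abs_le (intgB ig (iphi Q))) _.
  pose b x := 2 * (e / 8) + 2 * M / N%:R ^+ 2 * x ^+ 2.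
  have ib1 : Q.-integrable setT (EFin \o (fun x => 2 * M / N%:R ^+ 2 * x ^+ 2)) by exact: intgZ.
  have ib0 := intg_cst Q (2 * (e / 8)).
  have ib := intgD ib0 ib1.
  rewrite (le_trans (Ex_le (intg_abs (intgB ig (iphi Q))) ib _))//.
    by apply: aeW => x; exact: gphi.
  rewrite ExD// Ex_cst ExZ//.
  have : 2 * M / N%:R ^+ 2 * \int[Q]_x (x ^+ 2) <= e / 8.
    have h1 : 2 * M / N%:R ^+ 2 * \int[Q]_x (x ^+ 2) <= 2 * M / N%:R ^+ 2 * B'.
      by rewrite ler_wpM2l// divr_ge0 ?sqr_ge0// mulr_ge0.
    rewrite (le_trans h1)// mulrAC ler_pdivrMr ?exprn_gt0//.
    have nb : 2 * M * B' <= N%:R * (e / 8) by rewrite -ler_pdivrMr.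
    rewrite (le_trans nb)// mulrC ler_wpM2l ?(ltW e8)// expr2 ler_peMr// ltW//.
  lra.
have e4 : 0 < e / 4 by rewrite divr_gt0.
have [_ _ /cvgrPdist_le /(_ _ e4)] := Cg.
apply: filterS => k hk.
have h1 : `|\int[nu]_x g x - \int[nu]_x phi x| <= 3 * (e / 8).
  by apply: close => //; rewrite le_max lexx orbT.
have h2 : `|\int[nu_ k]_x g x - \int[nu_ k]_x phi x| <= 3 * (e / 8).
  by apply: close => //; rewrite le_max B2.
rewrite (_ : _ - _ = (\int[nu]_x g x - \int[nu_ k]_x g x) -
  (\int[nu]_x g x - \int[nu]_x phi x) +
  (\int[nu_ k]_x g x - \int[nu_ k]_x phi x)); last by ring.
rewrite (le_trans (ler_normD _ _))//.
have := ler_normB (\int[nu]_x g x - \int[nu_ k]_x g x) (\int[nu]_x g x - \int[nu]_x phi x).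
lra.
Qed.

End levy_criterion.


(** * Cosine integrals and second moment of the normal law *)

Section gaussian.
Variables (R : realType) (s : R).
Hypothesis s0 : 0 < s.
Local Notation lambda := (@lebesgue_measure R).
Local Notation nu := (normal_prob 0 s : probability (measurableTypeR R) R).
Local Notation p := (normal_pdf 0 s).

(** The Radon-Nikodym derivative and [normal_pdf] have the same integral over every measurable set,
    hence agree almost everywhere. *)
Lemma integral_normal_prob (h : R -> R) (U : set R) : measurable U ->
  nu.-integrable U (EFin \o h) ->
  (\int[nu]_(x in U) (h x)%:E = \int[lambda]_(x in U) (h x * p x)%:E)%E.
Proof.
move=> mU ih.
have mh : measurable_fun U (EFin \o h) by exact: measurable_int ih.
have mp : measurable_fun U (EFin \o p).
  by apply: measurable_funTS; apply/measurable_EFinP; exact: measurable_normal_pdf.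
have dom := @normal_prob_dominates R 0 s.
have ir := @Radon_Nikodym_integrable _ _ _ (charge_of_finite_measure nu) lambda dom.
rewrite -(Radon_Nikodym_change_of_variables (normal_prob_dominates 0 s))//.
under [RHS]eq_integral do rewrite EFinM.
apply: ae_eq_integral => //.
- apply: emeasurable_funM => //; apply: measurable_funTS.
  exact: measurable_int ir.
- exact: emeasurable_funM.
- apply: ae_eqe_mul2l; apply: integral_ae_eq => //.
  + exact: integrableS ir.
  + by move=> E _ mE; rewrite -Radon_Nikodym_integral.
Qed.

Let derE (f g : R -> R) (x a b : R) : is_derive x 1 f a -> f =1 g -> a = b ->
  is_derive x 1 g b.
Proof. by move=> df /funext <- <-. Qed.

Lemma is_derive_expR_sqr (c x : R) :
  is_derive x 1 (fun y => expR (c * y ^+ 2)) (2 * c * x * expR (c * x ^+ 2)).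
Proof.
have dx : is_derive x 1 (fun y : R => c * y ^+ 2) (2 * c * x).
  apply: derE (is_deriveZ c (is_deriveM (is_derive_id x 1) (is_derive_id x 1))) _ _.
    by move=> y; rewrite /= expr2.
  by rewrite /GRing.scale/=; ring.
apply: derE (@is_derive1_comp R expR (fun y => c * y ^+ 2) x _ _ (is_derive_expR _) dx) _ _ => //.
exact: mulrC.
Qed.

Lemma is_derive_affine (g : R -> R) (g' a b x : R) : is_derive (a * x + b) 1 g g' ->
  is_derive x 1 (fun y => g (a * y + b)) (a * g').
Proof.
move=> dg; have dx : is_derive x 1 (fun y : R => a * y + b) a.
  apply: derE (is_deriveD (is_deriveZ a (is_derive_id x 1)) (is_derive_cst b x 1)) _ _ => //.
  by rewrite /GRing.scale/= mulr1 addr0.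
by apply: derE (@is_derive1_comp R g (fun y => a * y + b) x _ _ dg dx) _ _ => //; rewrite mulrC.
Qed.

Let pE (x : R) : p x = normal_peak s * expR (- (2 * s ^+ 2)^-1 * x ^+ 2).
Proof.
rewrite normal_pdfE ?gt_eqF// /normal_fun subr0; congr (_ * expR _).
by rewrite -mulr_natl; field; rewrite gt_eqF.
Qed.

Let dp (x : R) : is_derive x 1 p (- (x / s ^+ 2) * p x).
Proof.
apply: derE (is_deriveZ (normal_peak s) (is_derive_expR_sqr (- (2 * s ^+ 2)^-1) x)) _ _.
  by move=> y; rewrite /= pE.
by rewrite pE /GRing.scale/=; field; rewrite gt_eqF.
Qed.

(** From [exp z >= 1 + z]. The resulting decay of the density like [1 / n] is enough to kill bounded
    boundary terms. *)
Let p_le (n : R) : 0 < n -> n * p n <= normal_peak s * s.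
Proof.
move=> n0; rewrite pE mulrCA ler_wpM2l ?normal_peak_ge0//.
rewrite mulNr expRN ler_pdivrMr ?expR_gt0//.
have := expR_ge1Dx ((2 * s ^+ 2)^-1 * n ^+ 2).
have : n <= s * (1 + (2 * s ^+ 2)^-1 * n ^+ 2).
  rewrite (_ : s * _ = n + (s - n) ^+ 2 / (2 * s) + s / 2); last first.
    by field; rewrite gt_eqF.
  have : 0 <= (s - n) ^+ 2 / (2 * s) by rewrite divr_ge0 ?sqr_ge0// mulr_ge0// ltW.
  by have := s0; lra.
by move=> /le_trans h1 h2; apply: h1; rewrite ler_wpM2l// ltW.
Qed.

(** Stein's identity with boundary terms: the density satisfies [p' = - x p / s^2], so the integrand
    times [p] is the derivative of [G p]. *)
Lemma normal_stein_itv (G G' : R -> R) (n : R) : 0 < n ->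
  (forall x : R, is_derive x 1 G (G' x)) -> continuous G' ->
  nu.-integrable `[- n, n] (EFin \o (fun x => G' x - x / s ^+ 2 * G x)) ->
  \int[nu]_(x in `[- n, n]) (G' x - x / s ^+ 2 * G x) = G n * p n - G (- n) * p (- n).
Proof.
move=> n0 dG cG ih; rewrite /Rintegral integral_normal_prob//.
have dGp (x : R) : is_derive x 1 (fun y => G y * p y) ((G' x - x / s ^+ 2 * G x) * p x).
  apply: derE (is_deriveM (dG x) (dp x)) _ _ => //.
  by rewrite /GRing.scale/=; ring.
have cont (g g' : R -> R) : (forall x : R, is_derive x 1 g (g' x)) -> continuous g.
  by move=> dg x; apply/differentiable_continuous/derivable1_diffP; exact: ex_derive.
have cGp := cont _ _ dGp.
rewrite (@continuous_FTC2 R _ (fun y => G y * p y) (- n) n)//.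
- by rewrite gtrN.
- apply: continuous_subspaceT => x; apply: cvgM; last exact: (cont _ _ dp).
  apply: cvgB; first exact: cG.
  by apply: cvgM; [exact: cvgMl|exact: (cont _ _ dG)].
- split; first by move=> x _; exact: ex_derive.
    exact/cvg_at_right_filter/cGp.
  exact/cvg_at_left_filter/cGp.
- by move=> x _; rewrite derive1E; exact: derive_val.
Qed.

Let itv (n : nat) : set (measurableTypeR R) := `[- n.+1%:R, n.+1%:R].

Let m_itv n : measurable (itv n). Proof. exact: measurable_itv. Qed.

Let itv_cover (x : R) : exists N, forall n, (N <= n)%N -> x \in itv n.
Proof.
have [N NP] := natr_ge `|x|; exists N => n Nn.
rewrite inE /itv/= in_itv/= -ler_norml NP//; exact: leqW.
Qed.

(** Stein's identity with [G x = x] on a symmetric interval has a nonnegative boundary term, so the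
    truncated second moment is at most [s^2]; the intervals then increase to the line. *)
Lemma normal_prob_sqr : nu.-integrable setT (EFin \o (fun x => x ^+ 2)).
Proof.
have mx2 : measurable_fun [set: measurableTypeR R] (fun x : R => x ^+ 2) by exact: measurable_funX.
have bd n : (\int[nu]_(x in itv n) (x ^+ 2)%:E <= (s ^+ 2)%:E)%E.
  have ix2 : nu.-integrable (itv n) (EFin \o (fun x => x ^+ 2)).
    apply: measurable_bounded_integrable => //.
    - by rewrite (le_lt_trans (probability_le1 nu (m_itv n)))// ltry.
    - exists (n.+1%:R ^+ 2); split; first exact: num_real.
      move=> M nM x; rewrite /itv/= in_itv/= -ler_norml => xn.
      rewrite ger0_norm ?sqr_ge0// (le_trans _ (ltW nM))//.
      by rewrite -[leLHS]real_normK ?num_real// ler_sqr ?nnegrE.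
  have i1 : nu.-integrable (itv n) (EFin \o (fun=> 1 : R)).
    by apply: integrableS (intg_cst nu 1).
  have ix3 : nu.-integrable (itv n) (EFin \o (fun x => s ^- 2 * x ^+ 2)).
    exact: (integrableZl (m_itv n) (s ^- 2) ix2).
  have hE : (fun x : R => 1 - x / s ^+ 2 * x) = (fun x => 1 - s ^- 2 * x ^+ 2).
    by apply/funext => x; ring.
  have ih : nu.-integrable (itv n) (EFin \o (fun x => 1 - x / s ^+ 2 * x)).
    by rewrite hE; exact: (integrableB (m_itv n) i1 ix3).
  have n0 : 0 < n.+1%:R :> R by rewrite ltr0n.
  have := @normal_stein_itv (fun x => x) (fun=> 1) _ n0 _ _ ih.
  move=> /(_ (fun x => is_derive_id x 1) (fun x => @cst_continuous _ _ _ x)).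
  rewrite hE RintegralB// RintegralZl//.
  rewrite Rintegral_cst// mul1r => e.
  have fi : (\int[nu]_(x in itv n) (x ^+ 2)%:E \is a fin_num)%E by exact: integrable_fin_num.
  rewrite -(fineK fi) lee_fin -[X in X <= _]/(\int[nu]_(x in itv n) (x ^+ 2)).
  have pn (x : R) : 0 <= p x by exact: normal_pdf_ge0.
  have : fine (nu (itv n)) <= 1.
    by rewrite -lee_fin fineK ?fin_num_measure//; exact: probability_le1.
  have : 0 <= n.+1%:R * p n.+1%:R + n.+1%:R * p (- n.+1%:R) by rewrite addr_ge0// mulr_ge0.
  move=> h1 h2; have : s ^- 2 * \int[nu]_(x in itv n) (x ^+ 2) <= 1 by lra.
  by rewrite ler_pdivrMl ?exprn_gt0// mulr1.
apply/integrableP; split; first exact/measurable_EFinP.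
under eq_integral do rewrite /= ger0_norm ?sqr_ge0//.
have cover : \bigcup_n itv n = setT.
  apply/seteqP; split => // x _; have [N /(_ N (leqnn _))] := itv_cover x.
  by rewrite inE => ?; exists N.
have : (\int[nu]_(x in itv n) (x ^+ 2)%:E @[n --> \oo] -->
    \int[nu]_(x in \bigcup_n itv n) (x ^+ 2)%:E)%E.
  apply: ge0_nondecreasing_set_cvg_integral => [i j ij|//|i|i x _].
  - apply/subsetPset => x; rewrite /itv/= !in_itv/= -!ler_norml => /le_trans; apply.
    by rewrite ler_nat.
  - by apply/measurable_EFinP; exact: (measurable_funTS mx2).
  - by rewrite lee_fin sqr_ge0.
rewrite cover => cv; rewrite (@le_lt_trans _ _ (s ^+ 2)%:E) ?ltry//.
by apply: (cvge_le _ cv); apply: nearW => n; exact: bd.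
Qed.

Let cvg_itv (h : R -> R) : nu.-integrable setT (EFin \o h) ->
  \int[nu]_(x in itv n) h x @[n --> \oo] --> \int[nu]_x h x.
Proof.
move=> ih; have mh := intg_meas ih.
apply: (eq_cvgn (fun n => esym (Rintegral_indicM nu h (m_itv n)))).
apply: (proj2 (@Ex_dct _ _ _ nu (fun n x => \1_(itv n) x * h x) h (fun x => `|h x|) _ _ _ _ _)).
- by move=> n; apply: measurable_funM.
- exact: mh.
- exact: intg_abs.
- apply: aeW => x; have [N NP] := itv_cover x.
  apply: cvg_near_cst; exists N => // n /NP nP.
  by rewrite /= indicE nP mul1r.
- move=> n; apply: aeW => x; rewrite normrM indicE; case: (_ \in _) => /=.
    by rewrite normr1 mul1r.
  by rewrite normr0 mul0r.
Qed.

Let c_meas (t th : R) : measurable_fun [set: measurableTypeR R] (fun x => cos (t * x + th)).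
Proof.
apply: continuous_measurable_fun => x.
apply: continuous_comp; last exact: continuous_cos.
by apply: cvgD; [exact: cvgMr|exact: cvg_cst].
Qed.

Let s_meas (t th : R) : measurable_fun [set: measurableTypeR R] (fun x => sin (t * x + th)).
Proof.
apply: continuous_measurable_fun => x.
apply: continuous_comp; last exact: continuous_sin.
by apply: cvgD; [exact: cvgMr|exact: cvg_cst].
Qed.

Let c_int t th : nu.-integrable setT (EFin \o (fun x => cos (t * x + th))).
Proof.
apply: intg_le (intg_cst nu 1) _ => // x.
by rewrite ler_norml cos_geN1 cos_le1.
Qed.

Let x_int : nu.-integrable setT (EFin \o (fun x => `|x|)).
Proof.
apply: (intg_le _ (intgD (intg_cst nu 1) normal_prob_sqr)) => [|x].
  exact: normr_measurable.
rewrite normr_id; have := sqr_ge0 (`|x| - 1); rewrite sqrrB1 real_normK ?num_real//.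
by have := normr_ge0 x; lra.
Qed.

Let xs_int t th : nu.-integrable setT (EFin \o (fun x => x * sin (t * x + th))).
Proof.
apply: intg_le x_int _ => [|x]; first exact: measurable_funM.
by rewrite normrM ler_piMr// ler_norml sin_geN1 sin_le1.
Qed.

Lemma normal_stein_sin (t th : R) :
  \int[nu]_x (x * sin (t * x + th)) = s ^+ 2 * t * \int[nu]_x cos (t * x + th).
Proof.
pose h x : R := t * cos (t * x + th) - x / s ^+ 2 * sin (t * x + th).
have hE x : h x = t * cos (t * x + th) - s ^- 2 * (x * sin (t * x + th)).
  by rewrite /h; ring.
have ih : nu.-integrable setT (EFin \o h).
  by rewrite (funext hE); apply: intgB; apply: intgZ; [exact: c_int|exact: xs_int].
have h0 : \int[nu]_x h x = 0.
  apply: (cvg_unique (@Rhausdorff R) (cvg_itv ih)).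
  have E n : \int[nu]_(x in itv n) h x =
      sin (t * n.+1%:R + th) * p n.+1%:R - sin (t * - n.+1%:R + th) * p (- n.+1%:R).
    apply: normal_stein_itv.
    - by rewrite ltr0n.
    - by move=> x; apply: is_derive_affine.
    - move=> x; apply: cvgM; first exact: cvg_cst.
      apply: continuous_comp; last exact: continuous_cos.
      by apply: cvgD; [exact: cvgMr|exact: cvg_cst].
    - exact: integrableS ih.
  apply: (eq_cvgn (fun n => esym (E n))).
  apply/norm_cvg0P.
  have hb n : `|sin (t * n.+1%:R + th) * p n.+1%:R - sin (t * - n.+1%:R + th) * p (- n.+1%:R)| <=
      2 * (normal_peak s * s) * n.+1%:R^-1.
    have n0 : 0 < n.+1%:R :> R by rewrite ltr0n.
    have pN : p (- n.+1%:R) = p n.+1%:R by rewrite !pE sqrrN.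
    have pn (x : R) : 0 <= p x by exact: normal_pdf_ge0.
    have := p_le n0; rewrite mulrC -ler_pdivlMr// => h1.
    rewrite (le_trans (ler_normB _ _))// !normrM pN (ger0_norm (pn _)).
    have h2 (x : R) : `|sin x| * p n.+1%:R <= p n.+1%:R.
      by rewrite ler_piMl// ler_norml sin_geN1 sin_le1.
    have := h2 (t * n.+1%:R + th); have := h2 (t * - n.+1%:R + th).
    rewrite -mulrA mulr_natl mulr2n => a b; apply: lerD; [exact: (le_trans b h1)|exact: (le_trans a h1)].
  apply: (@squeeze_cvgr _ _ _ _ (fun=> 0) (fun n => 2 * (normal_peak s * s) * n.+1%:R^-1)).
  - by apply: nearW => n; rewrite normr_ge0 hb.
  - exact: cvg_cst.
  - by rewrite -[X in _ --> X](mulr0 (2 * (normal_peak s * s))); apply: cvgMr; exact: cvg_harmonic.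
move: h0; have ic := c_int t th; have ix := xs_int t th.
rewrite (funext hE) ExB; [|exact: (intgZ _ ic)|exact: (intgZ _ ix)].
rewrite !ExZ// => /eqP; rewrite subr_eq0 => /eqP e.
by rewrite -mulrA e mulrA divff ?mul1r// gt_eqF// exprn_gt0.
Qed.

(** As a function of [t] the integral [C] solves [C' = - s^2 t C], by differentiation under the
    integral (dominated by [|x|]) and [normal_stein_sin]. Hence [exp (s^2 t^2 / 2) C t] is
    constant. *)
Lemma normal_cos (t th : R) :
  \int[nu]_x cos (t * x + th) = expR (- (s ^+ 2 * t ^+ 2 / 2)) * cos th.
Proof.
pose C t := \int[nu]_x cos (t * x + th).
have df (x u : R) : is_derive u 1 (fun u => cos (u * x + th)) (- (x * sin (u * x + th))).
  have d : is_derive u 1 (fun u => cos (x * u + th)) (x * - sin (x * u + th)).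
    by apply: is_derive_affine.
  by apply: derE d _ _ => [v|]; [rewrite mulrC|rewrite mulrN (mulrC x u)].
have dC (u : R) : is_derive u 1 C (- (s ^+ 2 * u * C u)).
  have Iu : `]u - 1, u + 1[%classic u by rewrite /= in_itv/=; lra.
  have c1 (v : R) : `]u - 1, u + 1[%classic v -> nu.-integrable setT (EFin \o (fun x : R => cos (v * x + th))).
    by move=> _; exact: c_int.
  have c2 (v x : R) : `]u - 1, u + 1[%classic v -> setT x -> derivable (fun u : R => cos (u * x + th)) v 1.
    by move=> _ _; exact: ex_derive.
  have d1 (v x : R) : partial1of2 (fun u x : R => cos (u * x + th)) v x = - (x * sin (v * x + th)).
    by rewrite partial1of2E; exact: derive_val.
  have c3 (v x : R) : `]u - 1, u + 1[%classic v -> setT x ->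
      `|partial1of2 (fun u x : R => cos (u * x + th)) v x| <= `|x|.
    by move=> _ _; rewrite d1 normrN normrM ler_piMr// ler_norml sin_geN1 sin_le1.
  have D := derivable_under_integral measurableT Iu c1 c2 (fun x => normr_ge0 x) x_int c3.
  have V := differentiation_under_integral measurableT Iu c1 c2 (fun x => normr_ge0 x) x_int c3.
  apply: DeriveDef; first exact: D.
  rewrite -derive1E V.
  rewrite (_ : - _ = - \int[nu]_x (x * sin (u * x + th))); last by rewrite normal_stein_sin.
  rewrite -ExN; last exact: xs_int.
  by apply: eq_Rintegral => x _; exact: d1.
pose D u := expR (s ^+ 2 / 2 * u ^+ 2) * C u.
have dD (u : R) : is_derive u 1 D 0.
  apply: derE (is_deriveM (is_derive_expR_sqr (s ^+ 2 / 2) u) (dC u)) _ _ => //.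
  by rewrite /GRing.scale/=; field.
have : D t = D 0 by exact: is_derive_0_is_cst.
have C0 : C 0 = cos th.
  by rewrite /C; under eq_Rintegral do rewrite mul0r add0r; rewrite Ex_cst.
rewrite /D C0 expr0n mulr0 expR0 mul1r => <-; rewrite mulrA -expRD (_ : _ + _ = 0).
  by rewrite expR0 mul1r.
by ring.
Qed.

End gaussian.


(** * Translation of the hypotheses and conclusion *)

Section square_norm.
Context d (T : measurableType d) (R : realType) (P : probability T R).

Lemma finite_Lnorm2 (g : T -> R) : measurable_fun setT g ->
  ('N[P]_2%:E[EFin \o g] < +oo)%E ->
  P.-integrable setT (EFin \o (fun w => g w ^+ 2)) /\
  Rintegral P setT (fun w => g w ^+ 2) = fine 'N[P]_2%:E[EFin \o g] ^+ 2.
Proof.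
move=> mg goo.
have gfin : ('N[P]_2%:E[EFin \o g] \is a fin_num)%E by rewrite ge0_fin_numE// Lnorm_ge0.
have e : (\int[P]_w (g w ^+ 2)%:E = (fine 'N[P]_2%:E[EFin \o g] ^+ 2)%:E)%E.
  have n0 : 0 <= fine 'N[P]_2%:E[EFin \o g] by rewrite fine_ge0// Lnorm_ge0.
  transitivity ('N[P]_2%:E[EFin \o g] `^ 2)%E.
    rewrite poweR_Lnorm//; apply: eq_integral => w _.
    by rewrite /= powR_mulrn// real_normK ?num_real.
  by rewrite -(fineK gfin)/= powR_mulrn.
split; last by rewrite /Rintegral e.
apply/integrableP; split; first by apply/measurable_EFinP; exact: measurable_funX.
under eq_integral do rewrite /= ger0_norm ?sqr_ge0//.
by rewrite e ltry.
Qed.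

End square_norm.

Lemma esum_neg_int (R : realType) (u : int -> \bar R) : (forall i, 0 <= u i)%E ->
  (\esum_(i in [set i : int | (i <= 0)%R]) u i = \sum_(j <oo) u (- j%:Z)%R)%E.
Proof.
move=> u0; rewrite nneseries_esumT//; apply: reindex_esum.
split => [j _|i j _ _ /oppr_inj[]//|i /= i0].
  by rewrite /= oppr_le0.
by exists `|i|%N => //; rewrite lez0_abs ?opprK.
Qed.

Lemma ae_forall_count d (T : measurableType d) (R : realType) (P : {measure set T -> \bar R})
    (I : countType) (Q : I -> T -> Prop) :
  (forall i, {ae P, forall w, Q i w}) -> {ae P, forall w, forall i, Q i w}.
Proof.
move=> hQ; have : {ae P, forall w, forall n : nat, if unpickle n is Some i then Q i w else True}.
  apply: ae_foralln => n; case: unpickle => [i|]; [exact: hQ|exact: aeW].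
by apply: filterS => w h i; have := h (pickle i); rewrite pickleK.
Qed.

Lemma normal_law_cos (R : realType) (s t th : R) : 0 <= s ->
  \int[normal_law 0 s]_x cos (t * x + th) = expR (- (s ^+ 2 * t ^+ 2 / 2)) * cos th.
Proof.
move=> s0; rewrite /normal_law; have [->|sn] := eqVneq s 0; last first.
  by apply: normal_cos; rewrite lt_neqAle eq_sym sn.
rewrite /Rintegral integral_dirac//.
  by rewrite diracT mul1e/= mulr0 add0r expr0n !mul0r oppr0 expR0 mul1r.
apply/measurable_EFinP; apply: continuous_measurable_fun => x.
apply: continuous_comp; last exact: continuous_cos.
by apply: cvgD; [exact: cvgMr|exact: cvg_cst].
Qed.

Lemma normal_law_sqr (R : realType) (s : R) : 0 <= s ->
  (normal_law 0 s).-integrable setT (EFin \o (fun x => x ^+ 2)).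
Proof.
move=> s0; rewrite /normal_law; have [_|sn] := eqVneq s 0; last first.
  by apply: normal_prob_sqr; rewrite lt_neqAle eq_sym sn.
have mx2 : measurable_fun [set: measurableTypeR R] (fun x : R => x ^+ 2) by exact: measurable_funX.
apply/integrableP; split; first exact/measurable_EFinP.
rewrite integral_dirac//; last by apply: measurableT_comp => //; exact/measurable_EFinP.
by rewrite diracT mul1e/= ltry.
Qed.

Theorem theorem1 (R : realType) (d : measure_display)
    (Omega : measurableType d) (mu : probability Omega R) (T : Omega -> Omega)
    (F : int -> set (set Omega)) (f : Omega -> R)
    (T_invertible : invertible T)
    (T_mp : measure_preserving mu T)
    (T_ergodic : ergodic mu T)
    (F_sub : forall i, sigma_algebra setT (F i) /\ F i `<=` measurable)
    (F_incr : forall i, F i `<=` F (i + 1))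
    (F_shift : forall i, F (i + 1) = preimage_set_system setT T (F i))
    (f_L2 : f \in Lfun mu 2%:E)
    (f_mean0 : (\int[mu]_w (f w)%:E = 0)%E)
    (f_F0 : measurable_wrt (F 0) f)
    (f_tail : {ae mu, forall w, cond_exp mu (\bigcap_i F i) f w = 0})
    (f_sum : (\esum_(i in [set i : int | (i <= 0)%R])
                'N[mu]_2%:E[EFin \o proj_diff mu F i f] < +oo)%E) :
  exists m s : R, 0 <= s /\
    forall k : nat -> R.-pker (g_sigma_algebraType (F 0)) ~> (measurableTypeR R),
      (forall n, (0 < n)%N ->
        is_cond_distribution mu
          (fun w => (birkhoff_sum T f n w -
                     cond_exp mu (F 0) (birkhoff_sum T f n) w)
                    / Num.sqrt n%:R)
          (k n)) ->
      {ae mu, forall w, weak_cvg (fun n => k n w) (normal_law m s)}.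
Proof.
have ef : ergodic_filtration mu T F by split.
have if_ : mu.-integrable setT (EFin \o f).
  by apply/Lfun1_integrable/(Lfun_subset12 _ f_L2); exact: fin_num_measure.
pose pd j := proj_diff mu F (- j%:Z) f.
pose N j := ('N[mu]_2%:E[EFin \o pd j])%E.
have N0 j : (0 <= N j)%E by exact: Lnorm_ge0.
have mpd j : measurable_fun setT (pd j).
  have m i : measurable_fun setT (cond_exp mu (F i) f).
    have [? _ _] := cond_expP (proj2 (F_sub i)) if_.
    exact: (wrt_measurable (proj2 (F_sub i))).
  exact: measurable_funB.
have N_sum : (\sum_(j <oo) N j < +oo)%E.
  by rewrite -(esum_neg_int (fun i => Lnorm_ge0 mu 2%:E (EFin \o proj_diff mu F i f))).
have N_le n : (\sum_(0 <= j < n) N j <= \sum_(j <oo) N j)%E by exact: nneseries_lim_ge.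
have Nfin j : (N j < +oo)%E.
  rewrite (le_lt_trans _ N_sum)// (le_trans _ (N_le j.+1))//.
  by rewrite big_nat_recr//= leeDr// sume_ge0.
have pd2 j := finite_Lnorm2 (mpd j) (Nfin j).
have aA n : \sum_(0 <= j < n) fine (N j) <= fine (\sum_(j <oo) N j)%E.
  rewrite -lee_fin fineK ?ge0_fin_numE ?nneseries_ge0// (le_trans _ (N_le n))//.
  by rewrite -sumEFin; apply: lee_sum => j _; rewrite fineK// ge0_fin_numE.
have pda j : Rintegral mu setT (fun w => pd j w ^+ 2) <= fine (N j) ^+ 2.
  by rewrite (proj2 (pd2 j)).
have [s2 [s20 cf iW2 W2]] := hannan_quenched ef if_ f_F0 (fun j => proj1 (pd2 j))
  (fun j => fine_ge0 (N0 j)) pda aA.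
(* The second parameter of [normal_law] is a standard deviation. *)
pose s := Num.sqrt s2; have s0 : 0 <= s by exact: sqrtr_ge0.
have s2E : s ^+ 2 = s2 by exact: sqr_sqrtr.
exists 0, s; split => // k kP.
pose E0 := cond_exp mu (F 0).
pose W n w := birkhoff_sum T f n w - E0 (birkhoff_sum T f n) w.
pose X n w := W n w / Num.sqrt n%:R.
have G0 := proj2 (F_sub 0).
have iS n : mu.-integrable setT (EFin \o birkhoff_sum T f n).
  by rewrite /birkhoff_sum; apply: intg_sum => i; exact: (intg_iter ef i if_).
have mW n : measurable_fun setT (W n).
  have [m _ _] := cond_expP G0 (iS n).
  by apply: measurable_funB; [exact: (intg_meas (iS n))|exact: (wrt_measurable G0)].
have mX n : measurable_fun setT (X n) by exact: measurable_funM.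
have X2E n w : X n.+1 w ^+ 2 = n.+1%:R^-1 * W n.+1 w ^+ 2.
  by rewrite /X exprMn exprVn sqr_sqrtr// mulrC.
have iX2 n : mu.-integrable setT (EFin \o (fun w => X n.+1 w ^+ 2)).
  by rewrite (funext (X2E n)); apply: intgZ; exact: iW2.
have EX2 : {ae mu, forall w, forall n,
    E0 (fun w => X n.+1 w ^+ 2) w = n.+1%:R^-1 * E0 (fun w => W n.+1 w ^+ 2) w}.
  apply: ae_foralln => n; rewrite (funext (X2E n)).
  apply: (E0_unique ef); first by apply: intgZ; exact: iW2.
  have iW := iW2 n.+1; apply: is_cond_expZ => //; exact: (cond_expP G0 iW).
(* The family of indices is countable, so one null set serves all of them. The kernels are taken
   from index one on, where [kP] applies. *)
have k_cos : {ae mu, forall w, forall i : nat * rat * nat,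
    \int[k i.1.1.+1 w]_x cos (ratr i.1.2 * x - i.2%:R * (pi / 2)) =
    E0 (fun w => cos (ratr i.1.2 * X i.1.1.+1 w - i.2%:R * (pi / 2))) w}.
  apply: ae_forall_count => i.
  exact: (cond_distribution_cos G0 (mX _) (kP _ (ltn0Sn _))).
have cf' : {ae mu, forall w, forall i : rat * nat,
    E0 (fun w => cos (ratr i.1 * X n w - i.2%:R * (pi / 2))) w @[n --> \oo] -->
    expR (- (s2 * ratr i.1 ^+ 2 / 2)) * cos (- (i.2%:R * (pi / 2)))}.
  by apply: ae_forall_count => i; exact: cf.
have k_sqr : {ae mu, forall w, forall n,
    (k n.+1 w).-integrable setT (EFin \o (fun x => x ^+ 2)) /\
    \int[k n.+1 w]_x (x ^+ 2) = E0 (fun w => X n.+1 w ^+ 2) w}.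
  apply: ae_foralln => n.
  apply: (cond_distribution_cond_exp G0 (mX _) (kP _ (ltn0Sn _)) _ _ (iX2 n)).
    by move=> x; exact: sqr_ge0.
  exact: measurable_funX.
suff : {ae mu, forall w : Omega, weak_cvg (fun n => k n w) (normal_law 0 s)} by [].
near=> w.
have [B BP] : exists B : R, forall n, E0 (fun w => W n.+1 w ^+ 2) w / n.+1%:R <= B.
  by near: w.
have hX2 n : E0 (fun w => X n.+1 w ^+ 2) w = n.+1%:R^-1 * E0 (fun w => W n.+1 w ^+ 2) w.
  by move: n; near: w.
have hk n q j : \int[k n.+1 w]_x cos (ratr q * x - j%:R * (pi / 2)) =
    E0 (fun w => cos (ratr q * X n.+1 w - j%:R * (pi / 2))) w.
  suff H : forall i : nat * rat * nat,
    \int[k i.1.1.+1 w]_x cos (ratr i.1.2 * x - i.2%:R * (pi / 2)) =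
    E0 (fun w => cos (ratr i.1.2 * X i.1.1.+1 w - i.2%:R * (pi / 2))) w by exact: (H (n, q, j)).
  by near: w.
have hcf q j : E0 (fun w => cos (ratr q * X n w - j%:R * (pi / 2))) w @[n --> \oo] -->
    expR (- (s2 * ratr q ^+ 2 / 2)) * cos (- (j%:R * (pi / 2))).
  suff H : forall i : rat * nat,
    E0 (fun w => cos (ratr i.1 * X n w - i.2%:R * (pi / 2))) w @[n --> \oo] -->
    expR (- (s2 * ratr i.1 ^+ 2 / 2)) * cos (- (i.2%:R * (pi / 2))) by exact: (H (q, j)).
  by near: w.
have hsqr n : (k n.+1 w).-integrable setT (EFin \o (fun x => x ^+ 2)) /\
    \int[k n.+1 w]_x (x ^+ 2) = E0 (fun w => X n.+1 w ^+ 2) w.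
  by move: n; near: w.
have /choice[Q QE] : forall n, exists Q : probability (measurableTypeR R) R,
    (Q : {measure set _ -> \bar R}) = k n.+1 w.
  by move=> n; apply: probability_of_measure; exact: prob_kernel.
have weak : weak_cvg Q (normal_law 0 s).
  apply: (@levy_criterion R Q (normal_law 0 s) _ B).
  - move=> q j; rewrite normal_law_cos// s2E.
    apply: (eq_cvgn (u := fun n => E0 (fun w => cos (ratr q * X n.+1 w - j%:R * (pi / 2))) w)).
      by move=> n; rewrite QE hk.
    by rewrite (cvg_shiftS (fun n => E0 (fun w => cos (ratr q * X n w - j%:R * (pi / 2))) w)).
  - by move=> n; have := (hsqr n).1; rewrite -QE.
  - by move=> n; rewrite QE (hsqr n).2 hX2 mulrC.
  - exact: normal_law_sqr.
move=> phi cphi bphi.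
rewrite -(cvg_shiftS (fun n => \int[k n w]_x phi x)).
by apply: (eq_cvgn _ (weak phi cphi bphi)) => n; rewrite QE.
Unshelve. all: by end_near. Qed.
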